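(* Let $\mu$ be a $\boxtimes$-infinitely divisible probability measure on $(0,\infty)$, and let $v_\mu$ be the analytic function on $\mathbb{C}\setminus[0,\infty)$ associated with $\mu$ (so that $\Sigma_\mu=e^{v_\mu}$ on $(-\infty,0)$; see context). Let $\Omega=\{z\in\mathbb{C}:\Re z<0\}\cup\{z\in\mathbb{C}:\Im z<0\}$. Assume that $v_\mu|_{\Omega}$ extends to a continuous function on $\Omega\cup I$, where $I\subset\mathbb{R}$ is an open interval containing $1$, and that the value of this extension at $1$, written $v_\mu(1)=-\beta+\mathrm{i}\gamma$ with $\beta,\gamma\in\mathbb{R}$, lies in the open upper half-plane, i.e. $\gamma>0$. Then for every compact set $K\subset(0,\infty)$ the measure $(\mu^{\boxtimes t})^{1/t}$ is Lebesgue absolutely continuous on $K$ for all sufficiently small $t>0$, and $$\frac{d(\mu^{\boxtimes t})^{1/t}}{dx}(x)\longrightarrow\frac{\gamma}{\pi x\,[(\log x-\beta)^2+\gamma^2]}\qquad\text{as } t\downarrow0$$ uniformly for $x\in K$. In particular, $(\mu^{\boxtimes t})^{1/t}$ converges weakly, as $t\downarrow 0$, to the law of $e^{\mathbf{C}_{\beta,\gamma}}$, where $\mathbf{C}_{\beta,\gamma}$ is a random variable having the Cauchy distribution with density $\frac{\gamma}{\pi}\frac{1}{(x-\beta)^2+\gamma^2}$ on $\mathbb{R}$.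
   Context: For a probability measure $\mu\ne\delta_0$ on $[0,\infty)$ let $G_\mu(z)=\int\frac{\mu(dx)}{z-x}$, $F_\mu=1/G_\mu$ and $\eta_\mu(z)=1-zF_\mu(1/z)$. The function $\eta_\mu$ is strictly increasing on $(-\infty,0)$ with $\eta_\mu(0-)=0$ and $\eta_\mu(-\infty)=1-1/\mu(\{0\})$ (equal to $-\infty$ if $\mu(\{0\})=0$), and the $\Sigma$-transform is $\Sigma_\mu(z)=\eta_\mu^{-1}(z)/z$ for $1-1/\mu(\{0\})<z<0$. The multiplicative free convolution $\mu\boxtimes\nu$ is the law of $X^{1/2}YX^{1/2}$ for free nonnegative $X,Y$ with laws $\mu,\nu$; it satisfies $\Sigma_{\mu\boxtimes\nu}=\Sigma_\mu\Sigma_\nu$ on some interval $(-c,0)$. A measure $\mu$ is $\boxtimes$-infinitely divisible if for each $n\in\mathbb{N}$ there is a probability measure $\mu_n$ on $[0,\infty)$ whose $n$-fold $\boxtimes$-convolution is $\mu$. Known characterization (Bercovici–Voiculescu): $\mu$ on $(0,\infty)$ is $\boxtimes$-infinitely divisible iff there is a (unique) analytic function $v_\mu$ on $\mathbb{C}\setminus[0,\infty)$ with $v_\mu(\bar z)=\overline{v_\mu(z)}$, mapping the open lower half-plane into $\{\Im w\ge 0\}$, and with $\Sigma_\mu(z)=e^{v_\mu(z)}$ for $z\in(-\infty,0)$. In that case, for every $t\ge0$, $\mu^{\boxtimes t}$ denotes the unique probability measure on $(0,\infty)$ with $\Sigma_{\mu^{\boxtimes t}}=\Sigma_\mu^t=e^{tv_\mu}$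 on $(-\infty,0)$. For a measure $\nu$ on $(0,\infty)$ and $p\in\mathbb{R}$, $\nu^p$ is the push-forward of $\nu$ by $x\mapsto x^p$. *)

(* Defs.v *)
From HB Require Import structures.
From mathcomp Require Export all_boot all_order all_algebra.
From mathcomp Require Export all_classical all_reals all_analysis.
From mathcomp Require Export measurable_realfun complex.

Set Implicit Arguments.
Unset Strict Implicit.
Unset Printing Implicit Defensive.

Import Order.TTheory GRing.Theory Num.Theory.
Import numFieldNormedType.Exports.

Local Open Scope classical_set_scope.
Local Open Scope ring_scope.
Local Open Scope complex_scope.

(* Probability measures on [0, +oo[ (or ]0, +oo[) are represented by Borel
   probability measures on R giving mass 1 to that interval. *)
Notation borel_prob R := (probability (measurableTypeR R) R).

(* The complex field with its usual topology and normed space structure;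
   R[i] itself carries no topology in the libraries. *)
Notation Cplx R := (R[i]^o).

Section transforms.
Context {R : realType}.
Implicit Types (mu : borel_prob R) (z w : R).

Definition cauchy_transform mu z : R := \int[mu]_x (z - x)^-1.

Definition F_transform mu z : R := (cauchy_transform mu z)^-1.

Definition eta_transform mu z : R := 1 - z * F_transform mu z^-1.

(* Inverse of the restriction of eta_mu to ]-oo, 0[, 0 outside its range. *)
Definition eta_inv mu z : R := xget 0 [set w | w < 0 /\ eta_transform mu w = z].

Definition Sigma_transform mu z : R := eta_inv mu z / z.

End transforms.

Section hilbert.
Context {R : realType} {H : completeNormedModType R[i]}.
Implicit Types (dot : H -> H -> R[i]) (S T X Y A : set (H * H)).

(* Linear in the first argument, conjugate linear in the second, and inducing
   the norm of H (which takes its values in the nonnegative elements of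
   R[i]). *)
Definition inner_product dot : Prop :=
  [/\ forall (a : R[i]) x y z, dot (a *: x + y) z = a * dot x z + dot y z,
      forall x y, dot y x = (dot x y)^* &
      forall x, dot x x = `|x| ^+ 2].

Definition bounded_operator (u : H -> H) : Prop := linear u /\ continuous u.

(* Unbounded operators are represented by their graphs. *)

Definition op_domain T : set H := [set x | exists y, T (x, y)].

Definition op_adjoint dot T : set (H * H) :=
  [set p | forall q, T q -> dot q.2 p.1 = dot q.1 p.2].

Definition op_comp S T : set (H * H) :=
  [set p | exists y, T (p.1, y) /\ S (y, p.2)].

Definition selfadjoint dot T : Prop :=
  dense (op_domain T) /\ op_adjoint dot T = T.

Definition positive_selfadjoint dot T : Prop :=
  selfadjoint dot T /\ forall p, T p -> 0 <= dot p.2 p.1.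

(* E is the spectral measure of T, i.e. T is the integral of l dE(l): the domain
   of T is the set of x such that l is square integrable for the measure
   <E(.)x, x>, and <Tx, x> is the integral of l for this measure. Countable
   additivity of E is contained in the requirement that all the <E(.)x, x> are
   measures. *)
Definition spectral_measure dot (E : set (measurableTypeR R) -> H -> H) T :
    Prop :=
  [/\ forall B, measurable B ->
        [/\ bounded_operator (E B), forall x, E B (E B x) = E B x &
            forall x y, dot (E B x) y = dot x (E B y)],
      forall x, E setT x = x,
      forall B C, measurable B -> measurable C ->
        forall x, E (B `&` C) x = E B (E C x) &
      forall x : H, exists m : {finite_measure set (measurableTypeR R) -> \bar R},
        [/\ forall B, measurable B -> dot (E B x) x = (fine (m B))%:C,
            op_domain T x <-> (\int[m]_l (l ^+ 2)%:E < +oo)%E &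
            forall y, T (x, y) -> dot y x = (\int[m]_l l)%:C]].

(* rho is the law of the self-adjoint operator T in the vector state
   <. xi, xi>. *)
Definition spectral_law dot (xi : H) T (rho : borel_prob R) : Prop :=
  exists E, spectral_measure dot E T /\
    forall B, measurable B -> dot (E B xi) xi = (fine (rho B))%:C.

Definition commutant (M : set (H -> H)) : set (H -> H) :=
  [set u | bounded_operator u /\ forall a, M a -> forall x, u (a x) = a (u x)].

Definition von_neumann_algebra dot (M : set (H -> H)) : Prop :=
  (forall a, M a ->
     exists2 b, M b & forall x y, dot (a x) y = dot x (b y)) /\
  commutant (commutant M) = M.

(* Bounded operators u with uT contained in Tu. *)
Definition op_commutant T : set (H -> H) :=
  [set u | bounded_operator u /\ forall x y, T (x, y) -> T (u x, u y)].

Definition affiliated (M : set (H -> H)) T : Prop :=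
  commutant M `<=` op_commutant T.

(* For T self-adjoint, op_commutant T is stable under adjunction, and its
   commutant is the smallest von Neumann algebra to which T is affiliated. *)
Definition generated_vna T : set (H -> H) := commutant (op_commutant T).

(* A von Neumann algebra with a faithful normal tracial state, represented (as is
   always possible, by the GNS construction) so that this state is a vector
   state tau(a) = <a xi, xi>; such a state is automatically normal. *)
Definition tracial_probability_space dot (M : set (H -> H)) (xi : H) : Prop :=
  [/\ inner_product dot,
      von_neumann_algebra dot M,
      `|xi| = 1,
      forall a b, M a -> M b -> dot (a (b xi)) xi = dot (b (a xi)) xi &
      forall a, M a -> a xi = 0 -> forall x, a x = 0].

(* Freeness of the algebras A1, A2 for the state <. xi, xi>: the state
   vanishes at a_0 a_1 ... a_(n-1), n >= 1, whenever all the a_j are centered and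
   come alternately from A1 and A2 (starting with either of them). *)
Definition free_algebras dot (xi : H) (A1 A2 : set (H -> H)) : Prop :=
  forall (s : seq (H -> H)) (b : bool), (0 < size s)%N ->
    (forall j, (j < size s)%N ->
       (if b (+) odd j then A1 else A2) (nth id s j) /\
       dot (nth id s j xi) xi = 0) ->
    dot (foldr (fun a c => a \o c) id s xi) xi = 0.

End hilbert.

Section free_convolution.
Context {R : realType}.
Implicit Types mu nu rho : borel_prob R.

(* rho is the free multiplicative convolution mu [x] nu, i.e. the law of
   X^(1/2) Y X^(1/2) for free positive operators X, Y, affiliated with a tracial
   probability space, with laws mu and nu. Here A = X^(1/2); the product of
   affiliated operators is, as usual, the closure of their composition. *)
Definition is_free_mult_conv mu nu rho : Prop :=
  exists (H : completeNormedModType R[i]) (dot : H -> H -> R[i])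
         (M : set (H -> H)) (xi : H) (X Y A : set (H * H)),
    [/\ tracial_probability_space dot M xi,
        [/\ positive_selfadjoint dot X, affiliated M X &
            spectral_law dot xi X mu],
        [/\ positive_selfadjoint dot Y, affiliated M Y &
            spectral_law dot xi Y nu],
        free_algebras dot xi (generated_vna X) (generated_vna Y) &
        [/\ positive_selfadjoint dot A, op_comp A A = X &
            spectral_law dot xi (closure (op_comp A (op_comp Y A))) rho]].

(* rho is the (n+1)-fold [x]-convolution of mu. *)
Fixpoint is_free_mult_conv_iter mu (n : nat) rho : Prop :=
  if n is n'.+1 then
    exists sigma, is_free_mult_conv_iter mu n' sigma /\
                  is_free_mult_conv sigma mu rho
  else forall B, measurable B -> rho B = mu B.

Definition free_mult_inf_divisible mu : Prop :=
  forall n : nat, exists mu_n : borel_prob R,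
    mu_n `[0, +oo[%classic = 1%E /\ is_free_mult_conv_iter mu_n n mu.

End free_convolution.

Section levy_khintchine.
Context {R : realType}.
Implicit Types (mu nu : borel_prob R) (v : Cplx R -> Cplx R).

Definition expC (z : R[i]) : R[i] :=
  (expR (complex.Re z))%:C * (cos (complex.Im z) +i* sin (complex.Im z)).

Definition analytic_on (D : set (Cplx R)) (f : Cplx R -> Cplx R) : Prop :=
  forall z0, D z0 -> exists (a : nat -> Cplx R) (r : R), 0 < r /\
    forall z : Cplx R, `|z - z0| < r%:C ->
      series (fun n => a n * (z - z0) ^+ n : Cplx R) n @[n --> \oo] --> f z.

(* In R[i], 0 <= z means that z is real and nonnegative. *)
Definition slit_plane : set (Cplx R) := [set z | ~~ (0 <= z)].

Definition Omega : set (Cplx R) :=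
  [set z | complex.Re z < 0] `|` [set z | complex.Im z < 0].

(* The last condition determines v on ]-oo, 0[, as v is real there by the second
   one. *)
Definition is_v_function mu v : Prop :=
  [/\ analytic_on slit_plane v,
      forall z, slit_plane z -> v (z^*) = (v z)^*,
      forall z, complex.Im z < 0 -> 0 <= complex.Im (v z) &
      forall z : R, z < 0 -> (Sigma_transform mu z)%:C = expC (v z%:C)].

(* nu = mu^([x] t), for mu a [x]-infinitely divisible measure on ]0, +oo[, where
   Sigma_mu > 0; `^ is the real power. *)
Definition is_free_mult_power mu (t : R) nu : Prop :=
  nu `]0, +oo[%classic = 1%E /\
  forall z : R, z < 0 -> Sigma_transform nu z = Sigma_transform mu z `^ t.

End levy_khintchine.

Section limit_law.
Context {R : realType}.

Definition power_fun (p : R) (x : measurableTypeR R) : measurableTypeR R :=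
  x `^ p.

HB.instance Definition _ (p : R) :=
  isMeasurableFun.Build _ _ _ _ (power_fun p) (@measurable_powR R p).

Definition exp_fun (x : measurableTypeR R) : measurableTypeR R := expR x.

HB.instance Definition _ :=
  isMeasurableFun.Build _ _ _ _ exp_fun (@measurable_expR R).

Definition power_law (nu : borel_prob R) (p : R) : borel_prob R :=
  distribution nu (power_fun p).

Definition abs_continuous_on (K : set R) (m : borel_prob R) : Prop :=
  forall B : set R, measurable B -> B `<=` K ->
    lebesgue_measure B = 0%E -> m B = 0%E.

(* f is, on K, a version of the Radon-Nikodym derivative dm/dx. *)
Definition is_density_on (K : set R) (m : borel_prob R) (f : R -> R) : Prop :=
  [/\ measurable_fun K f, forall x, K x -> 0 <= f x &
      forall B : set R, measurable B -> B `<=` K ->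
        m B = (\int[lebesgue_measure]_(x in B) (f x)%:E)%E].

Definition weak_cvg (F : set_system R) (m : R -> borel_prob R)
    (l : borel_prob R) : Prop :=
  forall g : R -> R, continuous g -> (exists c : R, forall x, `|g x| <= c) ->
    (\int[m t]_x g x) @[t --> F] --> (\int[l]_x g x).

Definition cauchy_pdf (b c x : R) : R := c / pi * ((x - b) ^+ 2 + c ^+ 2)^-1.

Definition has_cauchy_law d (T : measurableType d) (P : probability T R)
    (X : {RV P >-> measurableTypeR R}) (b c : R) : Prop :=
  forall B : set R, measurable B ->
    distribution P X B =
    (\int[lebesgue_measure]_(x in B) (cauchy_pdf b c x)%:E)%E.

Definition log_cauchy_pdf (b c x : R) : R :=
  c / (pi * x * ((ln x - b) ^+ 2 + c ^+ 2)).

End limit_law.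

(* Main.v *)
Require Import Defs.
From mathcomp Require Import ring lra.

Set Implicit Arguments.
Unset Strict Implicit.
Unset Printing Implicit Defensive.

Import Order.TTheory GRing.Theory Num.Theory.
Import numFieldNormedType.Exports.

Local Open Scope classical_set_scope.
Local Open Scope ring_scope.
Local Open Scope complex_scope.

(** Let nu be the t-th power of mu, let M(w) be the integral of 1 / (1 - w y)
    against nu(dy), and let eta = 1 - 1 / M, which continues the eta-transform of
    nu to the lower half-plane.

    The relation between the Sigma-transforms says that eta is inverse to
    z |-> z exp (t v(z)) on the negative axis, where eta is injective; so
    eta(w) exp (t v(eta(w))) = w for w < 0. Since eta maps the lower half-plane to
    itself, this extends by analytic continuation to all w with Im w < 0
    ([functional_equation]). The continuation rests on an elementary maximum
    principle for functions with second-order jets ([maximum_principle],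
    [identity_principle]).

    Now let w = exp (- t X - i b) with X bounded and b small compared to t. By
    continuity along the arc from - |w| to w, eta(w) is trapped in an annulus
    around the unit circle, where v is bounded ([annulus_trap]). Hence
    eta(w) = exp (- t (X + i b / t + v(eta(w)))) is close to 1 for t small, so
    v(eta(w)) is close to v(1) = - beta + i gamma, and t M(w) = t / (1 - eta(w)) is
    close to 1 / (X - beta + i gamma). Its imaginary part is - pi times the Cauchy
    density at X ([small_time_estimate]).

    On the other hand - (t / pi) Im M(exp (- t X - i b)) is the derivative in X of
    a smoothed distribution function of (log y) / t under nu. As the estimate is
    uniform in b, one may let b tend to 0 with t fixed: under the (1/t)-power of
    nu, the mass of the interval from exp X to exp Y differs from the increment of
    the Cauchy distribution function by at most e (Y - X) ([interval_masses]).

    Such bounds yield a density within a multiple of e of the given one: the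
    distribution function is Lipschitz, and its derivative is controlled pointwise
    ([density_of_increments]). This is the first part of the theorem. For the
    second, the limit law has the limit density and gives mass 1 to the positive
    half-line, so that uniform convergence of densities on compact sets leaves no
    mass free to escape ([weak_cvg_of_local_domination]). *)

(** * The modulus and second-order jets *)

Section modulus.
Context {R : realType}.
Implicit Types (z w h : R[i]) (x y : R).

(** The modulus as an element of R: the norm of R[i] has its values in R[i]. *)
Definition cmod z : R := ComplexField.Normc.normc z.

Lemma normC_cmod z : `|z| = (cmod z)%:C.
Proof. by []. Qed.

Lemma cmodE z : cmod z = Num.sqrt (complex.Re z ^+ 2 + complex.Im z ^+ 2).
Proof. by case: z. Qed.

Lemma cmod_ge0 z : 0 <= cmod z.
Proof. by rewrite cmodE sqrtr_ge0. Qed.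

Lemma sqr_cmod z : cmod z ^+ 2 = complex.Re z ^+ 2 + complex.Im z ^+ 2.
Proof. by rewrite cmodE sqr_sqrtr// addr_ge0// sqr_ge0. Qed.

Lemma cmodM z w : cmod (z * w) = cmod z * cmod w.
Proof. exact: ComplexField.Normc.normcM. Qed.

Lemma cmodD z w : cmod (z + w) <= cmod z + cmod w.
Proof. exact: le_normcD. Qed.

Lemma cmodN z : cmod (- z) = cmod z.
Proof. exact: normcN. Qed.

Lemma cmod0 : cmod 0 = 0.
Proof. exact: ComplexField.Normc.normc0. Qed.

Lemma cmod1 : cmod 1 = 1.
Proof. exact: ComplexField.Normc.normc1. Qed.

Lemma cmod_eq0 z : (cmod z == 0) = (z == 0).
Proof.
apply/eqP/eqP => [|->]; last exact: cmod0.
exact: ComplexField.Normc.eq0_normc.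
Qed.

Lemma cmod_gt0 z : (0 < cmod z) = (z != 0).
Proof. by rewrite lt_def cmod_ge0 andbT cmod_eq0. Qed.

Lemma cmodV z : cmod z^-1 = (cmod z)^-1.
Proof. exact: ComplexField.Normc.normcV. Qed.

Lemma cmodX z n : cmod (z ^+ n) = cmod z ^+ n.
Proof. by elim: n => [|n IH]; rewrite ?expr0 ?cmod1// !exprS cmodM IH. Qed.

Lemma cmod_distC z w : cmod (z - w) = cmod (w - z).
Proof. by rewrite -cmodN opprB. Qed.

Lemma cmodB z w : cmod (z - w) <= cmod z + cmod w.
Proof. by rewrite (le_trans (cmodD _ _))// cmodN. Qed.

Lemma cmod_lerB z w : cmod z - cmod w <= cmod (z - w).
Proof. by rewrite lerBlDr (le_trans _ (cmodD _ _))// subrK. Qed.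

Lemma Re_le_cmod z : `|complex.Re z| <= cmod z.
Proof. by rewrite cmodE -sqrtr_sqr ler_wsqrtr// lerDl sqr_ge0. Qed.

Lemma Im_le_cmod z : `|complex.Im z| <= cmod z.
Proof. by rewrite cmodE -sqrtr_sqr ler_wsqrtr// lerDr sqr_ge0. Qed.

Lemma cmod_real x : cmod x%:C = `|x|.
Proof. by rewrite cmodE /= expr0n addr0 sqrtr_sqr. Qed.

Lemma cmod_le_ReIm z : cmod z <= `|complex.Re z| + `|complex.Im z|.
Proof.
rewrite -(@ler_pXn2r _ 2)// ?nnegrE ?cmod_ge0 ?addr_ge0//.
rewrite sqr_cmod -[X in X + _]real_normK ?num_real//.
rewrite -[X in _ + X]real_normK ?num_real// sqrrD.
by rewrite lerD2r lerDl mulrn_wge0 ?mulr_ge0.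
Qed.

Lemma ReM z w : complex.Re (z * w) =
  complex.Re z * complex.Re w - complex.Im z * complex.Im w.
Proof. by case: z => a b; case: w. Qed.

Lemma ImM z w : complex.Im (z * w) =
  complex.Re z * complex.Im w + complex.Im z * complex.Re w.
Proof. by case: z => a b; case: w. Qed.

Lemma ReD z w : complex.Re (z + w) = complex.Re z + complex.Re w.
Proof. by case: z => a b; case: w. Qed.

Lemma ImD z w : complex.Im (z + w) = complex.Im z + complex.Im w.
Proof. by case: z => a b; case: w. Qed.

Lemma ReN z : complex.Re (- z) = - complex.Re z.
Proof. by case: z. Qed.

Lemma ImN z : complex.Im (- z) = - complex.Im z.
Proof. by case: z. Qed.

Lemma ReV z : complex.Re z^-1 = complex.Re z / cmod z ^+ 2.
Proof. by rewrite sqr_cmod; case: z. Qed.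

Lemma ImV z : complex.Im z^-1 = - (complex.Im z / cmod z ^+ 2).
Proof. by rewrite sqr_cmod; case: z. Qed.

Lemma complexP z w : complex.Re z = complex.Re w ->
  complex.Im z = complex.Im w -> z = w.
Proof. by case: z => a b; case: w => c d /= -> ->. Qed.

End modulus.

Arguments cmod {R} z : simpl never.

Section jets.
Context {R : realType}.
Implicit Types (z w h : R[i]) (r m f g : R[i] -> R[i]).

Definition bounded_near0 r : Prop :=
  exists K d : R, 0 < d /\ forall h, cmod h < d -> cmod (r h) <= K.

Lemma bounded_near0_cst c : bounded_near0 (fun _ => c).
Proof. by exists (cmod c), 1; split. Qed.

Lemma bounded_near0_id : bounded_near0 id.
Proof. by exists 1, 1; split => // h /ltW. Qed.

Lemma bounded_near0D r m : bounded_near0 r -> bounded_near0 m ->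
  bounded_near0 (fun h => r h + m h).
Proof.
move=> [K [d [d0 rK]]] [K' [d' [d'0 mK]]].
exists (K + K'), (Num.min d d'); split; first by rewrite lt_min d0.
move=> h; rewrite lt_min => /andP[hd hd'].
by rewrite (le_trans (cmodD _ _))// lerD ?rK ?mK.
Qed.

Lemma bounded_near0M r m : bounded_near0 r -> bounded_near0 m ->
  bounded_near0 (fun h => r h * m h).
Proof.
move=> [K [d [d0 rK]]] [K' [d' [d'0 mK]]].
exists (K * K'), (Num.min d d'); split; first by rewrite lt_min d0.
move=> h; rewrite lt_min => /andP[hd hd'].
by rewrite cmodM ler_pM ?cmod_ge0 ?rK ?mK.
Qed.

Lemma bounded_near0_comp r m : bounded_near0 r -> bounded_near0 m ->
  bounded_near0 (fun h => r (h * m h)).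
Proof.
move=> [K [d [d0 rK]]] [K' [d' [d'0 mK]]].
have K'0 : 0 <= K' by rewrite (le_trans (cmod_ge0 (m 0)))// mK// cmod0.
exists K, (Num.min d' (d / (K' + 1))); split.
  by rewrite lt_min d'0 divr_gt0// ltr_wpDl.
move=> h; rewrite lt_min => /andP[hd' hd]; apply: rK.
rewrite cmodM; rewrite ltr_pdivlMr ?ltr_wpDl// in hd.
apply: le_lt_trans hd; rewrite ler_wpM2l ?cmod_ge0//.
by rewrite (le_trans (mK _ hd'))// lerDl.
Qed.

(** This is all the regularity that the maximum principle below asks of an
    analytic function. It is stable under products and composition by mere
    algebra, and for power series and integrals it comes from an explicit bound
    on the remainder. *)
Definition jet2 f z : Prop :=
  exists a b r, bounded_near0 r /\
    forall h, f (z + h) = f z + a * h + b * h ^+ 2 + r h * h ^+ 3.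

Lemma jet2P f z a b (K d : R) : 0 < d ->
  (forall h, cmod h < d ->
     cmod (f (z + h) - (f z + a * h + b * h ^+ 2)) <= K * cmod h ^+ 3) ->
  jet2 f z.
Proof.
move=> d0 fK.
exists a, b, (fun h => (f (z + h) - (f z + a * h + b * h ^+ 2)) / h ^+ 3).
split; last first.
  move=> h; have [->|h0] := eqVneq h 0; first by rewrite addr0; ring.
  by rewrite divfK ?expf_neq0//; ring.
exists `|K|, d; split => // h hd; rewrite cmodM cmodV cmodX.
have [->|h0] := eqVneq h 0; first by rewrite cmod0 [(0:R) ^+ 3]expr0n invr0 mulr0.
rewrite ler_pdivrMr ?exprn_gt0 ?cmod_gt0//.
by rewrite (le_trans (fK _ hd))// ler_wpM2r ?exprn_ge0 ?cmod_ge0 ?ler_norm.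
Qed.

Lemma jet2_cst c z : jet2 (fun _ => c) z.
Proof.
exists 0, 0, (fun _ => 0); split; first exact: bounded_near0_cst.
by move=> h; ring.
Qed.

Lemma jet2_id z : jet2 id z.
Proof.
exists 1, 0, (fun _ => 0); split; first exact: bounded_near0_cst.
by move=> h; ring.
Qed.

Lemma jet2D f g z : jet2 f z -> jet2 g z -> jet2 (fun w => f w + g w) z.
Proof.
move=> [a [b [r [br fE]]]] [a' [b' [r' [br' gE]]]].
exists (a + a'), (b + b'), (fun h => r h + r' h).
split; first exact: bounded_near0D.
by move=> h; rewrite fE gE; ring.
Qed.

Lemma jet2M f g z : jet2 f z -> jet2 g z -> jet2 (fun w => f w * g w) z.
Proof.
move=> [a [b [r [br fE]]]] [a' [b' [r' [br' gE]]]].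
exists (f z * a' + a * g z), (f z * b' + a * a' + b * g z),
  (fun h => f z * r' h + r h * g z + a * b' + b * a' +
            h * (a * r' h + r h * a' + b * b') +
            h * h * (b * r' h + r h * b') + h * h * h * (r h * r' h)).
split; last by move=> h; rewrite fE gE; ring.
by do ![exact: bounded_near0_cst|exact: bounded_near0_id|exact: br|exact: br'
  |apply: bounded_near0D|apply: bounded_near0M].
Qed.

Lemma jet2N f z : jet2 f z -> jet2 (fun w => - f w) z.
Proof.
move=> jf; rewrite (_ : (fun _ => _) = (fun w => - 1 * f w)).
  by apply: jet2M => //; exact: jet2_cst.
by apply/funext => w; rewrite mulN1r.
Qed.

Lemma jet2B f g z : jet2 f z -> jet2 g z -> jet2 (fun w => f w - g w) z.
Proof. by move=> jf jg; apply: jet2D => //; exact: jet2N. Qed.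

Lemma jet2_comp f g z : jet2 f z -> jet2 g (f z) -> jet2 (fun w => g (f w)) z.
Proof.
move=> [a [b [r [br fE]]]] [a' [b' [r' [br' gE]]]].
pose m h := a + b * h + r h * h ^+ 2.
have bm : bounded_near0 m.
  rewrite /m; do ![exact: bounded_near0_cst|exact: bounded_near0_id|exact: br
  |apply: bounded_near0D|apply: bounded_near0M].
(* The increment of f is h * m h with m bounded, so that the remainder of g at
   f z is cubic in h. *)
exists (a' * a), (a' * b + b' * a ^+ 2),
  (fun h => a' * r h + b' * (2 * a * b + h * b * b + 2 * a * r h * h
            + 2 * b * r h * h * h + r h * r h * h * h * h)
            + r' (h * m h) * (m h * m h * m h)).
split; last first.
  move=> h; have -> : f (z + h) = f z + h * m h by rewrite fE /m; ring.
  by rewrite gE; move: (r' _) => rr; rewrite /m; ring.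
do ![exact: bounded_near0_cst|exact: bounded_near0_id|exact: br|exact: bm
  |exact: bounded_near0_comp |apply: bounded_near0D|apply: bounded_near0M].
Qed.

Lemma jet2_inv z : z != 0 -> jet2 GRing.inv z.
Proof.
move=> z0; have cz0 : 0 < cmod z by rewrite cmod_gt0.
apply: (@jet2P _ z (- z ^- 2) (z ^- 3) (2 / cmod z ^+ 4) (cmod z / 2)).
  by rewrite divr_gt0.
move=> h hz; have hz2 : cmod z / 2 <= cmod (z + h).
  have := cmod_lerB (z + h) h; have := cmod_lerB z (- h).
  by rewrite opprK cmodN addrK; lra.
have zh0 : z + h != 0 by rewrite -cmod_gt0 (lt_le_trans _ hz2)// divr_gt0.
(* The geometric expansion of 1 / (z + h), with its exact remainder. *)
have -> : (z + h)^-1 - (z^-1 + - z ^- 2 * h + z ^- 3 * h ^+ 2) =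
    - h ^+ 3 * z ^- 3 * (z + h)^-1 by field; rewrite z0 zh0.
rewrite !cmodM cmodN !cmodV !cmodX.
rewrite [leRHS](_ : _ = cmod h ^+ 3 / cmod z ^+ 3 * (cmod z / 2)^-1); last first.
  by field; rewrite gt_eqF.
rewrite ler_wpM2l//; last by rewrite lef_pV2// posrE ?divr_gt0 ?cmod_gt0.
by rewrite divr_ge0 ?exprn_ge0 ?cmod_ge0.
Qed.

Lemma jet2_continuous f z : jet2 f z -> forall e : R, 0 < e ->
  exists2 d : R, 0 < d & forall w, cmod (w - z) < d -> cmod (f w - f z) < e.
Proof.
move=> [a [b [r [br fE]]]] e e0.
have [K [d [d0 mK]]] : bounded_near0 (fun h => a + b * h + r h * (h * h)).
  by do ![exact: bounded_near0_cst|exact: bounded_near0_id|exact: br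
    |apply: bounded_near0D|apply: bounded_near0M].
have K0 : 0 <= K by rewrite (le_trans (cmod_ge0 _) (mK 0 _))// cmod0.
exists (Num.min d (e / (K + 1))).
  by rewrite lt_min d0 divr_gt0// ltr_wpDl.
move=> w; rewrite lt_min => /andP[wd we].
rewrite (_ : f w - f z = (a + b * (w - z) + r (w - z) * ((w - z) * (w - z))) * (w - z)).
  rewrite cmodM; rewrite ltr_pdivlMr ?ltr_wpDl// mulrC in we.
  apply: le_lt_trans we; rewrite ler_wpM2r ?cmod_ge0//.
  by rewrite (le_trans (mK _ wd))// lerDl.
by rewrite -[in f w](subrK z w) addrC [w - z + z]addrC fE; ring.
Qed.

End jets.

(** * The complex exponential *)

Section complex_exponential.
Context {R : realType}.
Implicit Types (z w h : R[i]) (x y : R).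

Lemma expCD z w : expC (z + w) = expC z * expC w.
Proof.
rewrite /expC ReD ImD expRD cosD sinD.
by apply: complexP; rewrite !(ReM, ImM) /=; ring.
Qed.

Lemma expC_real x : expC x%:C = (expR x)%:C.
Proof. by apply: complexP; rewrite !(ReM, ImM) /= cos0 sin0; ring. Qed.

Lemma expC0 : expC 0 = 1 :> R[i].
Proof. by rewrite expC_real expR0. Qed.

Lemma cmod_expC z : cmod (expC z) = expR (complex.Re z).
Proof.
rewrite cmodM cmod_real ger0_norm ?expR_ge0//.
by rewrite cmodE /= cos2Dsin2 sqrtr1 mulr1.
Qed.

(** Iterated, this mean value bound yields Taylor estimates from the values of
    the derivatives at 0 alone. *)
Lemma norm_le_of_derivative (g g' : R -> R) (c : R) (n : nat) :
  g 0 = 0 -> (forall x, is_derive x 1 g (g' x)) ->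
  (forall x, `|x| <= 1 -> `|g' x| <= c * `|x| ^+ n) ->
  forall x, `|x| <= 1 -> `|g x| <= c * `|x| ^+ n.+1.
Proof.
move=> g0 dg g'c x x1.
have gc a b : {within `[a, b], continuous g}.
  apply: continuous_subspaceT => u.
  by apply/differentiable_continuous/derivable1_diffP.
have [|x0|->] := ltgtP x 0; last by rewrite g0 normr0 exprS mul0r mulr0.
- move=> x0; have [y] := MVT x0 (fun u _ => dg u) (gc _ _).
  rewrite in_itv/= => /andP[xy y0]; rewrite g0 !sub0r.
  move=> /(congr1 (fun u : R => `|u|)); rewrite normrN => ->.
  rewrite normrM normrN exprSr mulrA ler_wpM2r//.
  have yx : `|y| <= `|x| by rewrite !ltr0_norm// lerN2 ltW.
  have c0 : 0 <= c * `|y| ^+ n by rewrite (le_trans _ (g'c _ (le_trans yx x1))).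
  rewrite (le_trans (g'c _ (le_trans yx x1)))// ler_wpM2l//.
    by move: c0; rewrite pmulr_lge0// exprn_gt0// normr_gt0 lt_eqF.
  by rewrite lerXn2r// nnegrE.
- have [y] := MVT x0 (fun u _ => dg u) (gc _ _).
  rewrite in_itv/= => /andP[y0 xy]; rewrite g0 !subr0 => ->.
  rewrite normrM exprSr mulrA ler_wpM2r//.
  have yx : `|y| <= `|x| by rewrite !gtr0_norm// ltW.
  have c0 : 0 <= c * `|y| ^+ n by rewrite (le_trans _ (g'c _ (le_trans yx x1))).
  rewrite (le_trans (g'c _ (le_trans yx x1)))// ler_wpM2l//.
    by move: c0; rewrite pmulr_lge0// exprn_gt0// normr_gt0 gt_eqF.
  by rewrite lerXn2r// nnegrE.
Qed.

Lemma expR1_le4 : expR 1 <= 4 :> R.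
Proof.
have e2 : expR (2^-1) <= 2 :> R.
  have := expR_ge1Dx (- 2^-1 : R); rewrite expRN.
  have e0 := expR_gt0 (2^-1 : R).
  by rewrite -(ler_pM2r e0) mulVf ?gt_eqF//; lra.
rewrite [X in expR X](_ : _ = 2^-1 + 2^-1 :> R); last by field.
rewrite expRD (_ : 4 = 2 * 2)//; last by ring.
by rewrite ler_pM ?expR_ge0.
Qed.

Lemma expR_taylor2 x : `|x| <= 1 ->
  `|expR x - 1 - x - x ^+ 2 / 2| <= 4 * `|x| ^+ 3.
Proof.
move: x; apply: (@norm_le_of_derivative _ (fun x => expR x - 1 - x)).
- by rewrite expR0; ring.
- by move=> x; apply: is_derive_eq; rewrite /GRing.scale/=; field.
apply: (@norm_le_of_derivative _ (fun x => expR x - 1)).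
- by rewrite expR0; ring.
- by move=> x; apply: is_derive_eq; rewrite /GRing.scale/=; field.
apply: (@norm_le_of_derivative _ expR).
- by rewrite expR0; ring.
- by move=> x; apply: is_derive_eq; rewrite /GRing.scale/=; field.
move=> x; rewrite ler_norml => /andP[_ x1].
rewrite expr0 mulr1 ger0_norm ?expR_ge0//.
by rewrite (le_trans _ expR1_le4)// ler_expR.
Qed.

Lemma sin_taylor1 x : `|x| <= 1 -> `|sin x - x| <= 1 * `|x| ^+ 3.
Proof.
move: x; apply: (@norm_le_of_derivative _ (fun x => cos x - 1)).
- by rewrite sin0; ring.
apply: (@norm_le_of_derivative _ (fun x => - sin x)).
- by rewrite cos0; ring.
- by move=> x; apply: is_derive_eq; rewrite /GRing.scale/=; field.
apply: (@norm_le_of_derivative _ (fun x => - cos x)).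
- by rewrite sin0; ring.
by move=> x _; rewrite expr0 mulr1 normrN ler_norml cos_le1 cos_geN1.
Qed.

Lemma cos_taylor2 x : `|x| <= 1 -> `|cos x - 1 + x ^+ 2 / 2| <= 1 * `|x| ^+ 3.
Proof.
move=> x1; rewrite mul1r; apply: le_trans (_ : 1 * `|x| ^+ 4 <= _); last first.
  by rewrite mul1r exprS ler_piMl// exprn_ge0.
move: x x1; apply: (@norm_le_of_derivative _ (fun x => - (sin x - x))).
- by rewrite cos0; ring.
- by move=> x; apply: is_derive_eq; rewrite /GRing.scale/=; field.
by move=> x x1; rewrite normrN sin_taylor1.
Qed.

Lemma expC_taylor2 h : cmod h <= 1 ->
  cmod (expC h - (1 + h + 2^-1 * h ^+ 2)) <= 11 * cmod h ^+ 3.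
Proof.
case: h => x y; set h := x +i* y; move=> h1.
have xh : `|x| <= cmod h by exact: (Re_le_cmod h).
have yh : `|y| <= cmod h by exact: (Im_le_cmod h).
have h0 := cmod_ge0 h.
pose X : R[i] := x%:C; pose Y : R[i] := 0 +i* y.
pose E : R[i] := (expR x - 1 - x - x ^+ 2 / 2)%:C.
pose S : R[i] := (cos y - 1 + y ^+ 2 / 2) +i* (sin y - y).
(* Multiplying the expansions of exp x and exp (i y): what is left over is a sum
   of products of total order at least three. *)
have -> : expC h - (1 + h + 2^-1 * h ^+ 2) =
    X * Y ^+ 2 / 2 + X ^+ 2 * Y / 2 + X ^+ 2 * Y ^+ 2 / 4 +
    E * expC Y + (1 + X + X ^+ 2 / 2) * S.
  have -> : h = X + Y by apply: complexP; rewrite /= ?addr0 ?add0r.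
  have -> : E = expC X - 1 - X - X ^+ 2 / 2.
    rewrite expC_real /E !rmorphB /= rmorphM /= rmorphXn /= fmorphV /=.
    by rewrite rmorphMn.
  have -> : S = expC Y - 1 - Y - Y ^+ 2 / 2.
    by apply: complexP; rewrite /= ?(ReM, ImM) /= expR0; field.
  by rewrite expCD; field.
have cX : cmod X <= cmod h by rewrite cmod_real.
have cY : cmod Y <= cmod h.
  by rewrite (le_trans (cmod_le_ReIm _))//= normr0 add0r.
have cE : cmod E <= 4 * cmod h ^+ 3.
  rewrite cmod_real (le_trans (expR_taylor2 (le_trans xh h1)))//.
  by rewrite ler_wpM2l// lerXn2r ?nnegrE.
have cS : cmod S <= 2 * cmod h ^+ 3.
  rewrite (le_trans (cmod_le_ReIm _))//=.
  have y1 := le_trans yh h1.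
  have y3 : `|y| ^+ 3 <= cmod h ^+ 3 by rewrite lerXn2r ?nnegrE.
  by have := cos_taylor2 y1; have := sin_taylor1 y1; lra.
have c2 : cmod (2 : R[i]) = 2 by rewrite (_ : 2 = (2:R)%:C) ?cmod_real ?ger0_norm// rmorphMn.
have c4 : cmod (4 : R[i]) = 4 by rewrite (_ : 4 = (4:R)%:C) ?cmod_real ?ger0_norm// rmorphMn.
have le3 (a b c : R) : 0 <= a -> 0 <= b -> 0 <= c -> a <= cmod h -> b <= cmod h ->
    c <= cmod h -> a * b * c <= cmod h ^+ 3.
  move=> a0 b0 c0 ah bh ch; rewrite (exprSr _ 2) expr2.
  by rewrite ler_pM ?mulr_ge0// ler_pM.
have t1 : cmod (X * Y ^+ 2 / 2) <= cmod h ^+ 3 / 2.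
  by rewrite !(cmodM, cmodV, cmodX, c2) ler_wpM2r// expr2 mulrA le3 ?cmod_ge0.
have t2 : cmod (X ^+ 2 * Y / 2) <= cmod h ^+ 3 / 2.
  by rewrite !(cmodM, cmodV, cmodX, c2) ler_wpM2r// expr2 le3 ?cmod_ge0.
have t3 : cmod (X ^+ 2 * Y ^+ 2 / 4) <= cmod h ^+ 3 / 4.
  rewrite !(cmodM, cmodV, cmodX, c4) ler_wpM2r// expr2 [cmod Y ^+ 2]expr2 mulrA.
  rewrite -[leRHS]mulr1 ler_pM ?mulr_ge0 ?cmod_ge0 ?le3 ?cmod_ge0//.
  exact: le_trans h1.
have t4 : cmod (E * expC Y) <= 4 * cmod h ^+ 3.
  by rewrite cmodM cmod_expC /= expR0 mulr1.
have t5 : cmod ((1 + X + X ^+ 2 / 2) * S) <= 5 * cmod h ^+ 3.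
  rewrite cmodM (_ : 5 * _ = 5 / 2 * (2 * cmod h ^+ 3)); last by field.
  rewrite ler_pM ?cmod_ge0//.
  have X1 := le_trans cX h1.
  have X2 : cmod (X ^+ 2 / 2) <= 1 / 2.
    by rewrite cmodM cmodV cmodX c2 ler_wpM2r// exprn_ile1// cmod_ge0.
  have := cmodD (1 + X) (X ^+ 2 / 2); have := cmodD 1 X; rewrite cmod1; lra.
have := cmodD (X * Y ^+ 2 / 2 + X ^+ 2 * Y / 2 + X ^+ 2 * Y ^+ 2 / 4 +
  E * expC Y) ((1 + X + X ^+ 2 / 2) * S).
have := cmodD (X * Y ^+ 2 / 2 + X ^+ 2 * Y / 2 + X ^+ 2 * Y ^+ 2 / 4)
  (E * expC Y).
have := cmodD (X * Y ^+ 2 / 2 + X ^+ 2 * Y / 2) (X ^+ 2 * Y ^+ 2 / 4).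
have := cmodD (X * Y ^+ 2 / 2) (X ^+ 2 * Y / 2).
have := exprn_ge0 3 h0; lra.
Qed.

Lemma expC_taylor1 h : cmod h <= 1 ->
  cmod (expC h - (1 + h)) <= 12 * cmod h ^+ 2.
Proof.
move=> h1; have h0 := cmod_ge0 h.
have -> : expC h - (1 + h) =
    (expC h - (1 + h + 2^-1 * h ^+ 2)) + 2^-1 * h ^+ 2 by ring.
rewrite (le_trans (cmodD _ _))//.
have c2 : cmod (2^-1 : R[i]) <= 1.
  rewrite (_ : 2^-1 = (2^-1 : R)%:C); last by rewrite fmorphV rmorphMn.
  by rewrite cmod_real ger0_norm// invf_le1// ler1n.
have : cmod (2^-1 * h ^+ 2) <= cmod h ^+ 2.
  by rewrite cmodM cmodX ler_piMl// sqr_ge0.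
have : cmod h ^+ 3 <= cmod h ^+ 2 by rewrite exprS ler_piMl// sqr_ge0.
have := expC_taylor2 h1; lra.
Qed.

Lemma jet2_expC z : jet2 (@expC R) z.
Proof.
apply: (@jet2P _ _ z (expC z) (expC z / 2) (cmod (expC z) * 11) 1) => // h h1.
have -> : expC (z + h) - (expC z + expC z * h + expC z / 2 * h ^+ 2) =
    expC z * (expC h - (1 + h + 2^-1 * h ^+ 2)) by rewrite expCD; ring.
by rewrite cmodM -mulrA ler_wpM2l ?cmod_ge0// expC_taylor2// ltW.
Qed.

End complex_exponential.

(** * Power series *)

Section power_series.
Context {R : realType}.
Implicit Types (z h : R[i]).

Lemma cvgC_cmod (u : nat -> R[i]) (l : R[i]) :
  ((u n : Cplx R) @[n --> \oo] --> (l : Cplx R)) -> forall e : R, 0 < e ->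
  exists N, forall n, (N <= n)%N -> cmod (u n - l) < e.
Proof.
move=> /cvgrPdist_lt ul e e0.
have /ul[N _ uN] : (0 : R[i]) < e%:C by rewrite (ltcR 0 e).
exists N => n /uN /=; rewrite normC_cmod ltcR cmod_distC; exact.
Qed.

(** The terms of a series converging at a point of modulus rho are bounded, so
    the coefficients are at most B / rho ^+ n, and for |h| <= rho / 2 the terms
    of order at least 3 are dominated by a geometric series. *)
Lemma jet2_analytic (D : set (Cplx R)) (v : Cplx R -> Cplx R) z :
  analytic_on D v -> D z -> jet2 v z.
Proof.
move=> vD /vD[a [r [r0 av]]].
have [rho rho0 rhor] : exists2 rho : R, 0 < rho & rho < r.
  by exists (r / 2); lra.
have partial h : cmod h < r -> forall e : R, 0 < e -> exists N, forall n,
    (N <= n)%N -> cmod (\sum_(0 <= i < n) a i * h ^+ i - v (z + h)) < e.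
  move=> hr; have zhz : (z + h : Cplx R) - z = h by rewrite addrAC subrr add0r.
  have /av/cvgC_cmod sv : `|(z + h : Cplx R) - z| < r%:C.
    change ((cmod (z + h - z))%:C < r%:C); rewrite ltcR.
    by rewrite zhz.
  move=> e e0; have [N sN] := sv e e0; exists N => n /sN.
  rewrite /series/=; congr (cmod (_ - _) < _).
  by apply: eq_bigr => i _; congr (_ * (_ ^+ _)).
have [B aB] : exists B, forall n, cmod (a n) * rho ^+ n <= B.
  have hr : cmod rho%:C < r by rewrite cmod_real gtr0_norm.
  have [N sN] := partial _ hr 1 ltr01.
  exists (2 + \sum_(i < N) cmod (a i) * rho ^+ i) => n.
  have tge0 i : 0 <= cmod (a i) * rho ^+ i.
    by rewrite mulr_ge0 ?cmod_ge0// exprn_ge0// ltW.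
  have [nN|Nn] := ltnP n N.
    rewrite (bigD1 (Ordinal nN))//= addrCA lerDl addr_ge0// sumr_ge0//.
  apply: (@le_trans _ _ 2); last by rewrite lerDl sumr_ge0.
  have -> : cmod (a n) * rho ^+ n = cmod (a n * rho%:C ^+ n).
    by rewrite cmodM cmodX cmod_real gtr0_norm.
  have := sN _ (leqW Nn); have := sN _ Nn; rewrite big_nat_recr//=.
  move: (\sum_(_ <= _ < _) _) (a n * _) (v _) => s w l sl swl.
  have -> : w = (s + w - l) - (s - l) by ring.
  by have := cmodB (s + w - l) (s - l); lra.
have B0 : 0 <= B by rewrite (le_trans _ (aB 0))// mulr_ge0 ?cmod_ge0.
have tail h : cmod h <= rho / 2 ->
    cmod (v (z + h) - (a 0 + a 1 * h + a 2 * h ^+ 2)) <=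
      2 * B / rho ^+ 3 * cmod h ^+ 3.
  move=> hrho.
  have [q [q0 q1 hq]] : exists q : R, [/\ 0 <= q, q <= 1 / 2 & cmod h = rho * q].
    exists (cmod h / rho); rewrite divr_ge0 ?cmod_ge0 ?(ltW rho0)//; split => //.
      by rewrite ler_pdivrMr//; lra.
    by rewrite mulrC divfK// gt_eqF.
  have term n : cmod (a n * h ^+ n) <= B * q ^+ n.
    rewrite cmodM cmodX hq.
    by rewrite exprMn mulrA ler_wpM2r// exprn_ge0.
  (* The n-th term is at most B q^n with q <= 1/2; in this form the bound on the
     partial sums goes through by induction. *)
  have part N : cmod (\sum_(0 <= i < N + 3) a i * h ^+ i -
       (a 0 + a 1 * h + a 2 * h ^+ 2)) <= B * q ^+ 3 * (2 - 2 / 2 ^+ N).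
    elim: N => [|N IH].
      rewrite add0n !big_nat_recr//= big_geq// expr0 invr1 mulr1 subrr mulr0.
      by rewrite add0r mulr1 expr1 subrr cmod0.
    rewrite addSn big_nat_recr//=.
    set s := \sum_(_ <= _ < _) _ in IH *; set p := _ + a 2 * _ in IH *.
    have -> : s + a (N + 3)%N * h ^+ (N + 3) - p =
      (s - p) + a (N + 3)%N * h ^+ (N + 3) by ring.
    have qN : q ^+ N <= (2 ^+ N)^-1.
      by rewrite -exprVn lerXn2r// ?nnegrE ?invr_ge0//; lra.
    have tN : cmod (a (N + 3)%N * h ^+ (N + 3)) <= B * q ^+ 3 * (2 ^+ N)^-1.
      rewrite (le_trans (term _))// -mulrA ler_wpM2l// exprD mulrC ler_wpM2l//.
      exact: exprn_ge0.
    apply: le_trans (cmodD _ _) _; apply: le_trans (lerD IH tN) _.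
    rewrite -mulrDr le_eqVlt; apply/orP; left; apply/eqP; congr (_ * _).
    by rewrite exprS; field; rewrite expf_neq0.
  have -> : 2 * B / rho ^+ 3 * cmod h ^+ 3 = 2 * (B * q ^+ 3).
    by rewrite hq; field; rewrite gt_eqF.
  apply/ler_addgt0Pr => e e0.
  have [|N sN] := partial h _ _ e0.
    by rewrite (le_lt_trans hrho)//; lra.
  have := sN (N + 3)%N (leq_addr _ _); have := part N.
  set s := \sum_(_ <= _ < _) _; set p := _ + a 2 * _ => sp sv.
  have -> : v (z + h) - p = (s - p) - (s - v (z + h)) by ring.
  have := cmodB (s - p) (s - v (z + h)).
  have : 0 <= B * q ^+ 3 * (2 / 2 ^+ N).
    by rewrite mulr_ge0 ?divr_ge0 ?mulr_ge0 ?exprn_ge0.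
  move: sp; rewrite mulrBr; lra.
have vz : v z = a 0%N.
  apply/eqP; rewrite -subr_eq0 -cmod_eq0 eq_le cmod_ge0 andbT.
  have /tail : cmod (0 : R[i]) <= rho / 2 by rewrite cmod0 ltW// divr_gt0.
  by rewrite cmod0 addr0 !expr0n/= !mulr0 !addr0.
apply: (@jet2P _ _ _ (a 1%N) (a 2%N) (2 * B / rho ^+ 3) (rho / 2)).
  by rewrite divr_gt0.
by move=> h /ltW; rewrite vz; exact: tail.
Qed.

End power_series.

(** * The maximum principle and analytic continuation *)

Section maximum_principle.
Context {R : realType}.
Implicit Types (z w h : R[i]) (f g : R[i] -> R[i]).

Definition rect (x0 x1 y0 y1 : R) : set R[i] :=
  [set z | x0 <= complex.Re z <= x1 /\ y0 <= complex.Im z <= y1].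

Lemma compact_rect x0 x1 y0 y1 :
  compact [set p : R * R | rect x0 x1 y0 y1 (p.1 +i* p.2)].
Proof.
rewrite (_ : [set _ | _] = `[x0, x1]%classic `*` `[y0, y1]%classic).
  by apply: compact_setX; exact: segment_compact.
by apply/seteqP; split => p /=; rewrite /rect/= !in_itv.
Qed.

(** The extreme value theorem, transported from the plane R * R. *)
Lemma cmod_continuous_max (A : set R[i]) (phi : R[i] -> R) :
  A !=set0 -> compact [set p : R * R | A (p.1 +i* p.2)] ->
  (forall z, A z -> forall e : R, 0 < e -> exists2 d : R, 0 < d &
    forall w, A w -> cmod (w - z) < d -> `|phi w - phi z| < e) ->
  exists2 c, A c & forall z, A z -> phi z <= phi c.
Proof.
move=> [[a b] Aab] cA phic.
have [] := @compact_EVT_max _ R (fun p : R * R => phi (p.1 +i* p.2)) _ _ cA.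
- by exists (a, b).
- apply/subspace_continuousP => -[p q] /= Apq.
  apply/cvgrPdist_lt => e e0; have [d d0 dP] := phic _ Apq e e0.
  rewrite near_withinE; apply/nbhs_ballP; exists (d / 2) => /=.
    by rewrite divr_gt0.
  move=> [p' q'] [/= pp' qq'] Apq'; rewrite distrC; apply: dP => //.
  rewrite (le_lt_trans (cmod_le_ReIm _))//= distrC [X in _ + X]distrC.
  by rewrite (splitr d) ltrD.
- by move=> [p q] /set_mem/= Apq h; exists (p +i* q) => // -[u v] Auv;
    have := h (u, v); rewrite inE; apply.
Qed.

Lemma parallelogram (u w : R[i]) :
  cmod (u + w) ^+ 2 + cmod (u - w) ^+ 2 = 2 * (cmod u ^+ 2 + cmod w ^+ 2).
Proof. by rewrite !sqr_cmod !(ReD, ImD, ReN, ImN); ring. Qed.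

(** Parseval identity: the functions 1, h, h^2 are orthogonal over the fourth
    roots of unity. *)
Lemma four_point_average (a b c : R[i]) (rho : R) :
  let p h := a + b * h + c * h ^+ 2 in
  cmod (p rho%:C) ^+ 2 + cmod (p (- rho%:C)) ^+ 2 +
  cmod (p (0 +i* rho)) ^+ 2 + cmod (p (- (0 +i* rho))) ^+ 2 =
  4 * (cmod a ^+ 2 + cmod b ^+ 2 * rho ^+ 2 + cmod c ^+ 2 * rho ^+ 4).
Proof.
move=> p; pose w := c * rho%:C ^+ 2.
have i2 : (0 +i* rho) ^+ 2 = - rho%:C ^+ 2.
  by rewrite !expr2; apply: complexP; rewrite /=; ring.
have -> : p rho%:C = (a + w) + b * rho%:C by rewrite /p /w; ring.
have -> : p (- rho%:C) = (a + w) - b * rho%:C by rewrite /p /w; ring.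
have -> : p (0 +i* rho) = (a - w) + b * (0 +i* rho).
  by rewrite /p /w i2; ring.
have -> : p (- (0 +i* rho)) = (a - w) - b * (0 +i* rho).
  by rewrite /p /w sqrrN i2; ring.
have cw : cmod w ^+ 2 = cmod c ^+ 2 * rho ^+ 4.
  rewrite cmodM cmodX cmod_real exprMn real_normK ?num_real//.
  by rewrite -exprM.
have cr : cmod (b * rho%:C) ^+ 2 = cmod b ^+ 2 * rho ^+ 2.
  by rewrite cmodM cmod_real exprMn real_normK ?num_real.
have ci : cmod (b * (0 +i* rho)) ^+ 2 = cmod b ^+ 2 * rho ^+ 2.
  by rewrite cmodM exprMn [X in _ * X]sqr_cmod/= expr0n add0r.
have := parallelogram (a + w) (b * rho%:C).
have := parallelogram (a - w) (b * (0 +i* rho)).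
have := parallelogram a w; rewrite cw cr ci; lra.
Qed.

Lemma sqr_cmod_lower (p e : R[i]) :
  cmod p ^+ 2 - 2 * cmod p * cmod e <= cmod (p + e) ^+ 2.
Proof.
have h : cmod p - cmod e <= cmod (p + e).
  by have := cmodB (p + e) e; rewrite addrK; lra.
have := cmod_ge0 (p + e); have := cmod_ge0 p; have := cmod_ge0 e.
have [pe|pe] := leP (cmod e) (cmod p); last by nra.
by have := sqr_ge0 (cmod e); nra.
Qed.

(** If |g| exceeded B inside, |g|^2 + eps |z|^2 would have an interior maximum
    for eps small. But its average over four points at distance rho exceeds its
    value at the centre by at least eps rho^2, up to an error of order rho^3
    that 2-jets suffice to control. *)
Lemma maximum_principle g x0 x1 y0 y1 (B : R) : 0 <= B ->
  (forall z, rect x0 x1 y0 y1 z -> jet2 g z) ->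
  (forall z, rect x0 x1 y0 y1 z ->
    [\/ complex.Re z = x0, complex.Re z = x1,
        complex.Im z = y0 | complex.Im z = y1] -> cmod (g z) <= B) ->
  forall z, rect x0 x1 y0 y1 z -> cmod (g z) <= B.
Proof.
move=> B0 jg gB s Ds; rewrite leNgt; apply/negP => Bgs.
set A := rect _ _ _ _ in jg gB Ds.
pose D := x0 ^+ 2 + x1 ^+ 2 + y0 ^+ 2 + y1 ^+ 2.
have D0 : 0 <= D by rewrite !addr_ge0 ?sqr_ge0.
have AD z : A z -> cmod z ^+ 2 <= D.
  move=> [/andP[? ?] /andP[? ?]]; rewrite sqr_cmod /D.
  have sq (u l r : R) : l <= u -> u <= r -> u ^+ 2 <= l ^+ 2 + r ^+ 2.
    move=> lu ur; have [u0|u0] := leP 0 u; nra.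
  by rewrite -addrA lerD// sq.
have gs2 : B ^+ 2 < cmod (g s) ^+ 2 by rewrite ltrXn2r ?nnegrE ?cmod_ge0.
(* As |z|^2 <= D on the rectangle, this eps is too small for the perturbation to
   move the maximum to the boundary. *)
pose eps := (cmod (g s) ^+ 2 - B ^+ 2) / (D + 1).
have eps0 : 0 < eps by rewrite divr_gt0 ?subr_gt0// ltr_wpDl.
have epsD : B ^+ 2 + eps * D < cmod (g s) ^+ 2.
  have : eps * (D + 1) = cmod (g s) ^+ 2 - B ^+ 2.
    by rewrite divfK// gt_eqF// ltr_wpDl.
  by move: eps0; nra.
clearbody eps.
pose phi z := cmod (g z) ^+ 2 + eps * cmod z ^+ 2.
have [c Ac cmax] : exists2 c, A c & forall z, A z -> phi z <= phi c.
  apply: cmod_continuous_max; [by exists s|exact: compact_rect|].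
  have sqc f z : jet2 f z -> forall e : R, 0 < e -> exists2 d : R, 0 < d &
    forall w, cmod (w - z) < d -> `|cmod (f w) ^+ 2 - cmod (f z) ^+ 2| < e.
    move=> jf e e0; pose K := 2 * cmod (f z) + 1.
    have K0 : 0 < K by rewrite ltr_wpDl// mulr_ge0// cmod_ge0.
    have [|d d0 fd] := @jet2_continuous _ f z jf (Num.min 1 (e / K)).
      by rewrite lt_min ltr01 divr_gt0.
    exists d => // w /fd; rewrite lt_min => /andP[f1 fe].
    rewrite subr_sqr normrM mulrC.
    have h1 : `|cmod (f w) - cmod (f z)| <= cmod (f w - f z).
      rewrite ler_norml cmod_lerB andbT lerNl opprB cmod_distC.
      exact: cmod_lerB.
    have h2 : `|cmod (f w) + cmod (f z)| <= K.
      rewrite ger0_norm ?addr_ge0 ?cmod_ge0// /K.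
      by have := cmod_lerB (f w) (f z); lra.
    rewrite ltr_pdivlMr// mulrC in fe.
    apply: le_lt_trans fe; exact: ler_pM.
  move=> z Az e e0.
  have [|d1 d10 gd] := sqc g z (jg z Az) (e / 2); first by rewrite divr_gt0.
  have [|d2 d20 zd] := sqc id z (jet2_id z) (e / 2 / eps); first by rewrite !divr_gt0.
  exists (Num.min d1 d2); first by rewrite lt_min d10.
  move=> w _; rewrite lt_min => /andP[/gd gw /zd zw].
  rewrite ltr_pdivlMr// in zw; rewrite /phi.
  rewrite [X in `|X|](_ : _ = (cmod (g w) ^+ 2 - cmod (g z) ^+ 2) +
    (cmod w ^+ 2 - cmod z ^+ 2) * eps); last by ring.
  rewrite (le_lt_trans (ler_normD _ _))// normrM (gtr0_norm eps0).
  by rewrite (splitr e) ltrD.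
have cbd : B ^+ 2 + eps * D < phi c.
  rewrite (lt_le_trans epsD)// (le_trans _ (cmax _ Ds))// lerDl.
  by rewrite mulr_ge0 ?sqr_ge0// ltW.
have cin : ~ [\/ complex.Re c = x0, complex.Re c = x1,
        complex.Im c = y0 | complex.Im c = y1].
  move=> /(gB _ Ac) gcB; move: cbd; apply/negP; rewrite -leNgt lerD//.
    by rewrite lerXn2r ?nnegrE ?cmod_ge0.
  by rewrite ler_wpM2l ?AD// ltW.
have [/andP[cx0 cx1] /andP[cy0 cy1]] := Ac.
have {}cx0 : x0 < complex.Re c.
  by rewrite lt_neqAle cx0 andbT; apply/eqP => e; apply: cin; constructor 1.
have {}cx1 : complex.Re c < x1.
  by rewrite lt_neqAle cx1 andbT; apply/eqP => e; apply: cin; constructor 2.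
have {}cy0 : y0 < complex.Im c.
  by rewrite lt_neqAle cy0 andbT; apply/eqP => e; apply: cin; constructor 3.
have {}cy1 : complex.Im c < y1.
  by rewrite lt_neqAle cy1 andbT; apply/eqP => e; apply: cin; constructor 4.
have [b1 [b2 [r [[K [d [d0 rK]]] gE]]]] := jg c Ac.
have K0 : 0 <= K by rewrite (le_trans (cmod_ge0 _) (rK 0 _))// cmod0.
pose P := cmod (g c) + cmod b1 + cmod b2.
have P0 : 0 <= P by rewrite !addr_ge0 ?cmod_ge0.
pose PK := 2 * P * K + 1.
have PK0 : 0 < PK by rewrite ltr_wpDl ?mulr_ge0.
have [rho [rho0 rhod rho1 rhoe rA]] : exists rho : R, [/\ 0 < rho, rho < d,
   rho <= 1, rho * PK < eps &
   [/\ x0 <= complex.Re c - rho, complex.Re c + rho <= x1,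
       y0 <= complex.Im c - rho & complex.Im c + rho <= y1]].
  pose m := Num.min (Num.min (complex.Re c - x0) (x1 - complex.Re c))
                    (Num.min (complex.Im c - y0) (y1 - complex.Im c)).
  pose m' := Num.min (Num.min (d / 2) 1) (eps / PK / 2).
  have m0 : 0 < m by rewrite !lt_min !subr_gt0 cx0 cx1 cy0 cy1.
  have m'0 : 0 < m' by rewrite !lt_min ltr01 !divr_gt0 ?divr_gt0.
  exists (Num.min m m'); split.
  - by rewrite lt_min m0.
  - rewrite (@le_lt_trans _ _ (d / 2))//; first by rewrite !ge_min lexx !orbT.
    by lra.
  - by rewrite !ge_min lexx !orbT.
  - rewrite -ltr_pdivlMr// (@le_lt_trans _ _ (eps / PK / 2))//.
      by rewrite !ge_min lexx !orbT.
    have epk : 0 < eps / PK by rewrite divr_gt0.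
    by lra.
  - split.
    + by rewrite lerBrDr -lerBrDl !ge_min lexx ?orbT.
    + by rewrite -lerBrDl !ge_min lexx ?orbT.
    + by rewrite lerBrDr -lerBrDl !ge_min lexx ?orbT.
    + by rewrite -lerBrDl !ge_min lexx ?orbT.
pose p h := g c + b1 * h + b2 * h ^+ 2.
have lower h : cmod h = rho ->
    cmod (p h) ^+ 2 - 2 * P * (K * rho ^+ 3) <= cmod (g (c + h)) ^+ 2.
  move=> hrho; rewrite gE -/(p h); apply: le_trans (sqr_cmod_lower _ _).
  rewrite lerD2l lerN2 -!mulrA ler_wpM2l// ler_pM ?cmod_ge0//.
    rewrite (le_trans (cmodD _ _))// lerD//.
      rewrite (le_trans (cmodD _ _))// lerD2l cmodM hrho.
      by rewrite ler_piMr ?cmod_ge0.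
    by rewrite cmodM cmodX hrho ler_piMr ?cmod_ge0// exprn_ile1// ltW.
  by rewrite cmodM cmodX hrho ler_wpM2r ?exprn_ge0 ?(ltW rho0)// rK// hrho.
have [rA1 rA2 rA3 rA4] := rA.
have cr : cmod rho%:C = rho by rewrite cmod_real gtr0_norm.
have ci : cmod (0 +i* rho) = rho.
  by rewrite cmodE/= expr0n add0r sqrtr_sqr gtr0_norm.
have cmaxh h : A (c + h) -> phi (c + h) <= phi c by move=> /cmax.
have inA h : `|complex.Re h| <= rho -> `|complex.Im h| <= rho -> A (c + h).
  rewrite !ler_norml => /andP[h1 h2] /andP[h3 h4]; rewrite /A/rect/= ReD ImD.
  clear - rA1 rA2 rA3 rA4 h1 h2 h3 h4.
  by split; apply/andP; split; lra.
have rr : `|rho| <= rho by rewrite gtr0_norm.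
have r0' : `|0 : R| <= rho by rewrite normr0 ltW.
have avg : cmod (p rho%:C) ^+ 2 + cmod (p (- rho%:C)) ^+ 2 +
    cmod (p (0 +i* rho)) ^+ 2 + cmod (p (- (0 +i* rho))) ^+ 2 =
    4 * (cmod (g c) ^+ 2 + cmod b1 ^+ 2 * rho ^+ 2 + cmod b2 ^+ 2 * rho ^+ 4).
  exact: four_point_average.
have l1 := lower _ cr; have l2 := lower _ ci.
have := lower (- rho%:C); rewrite cmodN => /(_ cr) l3.
have := lower (- (0 +i* rho)); rewrite cmodN => /(_ ci) l4.
have q1 : phi (c + rho%:C) <= phi c by exact/cmaxh/inA.
have q2 : phi (c - rho%:C) <= phi c.
  by apply/cmaxh/inA; rewrite ?ReN ?ImN normrN.
have q3 : phi (c + (0 +i* rho)) <= phi c by exact/cmaxh/inA.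
have q4 : phi (c - (0 +i* rho)) <= phi c.
  by apply/cmaxh/inA; rewrite ?ReN ?ImN normrN.
have n1 : cmod (c + rho%:C) ^+ 2 + cmod (c + - rho%:C) ^+ 2 +
    cmod (c + (0 +i* rho)) ^+ 2 + cmod (c + - (0 +i* rho)) ^+ 2 =
    4 * (cmod c ^+ 2 + rho ^+ 2).
  by rewrite !sqr_cmod !(ReD, ImD, ReN, ImN)/=; ring.
have b1ge : 0 <= cmod b1 ^+ 2 * rho ^+ 2 by rewrite mulr_ge0 ?sqr_ge0.
have b2ge : 0 <= cmod b2 ^+ 2 * rho ^+ 4.
  by rewrite mulr_ge0 ?sqr_ge0// exprn_ge0// ltW.
have key : eps * rho ^+ 2 <= 2 * P * (K * rho ^+ 3).
  have := congr1 ( *%R eps) n1.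
  move: q1 q2 q3 q4 l1 l2 l3 l4 avg b1ge b2ge; rewrite /phi.
  set T := 2 * P * _; clearbody p P T; clear.
  move: (cmod b1 ^+ 2 * _) (cmod b2 ^+ 2 * _) => u v.
  lra.
move: key; rewrite (_ : 2 * P * _ = (2 * P * K * rho) * rho ^+ 2); last by ring.
rewrite ler_pM2r ?exprn_gt0// => key.
by move: rhoe; rewrite /PK; nra.
Qed.

Lemma jet2_cmod_bounded f (x0 x1 y0 y1 : R) :
  (forall z, rect x0 x1 y0 y1 z -> jet2 f z) ->
  exists2 C : R, 0 <= C & forall z, rect x0 x1 y0 y1 z -> cmod (f z) <= C.
Proof.
move=> jf; have [A0|A0] := eqVneq (rect x0 x1 y0 y1) set0.
  by exists 0 => // z; rewrite A0.
have [||c Ac cmax] := @cmod_continuous_max _ (cmod \o f) _ (@compact_rect x0 x1 y0 y1).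
- exact/set0P.
- move=> z Az e e0; have [d d0 fd] := jet2_continuous (jf _ Az) e0.
  exists d => // w _ /fd; apply: le_lt_trans.
  by rewrite ler_norml cmod_lerB andbT lerNl opprB cmod_distC cmod_lerB.
by exists (cmod (f c)); [exact: cmod_ge0|exact: cmax].
Qed.

(** Let Re q vanish on the top and vertical sides and be positive inside. As f is
    zero on the bottom side, the weight exp (lambda q) does not change the maximum
    of |f| on the boundary, whereas inside |f| exp (lambda Re q) stays below this
    maximum for all lambda > 0 only if f = 0. *)
Lemma identity_principle f (x a y0 y1 : R) : 0 < a ->
  (forall z, rect (x - a) (x + a) y0 y1 z -> jet2 f z) ->
  (forall z, rect (x - a) (x + a) y0 y1 z -> complex.Im z = y0 -> f z = 0) ->
  forall y, y0 <= y < y1 -> f (x +i* y) = 0.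
Proof.
move=> a0 jf f0 y /andP[y0y yy1].
have [C C0 fC] := jet2_cmod_bounded jf.
pose k := pi / (2 * a); have k0 : 0 < k by rewrite divr_gt0 ?pi_gt0 ?mulr_gt0.
pose u : R[i] := 0 +i* k; pose c : R[i] := x +i* y1.
(* q is 2 sinh (i k (s - c)), c being the middle of the top side; the value of k
   makes cos (k (Re s - x)) vanish on the vertical sides. *)
pose q s := expC (u * (s - c)) - expC (- (u * (s - c))).
have Req s : complex.Re (q s) = cos (k * (complex.Re s - x)) *
    (expR (k * (y1 - complex.Im s)) - expR (- (k * (y1 - complex.Im s)))).
  case: s => s1 s2.
  have uE : u * (s1 +i* s2 - c) = (k * (y1 - s2)) +i* (k * (s1 - x)).
    by apply: complexP; rewrite /=; ring.
  by rewrite /q uE ReD ReN /expC !ReM /= cosN; ring.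
have ka : k * a = pi / 2 by rewrite /k; field; rewrite gt_eqF.
have jq z : jet2 q z.
  have js : jet2 (fun s => u * (s - c)) z.
    apply: jet2M; first exact: jet2_cst.
    by apply: jet2B; [exact: jet2_id|exact: jet2_cst].
  apply: jet2B; apply: (jet2_comp (g := @expC R)); [|exact: jet2_expC|
    |exact: jet2_expC] => //.
  exact: jet2N.
clearbody q; have fq (lambda : R) z : 0 <= lambda -> rect (x - a) (x + a) y0 y1 z ->
    cmod (f z) * expR (lambda * complex.Re (q z)) <= C.
  move=> l0 Az.
  have cg s : cmod (f s * expC (lambda%:C * q s)) =
      cmod (f s) * expR (lambda * complex.Re (q s)).
    by rewrite cmodM cmod_expC ReM [complex.Im _%:C]/= mul0r subr0.
  rewrite -cg; apply: (maximum_principle (g := fun s => f s * expC (lambda%:C * q s)) C0 _ _ Az).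
    move=> s As; apply: jet2M; first exact: jf.
    apply: (jet2_comp (g := @expC R)); last exact: jet2_expC.
    by apply: jet2M; [exact: jet2_cst|exact: jq].
  have side s : rect (x - a) (x + a) y0 y1 s -> complex.Re (q s) = 0 ->
      cmod (f s * expC (lambda%:C * q s)) <= C.
    by move=> As qs0; rewrite cg qs0 mulr0 expR0 mulr1 fC.
  move=> s As [xs|xs|ys|ys].
  - apply: side => //; rewrite Req xs addrC addKr mulrN ka cosN.
    by rewrite cos_pihalf mul0r.
  - by apply: side => //; rewrite Req xs addrC addKr ka cos_pihalf mul0r.
  - by rewrite (f0 _ As ys) mul0r cmod0.
  - by apply: side => //; rewrite Req ys subrr mulr0 oppr0 subrr mulr0.
set z := x +i* y.
have Az : rect (x - a) (x + a) y0 y1 z by split => /=; lra.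
have qz : 0 < complex.Re (q z).
  rewrite Req /= subrr mulr0 cos0 mul1r subr_gt0 ltr_expR.
  have : 0 < k * (y1 - y) by rewrite mulr_gt0 ?subr_gt0.
  lra.
apply/eqP; rewrite -cmod_eq0 eq_le cmod_ge0 andbT leNgt; apply/negP => fz0.
pose lambda := C / (cmod (f z) * complex.Re (q z)).
have l0 : 0 <= lambda by rewrite divr_ge0 ?mulr_ge0 ?(ltW qz) ?(ltW fz0).
have := fq lambda z l0 Az.
have := expR_ge1Dx (lambda * complex.Re (q z)).
rewrite -(ler_pM2l fz0) => h1 /(le_trans h1); rewrite mulrDr mulr1.
have -> : cmod (f z) * (lambda * complex.Re (q z)) = C.
  by rewrite /lambda; field; rewrite !gt_eqF.
by apply/negP; rewrite -ltNge ltrDr.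
Qed.

End maximum_principle.

(** * Integrals of bounded complex functions *)

Section complex_integral.
Context {R : realType} d {T : measurableType d} (P : probability T R) (D : set T).
Hypothesis mD : measurable D.
Implicit Types (f g : T -> R[i]) (u : T -> R).

Definition bounded_measurable u : Prop :=
  measurable_fun D u /\ exists C : R, forall y, D y -> `|u y| <= C.

Lemma bounded_measurable_integrable u :
  bounded_measurable u -> P.-integrable D (EFin \o u).
Proof.
move=> [mu [C uC]]; apply: measurable_bounded_integrable => //.
  by rewrite (le_lt_trans (probability_le1 _ _))// ltry.
exists C; split; first exact: num_real.
by move=> M CM y Dy; rewrite /= (le_trans (uC _ Dy))// ltW.
Qed.

Lemma bounded_measurableD u1 u2 : bounded_measurable u1 ->
  bounded_measurable u2 -> bounded_measurable (fun y => u1 y + u2 y).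
Proof.
move=> [m1 [C1 b1]] [m2 [C2 b2]]; split; first exact: measurable_funD.
by exists (C1 + C2) => y Dy; rewrite (le_trans (ler_normD _ _))// lerD ?b1 ?b2.
Qed.

Lemma bounded_measurableZ (c : R) u : bounded_measurable u ->
  bounded_measurable (fun y => c * u y).
Proof.
move=> [m1 [C1 b1]]; split; first exact: measurable_funM.
by exists (`|c| * C1) => y Dy; rewrite normrM ler_wpM2l// b1.
Qed.

Lemma bounded_measurableB u1 u2 : bounded_measurable u1 ->
  bounded_measurable u2 -> bounded_measurable (fun y => u1 y - u2 y).
Proof.
move=> b1 b2; rewrite (_ : (fun _ => _) = (fun y => u1 y + -1 * u2 y)).
  by apply: bounded_measurableD => //; exact: bounded_measurableZ.
by apply/funext => y; rewrite mulN1r.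
Qed.

Lemma bounded_measurable_cst (c : R) : bounded_measurable (fun _ => c).
Proof. by split; [exact: measurable_cst|exists `|c|]. Qed.

Lemma Rintegral_bounded u (C : R) : 0 <= C -> measurable_fun D u ->
  (forall y, D y -> `|u y| <= C) -> `|\int[P]_(y in D) u y| <= C.
Proof.
move=> C0 mu uC.
have iu : P.-integrable D (EFin \o u).
  by apply: bounded_measurable_integrable; split => //; exists C.
have iC : P.-integrable D (EFin \o cst C).
  apply: bounded_measurable_integrable; split; first exact: measurable_cst.
  by exists C => y _; rewrite ger0_norm.
rewrite (le_trans (le_normr_Rintegral mD iu))//.
apply: (le_trans (le_Rintegral mD _ iC uC)).
  apply: bounded_measurable_integrable; split.
    exact: measurableT_comp.
  by exists C => y Dy; rewrite normr_id uC.
rewrite Rintegral_cst// ler_piMr//.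
have PD : (P D <= 1)%E by exact: probability_le1.
by rewrite -[leRHS]/(fine 1%E) fine_le// fin_num_measure.
Qed.

Lemma Rintegral_gt0 u : P D = 1%E -> bounded_measurable u ->
  (forall y, D y -> 0 < u y) -> 0 < \int[P]_(y in D) u y.
Proof.
move=> PD1 bu u0; have u0' y : D y -> 0 <= u y by move=> /u0/ltW.
rewrite lt_neqAle Rintegral_ge0// andbT eq_sym.
apply/eqP => Iu0; have iu := bounded_measurable_integrable bu.
have [mu _] := bu.
have : (\int[P]_(y in D) `|(u y)%:E| = 0)%E.
  rewrite (eq_integral (EFin \o u)); last first.
    by move=> y /set_mem Dy /=; rewrite ger0_norm ?u0'.
  by rewrite -[LHS]fineK ?[fine _]Iu0//; apply: integrable_fin_num.
move=> /(ae_eq_integral_abs _ mD).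
have mEu : measurable_fun D (EFin \o u) by exact/measurable_EFinP.
move=> /(_ mEu) [N [mN PN0 DN]].
have DsubN : D `<=` N.
  move=> y Dy; apply: DN => /= /(_ Dy) [].
  by apply/eqP; rewrite gt_eqF// u0.
have : (P D <= P N)%E by rewrite le_measure// inE.
by rewrite PD1 PN0 leNgt lte01.
Qed.

Definition cmeasurable f : Prop :=
  measurable_fun D (fun y => complex.Re (f y)) /\
  measurable_fun D (fun y => complex.Im (f y)).

Lemma cmeasurable_cst c : cmeasurable (fun _ => c).
Proof. by split; exact: measurable_cst. Qed.

Lemma cmeasurable_real u : measurable_fun D u -> cmeasurable (fun y => (u y)%:C).
Proof. by move=> mu; split => //; exact: measurable_cst. Qed.

Lemma cmeasurableD f g : cmeasurable f -> cmeasurable g ->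
  cmeasurable (fun y => f y + g y).
Proof.
move=> [rf jf] [rg jg]; split.
  rewrite (_ : (fun _ => _) = (fun y => complex.Re (f y) + complex.Re (g y))).
    exact: measurable_funD.
  by apply/funext => y; rewrite ReD.
rewrite (_ : (fun _ => _) = (fun y => complex.Im (f y) + complex.Im (g y))).
  exact: measurable_funD.
by apply/funext => y; rewrite ImD.
Qed.

Lemma cmeasurableM f g : cmeasurable f -> cmeasurable g ->
  cmeasurable (fun y => f y * g y).
Proof.
move=> [rf jf] [rg jg]; split.
  rewrite (_ : (fun _ => _) = (fun y => complex.Re (f y) * complex.Re (g y) -
      complex.Im (f y) * complex.Im (g y))).
    by apply: measurable_funB; exact: measurable_funM.
  by apply/funext => y; rewrite ReM.
rewrite (_ : (fun _ => _) = (fun y => complex.Re (f y) * complex.Im (g y) +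
    complex.Im (f y) * complex.Re (g y))).
  by apply: measurable_funD; exact: measurable_funM.
by apply/funext => y; rewrite ImM.
Qed.

Lemma cmeasurableN f : cmeasurable f -> cmeasurable (fun y => - f y).
Proof.
move=> mf; rewrite (_ : (fun _ => _) = (fun y => - 1 * f y)).
  by apply: cmeasurableM => //; exact: cmeasurable_cst.
by apply/funext => y; rewrite mulN1r.
Qed.

Lemma measurable_funV_ge0 u : measurable_fun D u -> (forall y, 0 <= u y) ->
  measurable_fun D (fun y => (u y)^-1).
Proof.
move=> mu u0; rewrite (_ : (fun _ => _) = (@powR R)^~ (- 1) \o u).
  exact: measurableT_comp.
by apply/funext => y /=; rewrite powR_inv1.
Qed.

Lemma cmeasurableV f : cmeasurable f -> cmeasurable (fun y => (f y)^-1).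
Proof.
move=> [rf jf].
have mc : measurable_fun D (fun y => (cmod (f y) ^+ 2)^-1).
  apply: measurable_funV_ge0; last by move=> y; exact: sqr_ge0.
  rewrite (_ : (fun _ => _) = (fun y => complex.Re (f y) ^+ 2 + complex.Im (f y) ^+ 2)).
    by apply: measurable_funD; exact: measurable_funX.
  by apply/funext => y; rewrite sqr_cmod.
split.
  rewrite (_ : (fun _ => _) = (fun y => complex.Re (f y) / cmod (f y) ^+ 2)).
    exact: measurable_funM.
  by apply/funext => y; rewrite ReV.
rewrite (_ : (fun _ => _) = (fun y => - complex.Im (f y) / cmod (f y) ^+ 2)).
  by apply: measurable_funM => //; exact: measurableT_comp.
by apply/funext => y; rewrite ImV mulNr.
Qed.

Definition cintegral f : R[i] :=
  (\int[P]_(y in D) complex.Re (f y)) +i* (\int[P]_(y in D) complex.Im (f y)).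

Lemma Im_cintegral f :
  complex.Im (cintegral f) = \int[P]_(y in D) complex.Im (f y).
Proof. by []. Qed.

Definition cbounded f : Prop :=
  cmeasurable f /\ exists C : R, forall y, D y -> cmod (f y) <= C.

Lemma cbounded_Re f : cbounded f -> bounded_measurable (fun y => complex.Re (f y)).
Proof.
move=> [[mr mj] [C fC]]; split => //; exists C => y Dy.
exact: le_trans (Re_le_cmod _) (fC _ Dy).
Qed.

Lemma cbounded_Im f : cbounded f -> bounded_measurable (fun y => complex.Im (f y)).
Proof.
move=> [[mr mj] [C fC]]; split => //; exists C => y Dy.
exact: le_trans (Im_le_cmod _) (fC _ Dy).
Qed.

Lemma cboundedD f g : cbounded f -> cbounded g -> cbounded (fun y => f y + g y).
Proof.
move=> [mf [C fC]] [mg [C' gC]]; split; first exact: cmeasurableD.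
exists (C + C') => y Dy; rewrite (le_trans (cmodD _ _))// lerD ?fC ?gC//.
Qed.

Lemma cboundedM f g : cbounded f -> cbounded g -> cbounded (fun y => f y * g y).
Proof.
move=> [mf [C fC]] [mg [C' gC]]; split; first exact: cmeasurableM.
by exists (C * C') => y Dy; rewrite cmodM ler_pM ?cmod_ge0 ?fC ?gC.
Qed.

Lemma cbounded_cst c : cbounded (fun _ => c).
Proof. by split; [exact: cmeasurable_cst|exists (cmod c)]. Qed.

Lemma cboundedX f n : cbounded f -> cbounded (fun y => f y ^+ n).
Proof.
move=> bf; elim: n => [|n IH]; first exact: cbounded_cst.
rewrite (_ : (fun _ => _) = (fun y => f y * f y ^+ n)); first exact: cboundedM.
by apply/funext => y; rewrite exprS.
Qed.

Lemma eq_cintegral f g : {in D, f =1 g} -> cintegral f = cintegral g.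
Proof.
by move=> fg; congr (_ +i* _); apply: eq_Rintegral => y Dy; rewrite fg.
Qed.

Lemma cintegralD f g : cbounded f -> cbounded g ->
  cintegral (fun y => f y + g y) = cintegral f + cintegral g.
Proof.
move=> bf bg; rewrite /cintegral; apply: complexP => /=.
  rewrite -RintegralD//; do ?exact/bounded_measurable_integrable/cbounded_Re.
  by apply: eq_Rintegral => y _; rewrite ReD.
rewrite -RintegralD//; do ?exact/bounded_measurable_integrable/cbounded_Im.
by apply: eq_Rintegral => y _; rewrite ImD.
Qed.

Lemma cintegralZ c f : cbounded f ->
  cintegral (fun y => c * f y) = c * cintegral f.
Proof.
move=> bf; have ir := bounded_measurable_integrable (cbounded_Re bf).
have ij := bounded_measurable_integrable (cbounded_Im bf).
have iZ (k : R) u : P.-integrable D (EFin \o u) ->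
    P.-integrable D (EFin \o (fun y => k * u y)).
  move=> iu; rewrite (_ : _ \o _ = (fun y => k%:E * (u y)%:E)%E).
    exact: integrableZl.
  by apply/funext => y /=; rewrite EFinM.
rewrite /cintegral; apply: complexP; rewrite ?ReM ?ImM /=.
  rewrite -!RintegralZl// -RintegralB//; do ?exact: iZ.
  by apply: eq_Rintegral => y _; rewrite ReM.
rewrite -!RintegralZl// -RintegralD//; do ?exact: iZ.
by apply: eq_Rintegral => y _; rewrite ImM.
Qed.

(** The factor 2 comes from bounding the two parts separately. *)
Lemma cmod_cintegral f (C : R) : 0 <= C -> cmeasurable f ->
  (forall y, D y -> cmod (f y) <= C) -> cmod (cintegral f) <= 2 * C.
Proof.
move=> C0 [mr mj] fC; rewrite (le_trans (cmod_le_ReIm _))//=.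
rewrite mulr_natl mulr2n lerD// Rintegral_bounded// => y Dy.
  exact: le_trans (Re_le_cmod _) (fC _ Dy).
exact: le_trans (Im_le_cmod _) (fC _ Dy).
Qed.

End complex_integral.

(** * The moment transform and the continuation of eta *)

Section moment_transform.
Context {R : realType} (nu : borel_prob R).
Hypothesis nu_pos : nu `]0, +oo[%classic = 1%E.
Implicit Types (w h : R[i]) (x y : R).

Local Notation D := (`]0, +oo[%classic : set (measurableTypeR R)).

Let mD : measurable D. Proof. exact: measurable_itv. Qed.

Let Dgt0 y : D y -> 0 < y.
Proof. by rewrite /= in_itv/= andbT. Qed.

(** The inverse is measurable although it is not continuous at 0: it is the
    quotient of u by u ^+ 2. *)
Lemma measurable_funV (A : set (measurableTypeR R)) (u : measurableTypeR R -> R) :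
  measurable A -> measurable_fun A u -> measurable_fun A (fun y => (u y)^-1).
Proof.
move=> mA mu; rewrite (_ : (fun _ => _) = (fun y => u y * (u y ^+ 2)^-1)).
  apply: measurable_funM => //; apply: measurable_funV_ge0 => //.
  - exact: measurable_funX.
  - by move=> y; exact: sqr_ge0.
apply/funext => y; have [->|u0] := eqVneq (u y) 0; first by rewrite invr0 mul0r.
by field.
Qed.

Lemma Rintegral_setT_pos (u : measurableTypeR R -> R) : measurable_fun setT u ->
  \int[nu]_y u y = \int[nu]_(y in D) u y.
Proof.
move=> mu; rewrite /Rintegral -(setUv D) integral_setU//; last 3 first.
- exact: measurableC.
- by rewrite setUv; exact/measurable_EFinP.
- by apply/disj_setPS => y [].
congr fine; rewrite [X in (_ + X)%E]null_set_integral ?adde0//.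
- exact: measurableC.
- apply/measurable_EFinP; exact: measurable_funTS.
- by apply: (etrans (probability_setC nu mD)); rewrite nu_pos subee.
Qed.

Definition moment_kernel w y : R[i] := (1 - w * y%:C)^-1.

Definition moment_transform w : R[i] := cintegral nu D (moment_kernel w).

Local Notation M := moment_transform.

(** For w < 0 the denominator is 1 + |w| y; otherwise its imaginary part controls
    y, and then 1 <= |1 - w y| + |w| y. Thus the kernel k and the product y k are
    bounded in y. *)
Lemma moment_denominator_bound w : slit_plane w ->
  exists2 L : R, 0 < L & forall y, 0 < y -> 1 + y <= L * cmod (1 - w * y%:C).
Proof.
rewrite /slit_plane/= lecE negb_and -ltNge /=.
have [w0 w0'|wI _] := eqVneq (complex.Im w) 0.
  rewrite /= in w0'.
  exists (1 + (- complex.Re w)^-1) => [|y y0].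
    by rewrite addr_gt0// invr_gt0 oppr_gt0.
  have -> : 1 - w * y%:C = (1 + - complex.Re w * y)%:C.
    by apply: complexP; rewrite !(ReD, ImD, ReN, ImN, ReM, ImM) /= ?w0; ring.
  have w0y : 0 < - complex.Re w * y by rewrite mulr_gt0// oppr_gt0.
  rewrite cmod_real gtr0_norm ?addr_gt0// mulrDl mul1r mulrDr mulr1.
  rewrite mulKf ?oppr_eq0 ?lt_eqF//.
  have : 0 < (- complex.Re w)^-1 by rewrite invr_gt0 oppr_gt0.
  lra.
have aI : 0 < `|complex.Im w| by rewrite normr_gt0.
exists (1 + cmod w / `|complex.Im w| + `|complex.Im w|^-1) => [|y y0].
  by rewrite addr_gt0 ?invr_gt0// ltr_wpDr// divr_ge0 ?cmod_ge0.
set c := cmod (1 - _).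
have yc : y <= c / `|complex.Im w|.
  rewrite ler_pdivlMr//; apply: le_trans (Im_le_cmod _).
  rewrite !(ImD, ImN, ImM)/= mulr0 !add0r normrN normrM (gtr0_norm y0).
  by rewrite mulrC.
have h1 : 1 <= c + cmod w * y.
  have := cmodD (1 - w * y%:C) (w * y%:C); rewrite subrK cmod1 cmodM cmod_real.
  by rewrite gtr0_norm.
have h2 : cmod w * y <= cmod w * (c / `|complex.Im w|).
  by rewrite ler_wpM2l ?cmod_ge0.
rewrite [leRHS](_ : _ = c + cmod w * (c / `|complex.Im w|) + c / `|complex.Im w|).
  by lra.
by ring.
Qed.

Lemma cmeasurable_moment_kernel w : cmeasurable D (moment_kernel w).
Proof.
apply: cmeasurableV; apply: cmeasurableD; first exact: cmeasurable_cst.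
apply: cmeasurableN; apply: cmeasurableM; first exact: cmeasurable_cst.
by apply: cmeasurable_real; exact: measurable_id.
Qed.

(** The kernel at w + h is k + h y k^2 + h^2 y^2 k^3 plus h^3 (y k)^3 times the
    kernel at w + h. As y k is bounded, this exact geometric expansion may be
    integrated term by term. *)
Lemma jet2_moment_transform w : slit_plane w -> jet2 M w.
Proof.
move=> /moment_denominator_bound [L L0 dL].
have c0 y : D y -> 0 < cmod (1 - w * y%:C).
  move=> /Dgt0 y0; rewrite -(pmulr_rgt0 _ L0) (lt_le_trans _ (dL _ y0))//.
  exact: addr_gt0.
have bk : cbounded D (moment_kernel w).
  split; first exact: cmeasurable_moment_kernel.
  exists L => y Dy; have y0 := Dgt0 Dy; rewrite cmodV.
  rewrite -[leLHS]div1r ler_pdivrMr ?c0//.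
  by rewrite (le_trans _ (dL _ y0))// lerDl ltW.
pose yk y := y%:C * moment_kernel w y.
have byk : cbounded D yk.
  split.
    apply: cmeasurableM; last exact: cmeasurable_moment_kernel.
    by apply: cmeasurable_real; exact: measurable_id.
  exists L => y Dy; have y0 := Dgt0 Dy; rewrite cmodM cmodV cmod_real gtr0_norm//.
  by rewrite ler_pdivrMr ?c0// (le_trans _ (dL _ y0))// lerDr.
pose A := cintegral nu D (fun y => yk y * moment_kernel w y).
pose B := cintegral nu D (fun y => yk y ^+ 2 * moment_kernel w y).
apply: (@jet2P _ _ _ A B (2 * (2 * L * L ^+ 3)) ((2 * L)^-1)).
  by rewrite invr_gt0 mulr_gt0.
move=> h hL.
have c1 y : D y -> (2 * L)^-1 <= cmod (1 - (w + h) * y%:C).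
  move=> /Dgt0 y0; have hy : cmod (h * y%:C) <= (2 * L)^-1 * y.
    by rewrite cmodM cmod_real gtr0_norm// ler_wpM2r// ltW.
  have := cmod_lerB (1 - w * y%:C) (h * y%:C).
  rewrite (_ : 1 - w * y%:C - h * y%:C = 1 - (w + h) * y%:C); last by ring.
  apply: le_trans.
  have : (1 + y) / L <= cmod (1 - w * y%:C) by rewrite ler_pdivrMr// mulrC dL.
  have -> : (1 + y) / L = 2 * (2 * L)^-1 + 2 * ((2 * L)^-1 * y).
    by field; rewrite gt_eqF.
  have : 0 < (2 * L)^-1 by rewrite invr_gt0 mulr_gt0.
  have : 0 < (2 * L)^-1 * y by rewrite mulr_gt0// invr_gt0 mulr_gt0.
  lra.
have c1' y : D y -> 0 < cmod (1 - (w + h) * y%:C).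
  by move=> /c1; apply: lt_le_trans; rewrite invr_gt0 mulr_gt0.
pose rest y := yk y ^+ 3 * moment_kernel (w + h) y.
have brest : cbounded D rest.
  apply: cboundedM; first exact: cboundedX.
  split; first exact: cmeasurable_moment_kernel.
  exists (2 * L) => y Dy; rewrite cmodV -[leRHS]invrK lef_pV2 ?c1// posrE ?c1'//.
  by rewrite invr_gt0 mulr_gt0.
have -> : M (w + h) = M w + h * A + h ^+ 2 * B + h ^+ 3 * cintegral nu D rest.
  rewrite -!cintegralZ//; last 2 first.
  - by apply: cboundedM => //; exact: cboundedX.
  - exact: cboundedM.
  have bZ c (f : measurableTypeR R -> R[i]) : cbounded D f ->
      cbounded D (fun y => c * f y).
    by move=> bf; apply: cboundedM => //; exact: cbounded_cst.
  have b1 : cbounded D (fun y => h * (yk y * moment_kernel w y)).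
    by apply: bZ; exact: cboundedM.
  have b2 : cbounded D (fun y => h ^+ 2 * (yk y ^+ 2 * moment_kernel w y)).
    by apply: bZ; apply: cboundedM => //; exact: cboundedX.
  have b3 : cbounded D (fun y => h ^+ 3 * rest y) by exact: bZ.
  rewrite -!cintegralD//; do ?[exact: cboundedD|apply: cboundedD => //; exact: cboundedD].
  apply: eq_cintegral => y /set_mem Dy; rewrite /rest /yk /moment_kernel.
  have d1 : 1 - w * y%:C != 0 by rewrite -cmod_gt0 c0.
  have d2 : 1 - (w + h) * y%:C != 0 by rewrite -cmod_gt0 c1'.
  by field; rewrite d1 d2.
rewrite [X in cmod X](_ : _ = h ^+ 3 * cintegral nu D rest); last by ring.
rewrite cmodM cmodX mulrC ler_wpM2r ?exprn_ge0 ?cmod_ge0//.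
apply: cmod_cintegral => //; first by rewrite !mulr_ge0 ?exprn_ge0// ltW.
  by case: brest.
move=> y Dy; have y0 := Dgt0 Dy.
rewrite cmodM cmodX mulrC ler_pM ?cmod_ge0 ?exprn_ge0 ?cmod_ge0//.
  rewrite cmodV -[leRHS]invrK lef_pV2 ?c1// posrE ?c1'//.
  by rewrite invr_gt0 mulr_gt0.
rewrite lerXn2r ?nnegrE ?cmod_ge0 ?(ltW L0)//.
rewrite cmodM cmodV cmod_real gtr0_norm//.
by rewrite ler_pdivrMr ?c0// (le_trans _ (dL _ y0))// lerDr.
Qed.

Lemma cbounded_moment_kernel w : slit_plane w -> cbounded D (moment_kernel w).
Proof.
move=> /moment_denominator_bound [L L0 dL].
split; first exact: cmeasurable_moment_kernel.
exists L => y /Dgt0 y0; rewrite cmodV -[leLHS]div1r ler_pdivrMr.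
  by rewrite (le_trans _ (dL _ y0))// lerDl ltW.
rewrite -(pmulr_rgt0 _ L0) (lt_le_trans _ (dL _ y0))//.
exact: addr_gt0.
Qed.

Lemma slit_plane_Im w : complex.Im w < 0 -> slit_plane w.
Proof. by move=> w0; rewrite /slit_plane/= lecE/= lt_eqF. Qed.

Lemma slit_plane_neg x : x < 0 -> slit_plane x%:C.
Proof. by move=> x0; rewrite /slit_plane/= lecE/= eqxx/= -ltNge. Qed.

Lemma Im_moment_transform w : complex.Im w < 0 -> complex.Im (M w) < 0.
Proof.
move=> w0; rewrite -oppr_gt0 /moment_transform /cintegral /=.
have bk := cbounded_Im (cbounded_moment_kernel (slit_plane_Im w0)).
rewrite -mulN1r -RintegralZl//; last exact: bounded_measurable_integrable.
apply: Rintegral_gt0 => //; first exact: bounded_measurableZ.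
move=> y /Dgt0 y0; rewrite /moment_kernel ImV mulrN mulN1r opprK.
have Imd : complex.Im (1 - w * y%:C) = - complex.Im w * y.
  by rewrite !(ImD, ImN, ImM)/=; ring.
have d0 : 0 < complex.Im (1 - w * y%:C) by rewrite Imd mulr_gt0// oppr_gt0.
rewrite divr_gt0// exprn_gt0// (lt_le_trans _ (Im_le_cmod _))//.
by rewrite normr_gt0 gt_eqF.
Qed.

Definition real_moment_transform x : R := \int[nu]_(y in D) (1 - x * y)^-1.

Local Notation m := real_moment_transform.

Let kernel_real x y : moment_kernel x%:C y = ((1 - x * y)^-1)%:C.
Proof. by rewrite /moment_kernel fmorphV rmorphB rmorphM rmorph1. Qed.

Lemma moment_transform_real x : M x%:C = (m x)%:C.
Proof.
rewrite -[RHS]/(m x +i* 0); congr (_ +i* _).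
  by apply: eq_Rintegral => y _; rewrite kernel_real.
rewrite (@eq_Rintegral _ _ _ _ _ (cst 0)) ?Rintegral_cst ?mul0r// => y _.
by rewrite kernel_real.
Qed.

Let bounded_real_kernel x : x < 0 ->
  bounded_measurable D (fun y => (1 - x * y)^-1).
Proof.
move=> x0; have -> : (fun y : measurableTypeR R => (1 - x * y)^-1) =
    (fun y => complex.Re (moment_kernel x%:C y)).
  by apply/funext => y; rewrite kernel_real.
exact/cbounded_Re/cbounded_moment_kernel/slit_plane_neg.
Qed.

Lemma real_moment_transform_gt0 x : x < 0 -> 0 < m x.
Proof.
move=> x0; apply: Rintegral_gt0 => //; first exact: bounded_real_kernel.
move=> y /Dgt0 y0; rewrite invr_gt0 subr_gt0 (lt_trans _ ltr01)//.
by rewrite nmulr_rlt0.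
Qed.

Lemma real_moment_transform_mono x x' : x < x' -> x' < 0 -> m x < m x'.
Proof.
move=> xx' x'0; have x0 := lt_trans xx' x'0.
rewrite -subr_gt0 -RintegralB//;
  do ?exact/bounded_measurable_integrable/bounded_real_kernel.
apply: Rintegral_gt0 => //.
  by apply: bounded_measurableB; exact: bounded_real_kernel.
move=> y /Dgt0 y0; rewrite subr_gt0.
have xy0 : x' * y < 0 by rewrite nmulr_rlt0.
have xy : x * y < x' * y by rewrite ltr_pM2r.
by rewrite ltf_pV2 ?posrE; lra.
Qed.

Lemma real_moment_transform_lt1 x : x < 0 -> m x < 1.
Proof.
move=> x0; rewrite -subr_gt0.
have -> : 1 = \int[nu]_(y in D) (cst 1 y).
  by rewrite Rintegral_cst// mul1r; exact/esym/(congr1 fine nu_pos).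
rewrite -RintegralB//; last 2 first.
- by apply: bounded_measurable_integrable => //; exact: bounded_measurable_cst.
- exact/bounded_measurable_integrable/bounded_real_kernel.
apply: Rintegral_gt0 => //.
  apply: bounded_measurableB; first exact: bounded_measurable_cst.
  exact: bounded_real_kernel.
move=> y /Dgt0 y0; rewrite subr_gt0 /=.
have xy0 : x * y < 0 by rewrite nmulr_rlt0.
by rewrite invf_lt1; lra.
Qed.

Lemma eta_transform_moment x : x < 0 -> eta_transform nu x = 1 - (m x)^-1.
Proof.
move=> x0; rewrite /eta_transform /F_transform /cauchy_transform.
rewrite Rintegral_setT_pos; last first.
  by apply: measurable_funV => //; apply: measurable_funB.
have -> : \int[nu]_(y in D) (x^-1 - y)^-1 = x * m x.
  rewrite -RintegralZl//; last first.
    exact/bounded_measurable_integrable/bounded_real_kernel.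
  apply: eq_Rintegral => y /set_mem/Dgt0 y0.
  by rewrite -[RHS]invf_div; congr (_^-1); field; rewrite lt_eqF.
by rewrite invfM mulrA divff ?mul1r// lt_eqF.
Qed.

Lemma eta_transform_lt0 x : x < 0 -> eta_transform nu x < 0.
Proof.
move=> x0; rewrite eta_transform_moment// subr_lt0.
by rewrite invf_gt1 ?real_moment_transform_gt0 ?real_moment_transform_lt1.
Qed.

Lemma eta_transform_mono x x' : x < x' -> x' < 0 ->
  eta_transform nu x < eta_transform nu x'.
Proof.
move=> xx' x'0; rewrite !eta_transform_moment ?(lt_trans xx')//.
rewrite ltrD2l ltrN2 ltf_pV2 ?posrE ?real_moment_transform_gt0 ?(lt_trans xx')//.
exact: real_moment_transform_mono.
Qed.

(** The analytic continuation of eta_transform off the negative axis. *)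
Definition complex_eta w : R[i] := 1 - (M w)^-1.

Lemma complex_eta_real x : x < 0 -> complex_eta x%:C = (eta_transform nu x)%:C.
Proof.
move=> x0; rewrite /complex_eta moment_transform_real eta_transform_moment//.
by rewrite rmorphB rmorph1 fmorphV.
Qed.

Lemma Im_complex_eta w : complex.Im w < 0 -> complex.Im (complex_eta w) < 0.
Proof.
move=> /Im_moment_transform Mw; rewrite /complex_eta ImD ImN ImV opprK add0r.
rewrite nmulr_rlt0// invr_gt0 exprn_gt0// (lt_le_trans _ (Im_le_cmod _))//.
by rewrite normr_gt0 lt_eqF.
Qed.

Lemma moment_transform_neq0 w : complex.Im w < 0 -> M w != 0.
Proof.
by move=> /Im_moment_transform; apply: contraTN => /eqP ->; rewrite ltxx.
Qed.

Lemma jet2_complex_eta w :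
  complex.Im w < 0 \/ (exists2 x, x < 0 & w = x%:C) -> jet2 complex_eta w.
Proof.
move=> wP; have [sw Mw] : slit_plane w /\ M w != 0.
  case: wP => [w0|[x x0 ->]].
    by split; [exact: slit_plane_Im|exact: moment_transform_neq0].
  split; first exact: slit_plane_neg.
  rewrite moment_transform_real -cmod_gt0 cmod_real normr_gt0 gt_eqF//.
  exact: real_moment_transform_gt0.
apply: jet2B; first exact: jet2_cst.
by apply: (jet2_comp (g := GRing.inv)); [exact: jet2_moment_transform|exact: jet2_inv].
Qed.

End moment_transform.

(** * The functional equation of eta *)

Section functional_equation.
Context {R : realType} (mu : borel_prob R) (v : Cplx R -> Cplx R).
Hypothesis v_mu : is_v_function mu v.
Variables (t : R) (nu : borel_prob R).
Hypothesis nu_t : is_free_mult_power mu t nu.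

Let nu_pos : nu `]0, +oo[%classic = 1%E. Proof. by case: nu_t. Qed.

Lemma v_real (x : R) : x < 0 -> v x%:C = (complex.Re (v x%:C))%:C.
Proof.
case: v_mu => _ vJ _ _ x0; have := vJ x%:C (slit_plane_neg x0).
rewrite conjc_real => vE; apply: complexP => //=.
have := congr1 (@complex.Im R) vE; case: (v x%:C) => a b /=; lra.
Qed.

Lemma eta_inv_power (x : R) : x < 0 ->
  eta_inv nu x = x * expR (t * complex.Re (v x%:C)).
Proof.
move=> x0; case: v_mu => _ _ _ vS; case: nu_t => _ /(_ _ x0).
have -> : Sigma_transform mu x = expR (complex.Re (v x%:C)).
  have := vS _ x0; rewrite v_real// expC_real.
  by move=> /(congr1 (@complex.Re R)).
rewrite /powR gt_eqF ?expR_gt0// expRK /Sigma_transform => <-.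
by rewrite mulrC divfK// lt_eqF.
Qed.

(** The argument of eta is the value of eta_inv at x. It is nonzero, so it is a
    genuine preimage of x and not the default value of eta_inv. *)
Lemma eta_transform_phi (x : R) : x < 0 ->
  eta_transform nu (x * expR (t * complex.Re (v x%:C))) = x.
Proof.
move=> x0; have := eta_inv_power x0; rewrite /eta_inv.
case: xgetP => [y -> [y0 ey] <-//|_ /esym/eqP].
by rewrite mulf_eq0 lt_eqF// gt_eqF// expR_gt0.
Qed.

Lemma eta_transform_inj (x y : R) : x < 0 -> y < 0 ->
  eta_transform nu x = eta_transform nu y -> x = y.
Proof.
move=> x0 y0 xy; have [xy'|xy'|//] := ltgtP x y.
  by have := eta_transform_mono nu_pos xy' y0; rewrite xy ltxx.
by have := eta_transform_mono nu_pos xy' x0; rewrite xy ltxx.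
Qed.

(** Both sides have the same image under eta, which is injective. *)
Lemma functional_equation_neg (x : R) : x < 0 ->
  let h := complex_eta nu x%:C in h * expC (t%:C * v h) = x%:C.
Proof.
move=> x0 /=; rewrite complex_eta_real//.
have e0 := eta_transform_lt0 nu_pos x0; rewrite v_real// -rmorphM expC_real -rmorphM.
congr (_%:C); apply: eta_transform_inj => //.
  by rewrite nmulr_rlt0// expR_gt0.
exact: eta_transform_phi.
Qed.

Lemma expC_polar_neg (x tau : R) : 0 < tau < pi ->
  complex.Im (expC (x +i* (- tau))) < 0.
Proof.
move=> taupi; rewrite /expC ImM /= mul0r addr0 sinN mulrN oppr_lt0.
by rewrite mulr_gt0 ?expR_gt0 ?sin_gt0_pi.
Qed.

Lemma expC_polar_pi (x : R) : expC (x +i* (- pi)) = (- expR x)%:C.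
Proof.
apply: complexP; rewrite /expC ?(ReM, ImM) /= sinN cosN sinpi cospi; ring.
Qed.

(** The relation is known on the negative axis only. In the coordinate s = log w
    this is the line Im s = - pi, and the identity principle carries the relation
    to the strip - pi <= Im s < 0: both sides are analytic there, since eta maps
    the lower half-plane to itself and v is defined on it. *)
Lemma functional_equation (x tau : R) : 0 < tau <= pi ->
  let h := complex_eta nu (expC (x +i* (- tau))) in
  h * expC (t%:C * v h) = expC (x +i* (- tau)).
Proof.
move=> /andP[tau0 taupi] /=; apply/eqP; rewrite -subr_eq0; apply/eqP.
pose f s := complex_eta nu (expC s) *
  expC (t%:C * v (complex_eta nu (expC s))) - expC s.
have dom s : rect (x - 1) (x + 1) (- pi) (- (tau / 2)) s ->
    complex.Im (expC s) < 0 \/ (exists2 y, y < 0 & expC s = y%:C).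
  case: s => s1 s2 [_ /andP[s2pi s2tau]]; rewrite /= in s2pi s2tau.
  rewrite -[s2]opprK; have [s2E|s2pi'] := eqVneq (- s2) pi.
    by right; exists (- expR s1); rewrite ?oppr_lt0 ?expR_gt0// s2E expC_polar_pi.
  left; apply: expC_polar_neg; rewrite (lt_neqAle (- s2)) s2pi'/=.
  by rewrite lerNl s2pi andbT; lra.
apply: (@identity_principle _ f x 1 (- pi) (- (tau / 2))) => //; last first.
  by rewrite lerN2 taupi ltrN2; lra.
- move=> [s1 s2] [/= s1x _] /= ->; rewrite /f expC_polar_pi.
  by rewrite functional_equation_neg ?subrr// oppr_lt0 expR_gt0.
- move=> s /dom ds.
  have jeta : jet2 (fun s => complex_eta nu (expC s)) s.
    apply: (jet2_comp (g := complex_eta nu)); first exact: jet2_expC.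
    exact: jet2_complex_eta.
  apply: jet2B; last exact: jet2_expC.
  apply: jet2M => //; apply: (jet2_comp (g := @expC R)); last exact: jet2_expC.
  apply: jet2M; first exact: jet2_cst.
  apply: (jet2_comp (g := v)) => //; apply: (jet2_analytic (D := slit_plane)).
    by case: v_mu.
  case: ds => [/(Im_complex_eta nu_pos)/slit_plane_Im//|[y y0 ->]].
  by rewrite complex_eta_real//; apply/slit_plane_neg/eta_transform_lt0.
Qed.

End functional_equation.

(** * Bounds for the boundary extension of v *)

Section boundary_extension.
Context {R : realType} (v ve : Cplx R -> Cplx R) (I : set R).
Hypothesis I_open : open I.
Hypothesis I1 : I 1.
Hypothesis ve_ext : forall z, Omega z -> ve z = v z.
Hypothesis ve_cont :
  {within @Omega R `|` [set x%:C | x in I], continuous ve}.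

Lemma extension_cmod_continuous (z : R[i]) :
  (@Omega R `|` [set x%:C | x in I]) z -> forall e : R, 0 < e ->
  exists2 d : R, 0 < d & forall w : R[i],
    (@Omega R `|` [set x%:C | x in I]) w -> cmod (w - z) < d ->
    cmod (ve w - ve z) < e.
Proof.
move=> Az e e0; have /subspace_continuousP/(_ z Az) := ve_cont.
move=> /cvgrPdist_lt/(_ e%:C); rewrite (ltcR 0 e) => /(_ e0).
rewrite near_withinE => /nbhs_ballP[d /= d0 dP].
have dE : d = (complex.Re d)%:C.
  by apply: complexP => //=; move: d0; rewrite ltcE/= => /andP[/eqP].
exists (complex.Re d); first by rewrite -(ltcR 0) -dE.
move=> w Aw wd; have := dP w; rewrite /ball /= dE.
move=> /(_ _ Aw); rewrite !normC_cmod !ltcR !(cmod_distC _ w).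
by move=> /(_ wd); rewrite cmod_distC.
Qed.

Definition lower_annulus (r0 r1 : R) : set R[i] :=
  [set z | complex.Im z <= 0 /\ r0 <= cmod z <= r1].

Lemma compact_lower_annulus (r0 r1 : R) : 0 < r0 -> 0 < r1 ->
  compact [set p : R * R | lower_annulus r0 r1 (p.1 +i* p.2)].
Proof.
move=> r00 r10.
have cont : continuous (fun p : R * R => p.1 ^+ 2 + p.2 ^+ 2).
  move=> p; apply: cvgD.
    by apply: (@continuous_comp _ _ _ fst (fun x : R => x ^+ 2));
      [exact: cvg_fst|exact: exprn_continuous].
  by apply: (@continuous_comp _ _ _ snd (fun x : R => x ^+ 2));
    [exact: cvg_snd|exact: exprn_continuous].
have -> : [set p : R * R | lower_annulus r0 r1 (p.1 +i* p.2)] =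
    [set p | rect (- r1) r1 (- r1) 0 (p.1 +i* p.2)] `&`
    (fun p : R * R => p.1 ^+ 2 + p.2 ^+ 2) @^-1` `[r0 ^+ 2, r1 ^+ 2].
  apply/seteqP; split => [[p q] /=|[p q] /=]; rewrite /lower_annulus /rect /=.
    move=> [q0 /andP[rp pr]]; rewrite in_itv/=.
    have := sqr_cmod (p +i* q) => /= <-.
    have := Re_le_cmod (p +i* q); have := Im_le_cmod (p +i* q) => /=.
    rewrite !ler_norml => /andP[h1 h2] /andP[h3 h4].
    rewrite !lerXn2r ?nnegrE ?cmod_ge0 ?(ltW r00) ?(ltW r10)// q0.
    by split => //; split; apply/andP; split; lra.
  rewrite in_itv/= => -[[_ /andP[_ q0]]].
  have := sqr_cmod (p +i* q) => /= <-.
  by rewrite !ler_pXn2r ?nnegrE ?cmod_ge0 ?(ltW r00) ?(ltW r10).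
apply: (@subclosed_compact _ _ [set p | rect (- r1) r1 (- r1) 0 (p.1 +i* p.2)]).
- apply: closedI; first exact/(compact_closed (@norm_hausdorff _ _))/compact_rect.
  by apply: preimage_closed => //; exact: itv_closed.
- exact: compact_rect.
- exact: subIsetl.
Qed.

(** Near the circle |z| = 1 the real points of the lower half-annulus are either
    negative, hence in Omega, or close to 1, hence in I. The bound follows by
    compactness. *)
Lemma lower_annulus_bound : exists r0 r1 C : R, [/\ 0 < r0 < 1, 1 < r1, 0 <= C &
  forall z : R[i], lower_annulus r0 r1 z ->
    (@Omega R `|` [set x%:C | x in I]) z /\ cmod (ve z) <= C].
Proof.
have [d d0 dI] : exists2 d : R, 0 < d & ball (1 : R) d `<=` I.
  have : nbhs (1 : R) I by exact: open_nbhs_nbhs.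
  by move=> /nbhs_ballP[d /= d0 dI]; exists d.
pose a := Num.min (d / 2) (1 / 2).
have a0 : 0 < a by rewrite lt_min !divr_gt0.
have ad : a < d by rewrite (@le_lt_trans _ _ (d / 2)) ?ge_min ?lexx//; lra.
have a1 : a <= 1 / 2 by rewrite ge_min lexx orbT.
clearbody a.
have SA z : lower_annulus (1 - a) (1 + a) z ->
    (@Omega R `|` [set x%:C | x in I]) z.
  move=> [Iz /andP[z1 z2]]; have [Iz0|Iz0] := ltP (complex.Im z) 0.
    by left; right.
  have Im0 : complex.Im z = 0 by apply/eqP; rewrite eq_le Iz Iz0.
  have zE : z = (complex.Re z)%:C by apply: complexP.
  have [Rz0|Rz0] := ltP (complex.Re z) 0; first by left; left.
  right; exists (complex.Re z) => //; apply: dI.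
  move: z1 z2; rewrite zE cmod_real ger0_norm//= => z1 z2.
  by rewrite /ball/= ltr_norml; apply/andP; split; lra.
have [|||c Sc cmax] := @cmod_continuous_max _ (lower_annulus (1 - a) (1 + a))
  (fun z => cmod (ve z)).
- exists 1; split => //=; rewrite cmod1; apply/andP; split; lra.
- by apply: compact_lower_annulus; lra.
- move=> z /SA Az e e0; have [d' d'0 vd] := extension_cmod_continuous Az e0.
  exists d' => // w /SA Aw /(vd _ Aw); apply: le_lt_trans.
  by rewrite ler_norml cmod_lerB andbT lerNl opprB cmod_distC cmod_lerB.
exists (1 - a), (1 + a), (cmod (ve c)); split => //.
- by apply/andP; split; lra.
- by lra.
- exact: cmod_ge0.
- by move=> z Sz; split; [exact: SA|exact: cmax].
Qed.

End boundary_extension.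

(** * Small-time asymptotics of the moment transform *)

(** Values of eta along the circle of radius exp x: tau = pi is the point on the
    negative axis, and tau tends to 0 towards the positive axis. *)
Definition eta_arc {R : realType} (nu : borel_prob R) (x tau : R) : R[i] :=
  complex_eta nu (expC (x +i* (- tau))).

Section small_time_estimate.
Context {R : realType} (mu : borel_prob R) (v ve : Cplx R -> Cplx R) (I : set R).
Hypothesis v_mu : is_v_function mu v.
Hypothesis ve_ext : forall z, Omega z -> ve z = v z.

Section trap.
Variables (t : R) (nu : borel_prob R) (r0 r1 C N : R).
Hypothesis t0 : 0 < t.
Hypothesis nu_t : is_free_mult_power mu t nu.
Hypothesis r01 : 0 < r0 < r1.
Hypothesis ve_bound : forall z : R[i], lower_annulus r0 r1 z -> cmod (ve z) <= C.
Hypothesis r1_large : expR (t * (N + C)) < r1.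
Hypothesis r0_small : r0 < expR (- (t * (N + C))).

Let nu_pos : nu `]0, +oo[%classic = 1%E. Proof. by case: nu_t. Qed.

Local Notation path := (eta_arc nu).

Lemma path_lower x tau : 0 < tau <= pi ->
  complex.Im (path x tau) <= 0 /\ Omega (path x tau).
Proof.
move=> /andP[tau0 taupi]; rewrite /eta_arc; have [->|taupi'] := eqVneq tau pi.
  have x0 : - expR x < 0 by rewrite oppr_lt0 expR_gt0.
  rewrite expC_polar_pi complex_eta_real//; split => //=; left => /=.
  exact: eta_transform_lt0.
have Imh : complex.Im (complex_eta nu (expC (x +i* (- tau)))) < 0.
  apply: (Im_complex_eta nu_pos); apply: expC_polar_neg.
  by rewrite tau0 lt_neqAle taupi'.
by split; [exact: ltW|right].
Qed.

Lemma cmod_path x tau : 0 < tau <= pi ->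
  cmod (path x tau) = expR (x - t * complex.Re (ve (path x tau))).
Proof.
move=> taupi; have [_ /ve_ext veE] := path_lower x taupi.
have := functional_equation v_mu nu_t x taupi => /=.
rewrite -/(path x tau) -veE => /(congr1 cmod); rewrite cmodM !cmod_expC ReM /=.
rewrite mul0r subr0 => h; rewrite expRD expRN -h mulrK//.
by rewrite unitfE gt_eqF// expR_gt0.
Qed.

Lemma cmod_path_strict x tau : `|x| <= t * N -> 0 < tau <= pi ->
  lower_annulus r0 r1 (path x tau) -> r0 < cmod (path x tau) < r1.
Proof.
move=> xN taupi Sh; rewrite cmod_path//.
have vC : `|complex.Re (ve (path x tau))| <= C.
  exact: le_trans (Re_le_cmod _) (ve_bound Sh).
have tvC : `|t * complex.Re (ve (path x tau))| <= t * C.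
  by rewrite normrM gtr0_norm// ler_pM2l.
move: xN tvC; rewrite !ler_norml => /andP[x1 x2] /andP[v1 v2].
apply/andP; split.
  by rewrite (lt_le_trans r0_small)// ler_expR; lra.
by rewrite (le_lt_trans _ r1_large)// ler_expR; lra.
Qed.

(** On the negative axis eta is increasing and takes the values - r0 and - r1 at
    the points - r0 exp (t v(- r0)) and - r1 exp (t v(- r1)); the point - exp x
    lies between them. *)
Lemma cmod_path_start x : `|x| <= t * N -> r0 < cmod (path x pi) < r1.
Proof.
have [r00 r01'] := andP r01; have r10 := lt_trans r00 r01'.
rewrite ler_norml => /andP[x1 x2].
have x0 : - expR x < 0 by rewrite oppr_lt0 expR_gt0.
rewrite /eta_arc expC_polar_pi complex_eta_real// cmod_real ltr0_norm; last first.
  exact: eta_transform_lt0.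
have S r : r0 <= r <= r1 -> `|t * complex.Re (v (- r)%:C)| <= t * C.
  move=> /andP[rr0 rr1]; rewrite normrM gtr0_norm// ler_pM2l//.
  have r_gt0 : 0 < r by exact: lt_le_trans rr0.
  rewrite (le_trans (Re_le_cmod _))// -ve_ext; last by left; rewrite /= oppr_lt0.
  apply: ve_bound; split => //.
  by rewrite cmod_real normrN gtr0_norm// rr0.
have phi0 r : 0 < r -> - r * expR (t * complex.Re (v (- r)%:C)) < 0.
  by move=> r0'; rewrite nmulr_rlt0 ?expR_gt0// oppr_lt0.
have etaphi r : 0 < r ->
    eta_transform nu (- r * expR (t * complex.Re (v (- r)%:C))) = - r.
  by move=> r_gt0; rewrite (eta_transform_phi v_mu nu_t)// oppr_lt0.
apply/andP; split.
  rewrite ltrNr -(etaphi _ r00); apply: eta_transform_mono => //; last exact: phi0.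
  rewrite mulNr ltrN2 -ltr_pdivlMr ?expR_gt0// -expRN -expRD.
  rewrite (lt_le_trans r0_small)// ler_expR.
  have := S r0; rewrite lexx (ltW r01') ler_norml => /(_ isT)/andP[_]; lra.
rewrite ltrNl -(etaphi _ r10); apply: eta_transform_mono => //.
rewrite mulNr ltrN2 -ltr_pdivrMr ?expR_gt0// -expRN -expRD.
rewrite (le_lt_trans _ r1_large)// ler_expR.
have := S r1; rewrite lexx (ltW r01') ler_norml => /(_ isT)/andP[]; lra.
Qed.

Lemma continuous_cmod_path x a : 0 < a -> a <= pi ->
  {within `[a, pi], continuous (fun tau => cmod (path x tau))}.
Proof.
move=> a0 api; apply: continuous_in_subspaceT => tau /set_mem/=.
rewrite in_itv/= => /andP[atau taupi].
have tau0 := lt_le_trans a0 atau.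
have jp : jet2 (fun s => complex_eta nu (expC s)) (x +i* (- tau)).
  apply: (jet2_comp (g := complex_eta nu)); first exact: jet2_expC.
  apply: jet2_complex_eta => //; have [->|taupi'] := eqVneq tau pi.
    by right; exists (- expR x); rewrite ?oppr_lt0 ?expR_gt0// expC_polar_pi.
  by left; apply: expC_polar_neg; rewrite tau0 lt_neqAle taupi'.
apply/cvgrPdist_lt => e e0; have [d d0 dP] := jet2_continuous jp e0.
apply/nbhs_ballP; exists d => //= tau'; rewrite /ball/= => taud.
have : cmod ((x +i* (- tau')) - (x +i* (- tau))) < d.
  rewrite (le_lt_trans (cmod_le_ReIm _))//= subrr normr0 add0r.
  by rewrite opprK addrC.
move=> /dP; apply: le_lt_trans; rewrite distrC.
by rewrite ler_norml cmod_lerB andbT lerNl opprB cmod_distC cmod_lerB.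
Qed.

(** While eta stays in the annulus, the functional equation keeps it away from
    its two boundary circles; so along an arc of the circle |w| = exp x that
    starts on the negative axis it cannot leave the annulus. *)
Lemma annulus_trap x tau : `|x| <= t * N -> 0 < tau <= pi ->
  lower_annulus r0 r1 (path x tau).
Proof.
move=> xN /andP[tau0 taupi].
have [r00 r01'] := andP r01; have [/andP[s0 s1]] := cmod_path_start xN.
have no_cross r : r0 <= r <= r1 -> r = r0 \/ r = r1 ->
    ~ exists2 c, c \in `[tau, pi] & cmod (path x c) = r.
  move=> rr rE [c]; rewrite in_itv/= => /andP[tc cpi] pr.
  have cP : 0 < c <= pi by rewrite cpi (lt_le_trans tau0).
  have Sc : lower_annulus r0 r1 (path x c).
    by split; [exact: (path_lower x cP).1|rewrite pr].
  have := cmod_path_strict xN cP Sc; rewrite pr.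
  by case: rE => ->; rewrite ltxx ?andbF.
split; first by apply: (path_lower x _).1; rewrite tau0.
have ivt r : Num.min (cmod (path x tau)) (cmod (path x pi)) <= r <=
    Num.max (cmod (path x tau)) (cmod (path x pi)) ->
    exists2 c, c \in `[tau, pi] & cmod (path x c) = r.
  exact: (IVT taupi (continuous_cmod_path (x := x) tau0 taupi)).
apply/andP; split; rewrite leNgt; apply/negP => h.
  apply: (no_cross r0); [by rewrite lexx ltW|by left|].
  by apply: ivt; rewrite ge_min le_max (ltW h) (ltW s0) !orbT.
apply: (no_cross r1); [by rewrite lexx ltW|by right|].
by apply: ivt; rewrite ge_min le_max (ltW h) (ltW s1) !orbT.
Qed.

(** The relation eta exp (t v(eta)) = w, solved for the first factor. *)
Lemma path_expC x tau : 0 < tau <= pi ->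
  path x tau = expC (- ((- x +i* tau) + t%:C * ve (path x tau))).
Proof.
move=> taupi; have [_ /ve_ext veE] := path_lower x taupi.
have := functional_equation v_mu nu_t x taupi => /=.
rewrite -/(path x tau) -veE => h.
rewrite opprD expCD [- (_ +i* _)](_ : _ = x +i* (- tau)); last first.
  by apply: complexP; rewrite /= ?opprK.
rewrite -h -mulrA -expCD subrr expC0 mulr1//.
Qed.

End trap.

Hypothesis I_open : open I.
Hypothesis I1 : I 1.
Hypothesis ve_cont :
  {within @Omega R `|` [set x%:C | x in I], continuous ve}.
Variables beta gamma : R.
Hypothesis ve1 : ve 1 = (- beta) +i* gamma.
Hypothesis gamma_gt0 : 0 < gamma.

(** For w = exp (- t X - i b) the functional equation reads
    eta = exp (- t Z) with Z = X + i b / t + v (eta). Hence eta tends to 1 with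
    t, Z tends to X + v(1) = (X - beta) + i gamma, and
    t M(w) = t / (1 - eta) tends to 1 / Z. *)
Lemma small_time_estimate (N e : R) : 0 < N -> 0 < e ->
  exists2 t0 : R, 0 < t0 & forall t nu, 0 < t < t0 ->
    is_free_mult_power mu t nu ->
    exists2 b0 : R, 0 < b0 & forall b X, 0 < b < b0 -> `|X| <= N ->
      `|- (t / pi) * complex.Im (moment_transform nu
            (expC ((- (t * X)) +i* (- b)))) - cauchy_pdf beta gamma X| <= e.
Proof.
move=> N0 e0.
have [r0 [r1 [C [/andP[r00 r01] r11 C0 SC]]]] := lower_annulus_bound I_open I1 ve_cont.
pose A := N + 1 + C; have A0 : 0 < A by rewrite /A; lra.
pose e1 := Num.min (gamma / 6) (e * gamma ^+ 2 / 6).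
have e10 : 0 < e1 by rewrite lt_min !divr_gt0// mulr_gt0// exprn_gt0.
have e1g : 6 * e1 <= gamma.
  have : e1 <= gamma / 6 by rewrite ge_min lexx.
  by lra.
have e1e : 6 * e1 <= e * gamma ^+ 2.
  have : e1 <= e * gamma ^+ 2 / 6 by rewrite ge_min lexx orbT.
  by lra.
clearbody e1.
have A1 : (@Omega R `|` [set x%:C | x in I]) 1 by right; exists 1.
have [d d0 vd] := extension_cmod_continuous ve_cont A1 e10.
(* eta = exp u with |u| <= t A, so that |eta - 1| <= 13 t A. *)
pose m := Num.min (Num.min 1 (d / 13)) (Num.min (ln r1) (- ln r0)).
have m0 : 0 < m.
  rewrite !lt_min ltr01 divr_gt0//= ln_gt0//= oppr_gt0 ln_lt0//.
  by rewrite r00.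
pose t0 := Num.min (m / A) (e1 / (12 * A ^+ 2)).
exists t0; first by rewrite lt_min !divr_gt0// mulr_gt0// exprn_gt0.
move=> t nu /andP[t_gt0 tt0] nu_t.
have tA : t * A < m.
  by rewrite -ltr_pdivlMr// (lt_le_trans tt0)// ge_min lexx.
have tA1 : t * A <= 1 by rewrite (le_trans (ltW tA))// !ge_min lexx.
have tAd : t * A < d / 13 by rewrite (lt_le_trans tA)// !ge_min lexx orbT.
have tAr1 : t * A < ln r1 by rewrite (lt_le_trans tA)// !ge_min lexx !orbT.
have tAr0 : t * A < - ln r0 by rewrite (lt_le_trans tA)// !ge_min lexx !orbT.
have tA2 : 12 * (t * A ^+ 2) <= e1.
  rewrite mulrCA -ler_pdivlMr ?mulr_gt0 ?exprn_gt0//.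
  by rewrite (le_trans (ltW tt0))// ge_min lexx orbT.
have tNC : t * (N + C) < t * A by rewrite ltr_pM2l// /A; lra.
exists (Num.min (t * Num.min 1 e1) pi).
  by rewrite lt_min pi_gt0 andbT mulr_gt0// lt_min ltr01.
move=> b X /andP[b0]; rewrite lt_min => /andP[bt bpi] XN.
have bt1 : b / t <= Num.min 1 e1 by rewrite ler_pdivrMr// mulrC ltW.
have bt11 : b / t <= 1 by rewrite (le_trans bt1)// ge_min lexx.
have bte : b / t <= e1 by rewrite (le_trans bt1)// ge_min lexx orbT.
have bt0 : 0 < b / t by rewrite divr_gt0.
have bP : 0 < b <= pi by rewrite b0 ltW.
have xN : `|- (t * X)| <= t * N by rewrite normrN normrM gtr0_norm// ler_pM2l.
have veC z : lower_annulus r0 r1 z -> cmod (ve z) <= C by move=> /SC[].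
have r1l : expR (t * (N + C)) < r1.
  rewrite -[ltRHS]lnK ?posrE ?(lt_trans ltr01)// ltr_expR.
  exact: lt_trans tAr1.
have r0l : r0 < expR (- (t * (N + C))).
  rewrite -[ltLHS]lnK ?posrE// ltr_expR ltrNr.
  exact: lt_trans tAr0.
have r0r1 : 0 < r0 < r1 by rewrite r00 (lt_trans r01).
have Sh := annulus_trap t_gt0 nu_t r0r1 veC r1l r0l xN bP.
have hE := path_expC nu_t (- (t * X)) bP.
have [_ Oh] := path_lower nu_t (- (t * X)) bP.
set h := eta_arc nu (- (t * X)) b in Sh hE Oh.
have hC : cmod (ve h) <= C by exact: veC.
pose Z := X%:C + (0 +i* (b / t)) + ve h.
have ZA : cmod Z <= A.
  have := cmodD (X%:C + (0 +i* (b / t))) (ve h).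
  have := cmodD X%:C (0 +i* (b / t)).
  have : cmod (0 +i* (b / t)) <= b / t.
    by rewrite (le_trans (cmod_le_ReIm _))//= normr0 add0r gtr0_norm.
  by rewrite -/Z cmod_real /A; lra.
have tC0 : t%:C != 0 by rewrite -cmod_gt0 cmod_real normr_gt0 gt_eqF.
pose u := - (t%:C * Z).
have hu : h = expC u.
  rewrite {1}hE; congr (expC (- _)); rewrite /Z !mulrDr; congr (_ + _).
  apply: complexP; rewrite ?(ReD, ImD, ReM, ImM)/=; first by ring.
  by field; rewrite gt_eqF.
have uA : cmod u <= t * A by rewrite cmodN cmodM cmod_real gtr0_norm// ler_pM2l.
have u1 : cmod u <= 1 by exact: le_trans tA1.
have rem := expC_taylor1 u1; rewrite -hu in rem.
have uu : cmod u ^+ 2 <= cmod u by rewrite expr2 ler_piMl ?cmod_ge0.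
have h1 : cmod (h - 1) < d.
  have -> : h - 1 = (h - (1 + u)) + u by ring.
  by have := cmodD (h - (1 + u)) u; lra.
have vh1 := vd h (or_introl Oh) h1.
pose Z0 := X%:C + ve 1.
pose D := (1 - h) / t%:C.
have DZ : cmod (D - Z) <= e1.
  have -> : D - Z = - (h - (1 + u)) / t%:C by rewrite /D /u; field.
  rewrite cmodM cmodN cmodV cmod_real gtr0_norm// ler_pdivrMr//.
  rewrite (le_trans rem)// (@le_trans _ _ (12 * (t * A) ^+ 2))//.
    by rewrite ler_pM2l// lerXn2r ?nnegrE ?cmod_ge0// mulr_ge0// ltW.
  by rewrite [leLHS](_ : _ = 12 * (t * A ^+ 2) * t); [rewrite ler_pM2r|ring].
have DZ0 : cmod (D - Z0) <= 3 * e1.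
  have -> : D - Z0 = (D - Z) + ((0 +i* (b / t)) + (ve h - ve 1)).
    by rewrite /Z /Z0; ring.
  have := cmodD (D - Z) ((0 +i* (b / t)) + (ve h - ve 1)).
  have := cmodD (0 +i* (b / t)) (ve h - ve 1).
  have : cmod (0 +i* (b / t)) <= b / t.
    by rewrite (le_trans (cmod_le_ReIm _))//= normr0 add0r gtr0_norm.
  lra.
have ImZ0 : complex.Im Z0 = gamma by rewrite /Z0 ve1 /= add0r.
have ReZ0 : complex.Re Z0 = X - beta by rewrite /Z0 ve1.
have Z0g : gamma <= cmod Z0.
  by rewrite (le_trans _ (Im_le_cmod _))// ImZ0 ler_norm.
have Dg : gamma / 2 <= cmod D.
  by have := cmod_lerB Z0 (Z0 - D); rewrite subKr cmod_distC; lra.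
have D0 : D != 0 by rewrite -cmod_gt0; lra.
have Z00 : Z0 != 0 by rewrite -cmod_gt0; lra.
have inv_close : cmod (D^-1 - Z0^-1) <= e.
  have -> : D^-1 - Z0^-1 = - (D - Z0) / (D * Z0) by field; rewrite D0 Z00.
  have DZ_gt0 : 0 < cmod D * cmod Z0 by rewrite mulr_gt0 ?cmod_gt0.
  rewrite cmodM cmodN cmodV cmodM ler_pdivrMr// (le_trans DZ0)//.
  have : gamma / 2 * gamma <= cmod D * cmod Z0 by rewrite ler_pM// ltW// divr_gt0.
  rewrite -(ler_pM2l e0); apply: le_trans.
  by move: e1e; rewrite expr2; lra.
have tM : t%:C * moment_transform nu (expC (- (t * X) +i* - b)) = D^-1.
  by rewrite /D /h /eta_arc /complex_eta subKr invf_div invrK.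
have -> : complex.Im (moment_transform nu (expC (- (t * X) +i* - b))) =
    complex.Im (D^-1) / t.
  rewrite -tM ImM; case: (moment_transform _ _) => p q /=.
  by field; rewrite gt_eqF.
have cauchyE : cauchy_pdf beta gamma X = - complex.Im (Z0^-1) / pi.
  rewrite ImV sqr_cmod ReZ0 ImZ0 opprK /cauchy_pdf.
  by rewrite mulrAC.
have pi1 : 1 <= pi :> R by rewrite (le_trans _ (pi_ge2 _))// ler1n.
rewrite cauchyE [X in `|X|](_ : _ = - complex.Im (D^-1 - Z0^-1) / pi); last first.
  have t_neq0 : t != 0 by rewrite gt_eqF.
  rewrite ImD ImN; move: (complex.Im D^-1) (complex.Im Z0^-1) => p q.
  rewrite mulNr [t / pi * _]mulrC mulrA divfK// !mulNr opprK mulrBl opprB.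
  exact: addrC.
rewrite normrM normrN normfV (gtr0_norm (pi_gt0 _)) ler_pdivrMr ?pi_gt0//.
by rewrite (le_trans (Im_le_cmod _))// (le_trans inv_close)// ler_peMr// ltW.
Qed.

End small_time_estimate.

(** * Poisson-type kernels *)

Section integral_bounds.
Context {R : realType} d {T : measurableType d} (P : probability T R) (D : set T).
Hypothesis mD : measurable D.
Implicit Types u : T -> R.

Let integral_scaled_indic (J : set T) (c : R) : measurable J -> J `<=` D ->
  \int[P]_(y in D) (c * \1_J y) = c * fine (P J) /\
  bounded_measurable D (fun y => c * \1_J y).
Proof.
move=> mJ JD; have bJ : bounded_measurable D (\1_J : T -> R).
  split; first exact: measurable_funTS.
  by exists 1 => y _; rewrite indicE; case: (_ \in _); rewrite ?normr1 ?normr0.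
split; last exact: bounded_measurableZ.
rewrite RintegralZl//; last exact: bounded_measurable_integrable.
by rewrite /Rintegral integral_indic// setIidl.
Qed.

Lemma Rintegral_ge_measure u (J : set T) (c : R) : bounded_measurable D u ->
  measurable J -> J `<=` D -> (forall y, D y -> 0 <= u y) ->
  (forall y, J y -> c <= u y) -> c * fine (P J) <= \int[P]_(y in D) u y.
Proof.
move=> bu mJ JD u0 uc; have [<- bJ] := integral_scaled_indic c mJ JD.
apply: le_Rintegral => //; do ?exact: bounded_measurable_integrable.
move=> y Dy; rewrite indicE; case: (boolP (y \in J)) => [/set_mem Jy|_].
  by rewrite mulr1 uc.
by rewrite mulr0 u0.
Qed.

Lemma Rintegral_le_measure u (J : set T) (c : R) : bounded_measurable D u ->
  0 <= c -> measurable J -> J `<=` D -> (forall y, D y -> u y <= 1) ->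
  (forall y, D y -> ~ J y -> u y <= c) ->
  \int[P]_(y in D) u y <= fine (P J) + c.
Proof.
move=> bu c0 mJ JD u1 uc; have [JE bJ] := integral_scaled_indic 1 mJ JD.
have bc := bounded_measurable_cst D c.
apply: (@le_trans _ _ (\int[P]_(y in D) (1 * \1_J y + c))).
  apply: le_Rintegral => //;
    do ?[exact: bounded_measurable_integrable
        |apply: bounded_measurable_integrable => //; exact: bounded_measurableD].
  move=> y Dy; rewrite indicE; case: (boolP (y \in J)) => [_|/negP yJ].
    by rewrite mulr1 (le_trans (u1 _ Dy))// lerDl.
  by rewrite mulr0 add0r uc// => Jy; apply: yJ; exact: mem_set.
rewrite RintegralD//; do ?exact: bounded_measurable_integrable.
rewrite JE mul1r lerD2l Rintegral_cst// ler_piMr//.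
have PD : (P D <= 1)%E by exact: probability_le1.
by rewrite -[leRHS]/(fine 1%E) fine_le// fin_num_measure.
Qed.

End integral_bounds.

Section poisson_kernel.
Context {R : realType}.
Implicit Types (b t X y q : R).

(** A smoothed step function of y, which jumps from pi / 2 to - pi / 2 at
    y = exp (t X) when b tends to 0. *)
Definition poisson_primitive t b X y : R :=
  atan ((expR (t * X) / y - cos b) / sin b).

Definition poisson_kernel t b X y : R :=
  let q := expR (t * X) / y in
  t * (q * sin b / (sin b ^+ 2 + (q - cos b) ^+ 2)).

Lemma is_derive_poisson_primitive t b X y : 0 < y -> 0 < b < pi ->
  is_derive X 1 (fun X => poisson_primitive t b X y) (poisson_kernel t b X y).
Proof.
move=> y0 /sin_gt0_pi s0.
rewrite /poisson_primitive /poisson_kernel.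
pose g X := (expR (t * X) / y - cos b) / sin b.
have dg : is_derive X 1 g (t * (expR (t * X) / y) / sin b).
  rewrite /g; apply: is_derive_eq; rewrite /GRing.scale/=.
  by field; rewrite gt_eqF//= gt_eqF.
have da := is_derive1_atan (g X).
apply: (is_derive_eq (is_derive1_comp da dg)).
rewrite /GRing.scale/= /g; move: (expR (t * X) / y) => q.
field; rewrite (gt_eqF s0)/= gt_eqF//.
by rewrite ltr_pwDl ?sqr_ge0// exprn_gt0.
Qed.

Lemma poisson_kernel_bound t b X y : 0 < t -> 0 < y -> 0 < b < pi ->
  `|poisson_kernel t b X y| <= t * (sin b / (2 * (1 - cos b))).
Proof.
move=> t0 y0 bpi; have s0 := sin_gt0_pi bpi; rewrite /poisson_kernel/=.
have q0 : 0 < expR (t * X) / y by rewrite divr_gt0// expR_gt0.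
move: (expR (t * X) / y) q0 => q q0.
have c1 : cos b < 1.
  have := cos2Dsin2 b; have : 0 < sin b ^+ 2 by rewrite exprn_gt0.
  have := cos_le1 b; nra.
have den0 : 0 < sin b ^+ 2 + (q - cos b) ^+ 2.
  by rewrite ltr_pwDl ?sqr_ge0// exprn_gt0.
rewrite ger0_norm; last by rewrite !mulr_ge0 ?invr_ge0// ltW.
rewrite ler_pM2l// ler_pdivrMr// mulrAC ler_pdivlMr; last by lra.
rewrite [leLHS](_ : _ = sin b * (q * (2 * (1 - cos b)))); last by ring.
rewrite ler_pM2l//.
have -> : sin b ^+ 2 = 1 - cos b ^+ 2 by have := cos2Dsin2 b; lra.
by have := sqr_ge0 (q - 1); lra.
Qed.

(** Along the ray of argument - b the imaginary part of the moment transform is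
    thus the derivative in X of an average of smoothed step functions. *)
Lemma Im_moment_kernel t b X y : 0 < y -> 0 < b < pi ->
  - t * complex.Im (moment_kernel (expC ((- (t * X)) +i* (- b))) y) =
  poisson_kernel t b X y.
Proof.
move=> y0 /sin_gt0_pi s0; rewrite /moment_kernel ImV sqr_cmod.
rewrite !(ReD, ImD, ReN, ImN, ReM, ImM)/= cosN sinN expRN /poisson_kernel.
have e0 := expR_gt0 (t * X); move: (expR (t * X)) e0 => p p0.
have d1 : 0 < sin b ^+ 2 + (p / y - cos b) ^+ 2.
  by rewrite ltr_pwDl ?sqr_ge0// exprn_gt0.
have -> : 1 - (((p^-1 * cos b - 0 * - sin b) * y - (p^-1 * - sin b + 0 * cos b) * 0)) =
    (p / y - cos b) / (p / y) by field; rewrite (gt_eqF p0) (gt_eqF y0).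
have -> : 0 - ((p^-1 * cos b - 0 * - sin b) * 0 + (p^-1 * - sin b + 0 * cos b) * y)
    = sin b / (p / y) by field; rewrite (gt_eqF p0) (gt_eqF y0).
have q0 : 0 < p / y by rewrite divr_gt0.
move: (p / y) q0 d1 => q q0 d1.
have -> : ((q - cos b) / q) ^+ 2 + (sin b / q) ^+ 2 =
   (sin b ^+ 2 + (q - cos b) ^+ 2) / q ^+ 2 by field; rewrite gt_eqF.
by move: (sin b ^+ 2 + _) d1 => D D0; field; rewrite (gt_eqF D0) (gt_eqF q0).
Qed.

End poisson_kernel.

(** * Stieltjes inversion in logarithmic coordinates *)

Section stieltjes_inversion.
Context {R : realType} (nu : borel_prob R) (t : R).
Hypothesis nu_pos : nu `]0, +oo[%classic = 1%E.
Hypothesis t0 : 0 < t.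
Implicit Types (b X y : R).

Local Notation D := (`]0, +oo[%classic : set (measurableTypeR R)).

Let mD : measurable D. Proof. exact: measurable_itv. Qed.

Let Dgt0 y : D y -> 0 < y.
Proof. by rewrite /= in_itv/= andbT. Qed.

Lemma atan_bounds (x : R) : - (pi / 2) <= atan x <= pi / 2.
Proof. by rewrite !ltW ?atan_ltpi2 ?atan_gtNpi2. Qed.

Lemma bounded_measurable_poisson_primitive b X :
  bounded_measurable D (fun y => poisson_primitive t b X y).
Proof.
split; last first.
  by exists (pi / 2) => y _; rewrite ler_norml atan_bounds.
apply: (@measurableT_comp _ _ _ _ _ _ (@atan R)).
  by apply: continuous_measurable_fun => x; exact: continuous_atan.
apply: measurable_funM; last exact: measurable_cst.
apply: measurable_funB; last exact: measurable_cst.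
apply: measurable_funM; first exact: measurable_cst.
by apply: measurable_funV => //; exact: measurable_id.
Qed.

Definition smoothed_cdf b X : R := \int[nu]_(y in D) poisson_primitive t b X y.

(** Differentiation under the integral: for fixed b the kernel is bounded
    uniformly in X and y. *)
Lemma is_derive_smoothed_cdf b X : 0 < b < pi ->
  is_derive X 1 (smoothed_cdf b)
    (- t * complex.Im (moment_transform nu (expC ((- (t * X)) +i* (- b))))).
Proof.
move=> bpi.
have XI : `](X - 1), (X + 1)[%classic X.
  by rewrite /= in_itv/=; apply/andP; split; lra.
have fi x : `](X - 1), (X + 1)[%classic x ->
    nu.-integrable D (EFin \o (fun y => poisson_primitive t b x y)).
  move=> _; apply: bounded_measurable_integrable => //.
  exact: bounded_measurable_poisson_primitive.
have fd (x y : R) : D y -> is_derive x 1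
    (fun x => poisson_primitive t b x y) (poisson_kernel t b x y).
  by move=> /Dgt0 y0; exact: is_derive_poisson_primitive.
pose G : measurableTypeR R -> R := cst (t * (sin b / (2 * (1 - cos b)))).
have G0 y : 0 <= G y.
  by rewrite (le_trans _ (poisson_kernel_bound 0 t0 ltr01 bpi)).
have Gi : nu.-integrable D (EFin \o G).
  apply: bounded_measurable_integrable => //; exact: bounded_measurable_cst.
have dE (x y : R) : D y ->
    partial1of2 (fun x (y : measurableTypeR R) => poisson_primitive t b x y) x y =
    poisson_kernel t b x y.
  by move=> /fd h; rewrite partial1of2E; apply: derive_val.
have Gub (x y : R) : `](X - 1), (X + 1)[%classic x -> D y ->
    `|partial1of2 (fun x (y : measurableTypeR R) => poisson_primitive t b x y) x y|
      <= G y.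
  by move=> _ Dy; rewrite dE// poisson_kernel_bound// Dgt0.
have dd (x y : R) : `](X - 1), (X + 1)[%classic x -> D y ->
    derivable (fun x => poisson_primitive t b x y) x 1.
  by move=> _ /fd h; exact: ex_derive.
have h1 := derivable_under_integral mD XI fi dd G0 Gi Gub.
have h2 := differentiation_under_integral mD XI fi dd G0 Gi Gub.
apply: DeriveDef; first exact: h1.
rewrite -derive1E [LHS]h2 /moment_transform.
have slit : slit_plane (expC ((- (t * X)) +i* (- b))).
  exact/slit_plane_Im/expC_polar_neg.
rewrite Im_cintegral -RintegralZl//; last first.
  apply: bounded_measurable_integrable => //.
  exact/cbounded_Im/cbounded_moment_kernel.
by apply: eq_Rintegral => y /set_mem Dy; rewrite dE// Im_moment_kernel// Dgt0.
Qed.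

Lemma smoothed_cdf_increment (F f : R -> R) (N e b : R) : 0 < b < pi ->
  (forall X, is_derive X 1 F (f X)) ->
  (forall X, `|X| <= N -> `|- (t / pi) * complex.Im (moment_transform nu
            (expC ((- (t * X)) +i* (- b)))) - f X| <= e) ->
  forall X Y, - N <= X -> X <= Y -> Y <= N ->
  `|(smoothed_cdf b Y - smoothed_cdf b X) / pi - (F Y - F X)| <= e * (Y - X).
Proof.
move=> bpi dF Mf X Y NX XY YN.
pose g := (fun X : R => smoothed_cdf b X * pi^-1 - F X).
have dg (Z : R) : is_derive Z 1 g (- (t / pi) * complex.Im (moment_transform nu
            (expC ((- (t * Z)) +i* (- b)))) - f Z).
  have dP := is_derive_smoothed_cdf Z bpi; have dFZ := dF Z.
  apply: is_derive_eq; rewrite /GRing.scale/=; ring.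
have cg : {within `[X, Y], continuous g}.
  apply: continuous_subspaceT => Z.
  by apply/differentiable_continuous/derivable1_diffP.
have [Z] := @MVT_segment _ g _ X Y XY (fun Z _ => dg Z) cg.
rewrite in_itv/= => /andP[XZ ZY] gE.
have -> : (smoothed_cdf b Y - smoothed_cdf b X) / pi - (F Y - F X) = g Y - g X.
  rewrite /g; move: (smoothed_cdf b Y) (smoothed_cdf b X) => p q; ring.
rewrite gE normrM [X in _ * X]ger0_norm ?subr_ge0// ler_wpM2r ?subr_ge0//.
by apply: Mf; rewrite ler_norml (le_trans NX XZ) (le_trans ZY YN).
Qed.

(** Since sin b <= 2 b and 1 - cos b <= 2 b, the argument of atan is at least A in
    absolute value as soon as |q - 1| >= k and b (2 A + 2) < k. *)
Lemma atan_kernel_limit (k e : R) : 0 < k -> 0 < e ->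
  exists2 b0 : R, 0 < b0 & forall b q, 0 < b < b0 ->
    (1 + k <= q -> pi / 2 - e <= atan ((q - cos b) / sin b)) /\
    (q <= 1 - k -> atan ((q - cos b) / sin b) <= - (pi / 2) + e).
Proof.
move=> k0 e0.
have [A A0 AP] : exists2 A : R, 0 < A & forall x, A <= x -> pi / 2 - e <= atan x.
  have : pi / 2 - e < pi / 2 :> R by lra.
  move=> /(cvgr_ge _ (@cvgy_atan R)) [A [_ AP]].
  exists (Num.max 1 (A + 1)); first by rewrite lt_max ltr01.
  move=> x; rewrite ge_max => /andP[_ Ax]; apply: AP; lra.
pose b0 := Num.min 1 (k / (2 * A + 2)).
exists b0; first by rewrite lt_min ltr01 divr_gt0//; lra.
move=> b q /andP[b_gt0]; rewrite lt_min => /andP[b1 bk].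
have {}bk : b * (2 * A + 2) < k by rewrite -ltr_pdivlMr//; lra.
have bpi : 0 < b < pi.
  by rewrite b_gt0 (lt_le_trans b1)// (le_trans _ (pi_ge2 _))// ler1n.
have s0 := sin_gt0_pi bpi.
have nb : `|b| <= 1 by rewrite gtr0_norm// ltW.
have sb : sin b <= 2 * b.
  have := sin_taylor1 nb; rewrite mul1r (gtr0_norm b_gt0) ler_norml => /andP[_].
  have : b ^+ 3 <= b by rewrite exprS ler_piMr ?exprn_ile1// ltW.
  lra.
have cb : 1 - 2 * b <= cos b.
  have := cos_taylor2 nb; rewrite mul1r (gtr0_norm b_gt0) ler_norml => /andP[+ _].
  have : b ^+ 3 <= b by rewrite exprS ler_piMr ?exprn_ile1// ltW.
  have : b ^+ 2 <= b by rewrite expr2 ler_piMr// ltW.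
  lra.
have cb1 := cos_le1 b.
split => qk.
  apply: AP; rewrite ler_pdivlMr//.
  have : A * sin b <= A * (2 * b) by rewrite ler_pM2l.
  lra.
rewrite -lerN2 -atanN opprD opprK; apply: AP.
rewrite -mulNr ler_pdivlMr//.
have : A * sin b <= A * (2 * b) by rewrite ler_pM2l.
lra.
Qed.

Section interval_masses.
Variables (F f : R -> R) (N e b0 : R).
Hypothesis dF : forall X : R, is_derive X 1 F (f X).
Hypothesis e0 : 0 <= e.
Hypothesis b0_gt0 : 0 < b0.
Hypothesis Mf : forall b X, 0 < b < b0 -> `|X| <= N ->
  `|- (t / pi) * complex.Im (moment_transform nu
            (expC ((- (t * X)) +i* (- b)))) - f X| <= e.

Lemma smoothed_cdf_increment_integral b X Y : smoothed_cdf b Y - smoothed_cdf b X =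
  pi * \int[nu]_(y in D) (pi^-1 * (poisson_primitive t b Y y - poisson_primitive t b X y)).
Proof.
have bB := bounded_measurableB (bounded_measurable_poisson_primitive b Y)
  (bounded_measurable_poisson_primitive b X).
rewrite RintegralZl//; last exact: bounded_measurable_integrable.
rewrite RintegralB//; do ?[exact/bounded_measurable_integrable/bounded_measurable_poisson_primitive].
by rewrite mulVKf// gt_eqF// pi_gt0.
Qed.

Lemma poisson_difference_bounds b X Y y : 0 < b < pi -> X <= Y -> 0 < y ->
  0 <= pi^-1 * (poisson_primitive t b Y y - poisson_primitive t b X y) <= 1.
Proof.
move=> bpi XY y0; have p0 := pi_gt0 R.
have /andP[h1 h2] := atan_bounds ((expR (t * X) / y - cos b) / sin b).
have /andP[h3 h4] := atan_bounds ((expR (t * Y) / y - cos b) / sin b).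
apply/andP; split.
  rewrite mulr_ge0 ?invr_ge0 ?(ltW p0)// subr_ge0; apply: le_atan.
  rewrite ler_pM2r ?invr_gt0 ?sin_gt0_pi// lerD2r ler_pM2r ?invr_gt0//.
  by rewrite ler_expR ler_pM2l.
by rewrite mulrC ler_pdivrMr// mul1r /poisson_primitive; lra.
Qed.

Let small_b (k eps : R) : 0 < k -> 0 < eps -> exists b, [/\ 0 < b < pi, 0 < b < b0 &
  forall q,
    (1 + k <= q -> pi / 2 - eps <= atan ((q - cos b) / sin b)) /\
    (q <= 1 - k -> atan ((q - cos b) / sin b) <= - (pi / 2) + eps)].
Proof.
move=> k0 eps0; have [b1 b10 b1P] := atan_kernel_limit k0 eps0.
pose m := Num.min (Num.min b0 b1) pi.
have m0 : 0 < m by rewrite !lt_min b0_gt0 b10 pi_gt0.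
have mb0 : m <= b0 by rewrite !ge_min lexx.
have mb1 : m <= b1 by rewrite !ge_min lexx ?orbT.
have mpi : m <= pi by rewrite !ge_min lexx ?orbT.
by exists (m / 2); split; [apply/andP; split; lra|apply/andP; split; lra
  |move=> q; apply: b1P; apply/andP; split; lra].
Qed.

Let kdelta (delta : R) : 0 < delta -> exists2 k : R, 0 < k &
  (1 + k <= expR (t * delta)) /\ (expR (- (t * delta)) <= 1 - k).
Proof.
move=> d0; have td : 0 < t * delta by rewrite mulr_gt0.
have h1 : 1 < expR (t * delta) by rewrite expR_gt1.
have h2 : expR (- (t * delta)) < 1 by rewrite expR_lt1 oppr_lt0.
exists (Num.min (expR (t * delta) - 1) (1 - expR (- (t * delta)))).
  by rewrite lt_min !subr_gt0 h1.
set k := Num.min _ _.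
have k1 : k <= expR (t * delta) - 1 by rewrite ge_min lexx.
have k2 : k <= 1 - expR (- (t * delta)) by rewrite ge_min lexx orbT.
by split; lra.
Qed.

(** For b small, the difference of the smoothed steps at X and Y is close to 1 on
    the shrunk interval, so its integral nearly dominates the mass. *)
Lemma closed_interval_mass_shrunk X Y (delta : R) : - N <= X -> X <= Y -> Y <= N ->
  0 < delta ->
  fine (nu `[expR (t * (X + delta)), expR (t * (Y - delta))]%classic) <=
  F Y - F X + e * (Y - X).
Proof.
move=> NX XY YN d0; have p0 := pi_gt0 R.
set J := `[_, _]%classic.
have mJ : measurable (J : set (measurableTypeR R)) by exact: measurable_itv.
have JD : (J : set (measurableTypeR R)) `<=` D.
  move=> y; rewrite /J/= !in_itv/= andbT => /andP[+ _].
  by apply: lt_le_trans; exact: expR_gt0.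
have [k k0 [k1 k2]] := kdelta d0.
apply/ler_addgt0Pr => eps eps0.
have [b [bpi bb0 bP]] := small_b k0 eps0.
have := smoothed_cdf_increment bpi dF (fun X => Mf bb0) NX XY YN.
rewrite ler_norml => /andP[_]; rewrite smoothed_cdf_increment_integral.
rewrite [pi * _]mulrC mulfK ?gt_eqF// lerBlDr => h.
have := @Rintegral_ge_measure _ _ _ nu D mD
  (fun y => pi^-1 * (poisson_primitive t b Y y - poisson_primitive t b X y)) J
  (1 - 2 * eps / pi).
move=> /(_ _ mJ JD _ _)/le_trans/(_ h) => h2.
have nuJ1 : fine (nu J) <= 1.
  by rewrite -[leRHS]/(fine 1%E) fine_le ?fin_num_measure// probability_le1.
have nuJ0 : 0 <= fine (nu J) by rewrite fine_ge0.
have ep : 2 * eps / pi <= eps.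
  by rewrite ler_pdivrMr// mulrC ler_pM2l// pi_ge2.
have ep0 : 0 <= 2 * eps / pi by rewrite divr_ge0 ?ltW// mulr_gt0.
have {}h2 : (1 - 2 * eps / pi) * fine (nu J) <= e * (Y - X) + (F Y - F X).
  apply: h2.
  - apply: bounded_measurableZ; apply: bounded_measurableB;
      exact: bounded_measurable_poisson_primitive.
  - by move=> y /Dgt0 y0; have /andP[] := poisson_difference_bounds bpi XY y0.
  - move=> y Jy; have y0 := Dgt0 (JD _ Jy).
    move: Jy; rewrite /J/= in_itv/= => /andP[y1 y2].
    have [hY _] := bP (expR (t * Y) / y).
    have [_ hX] := bP (expR (t * X) / y).
    have qY : 1 + k <= expR (t * Y) / y.
      rewrite (le_trans k1)// ler_pdivlMr// -ler_pdivlMl ?expR_gt0//.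
      by rewrite -expRN -expRD (le_trans y2)// ler_expR; lra.
    have qX : expR (t * X) / y <= 1 - k.
      rewrite (le_trans _ k2)// ler_pdivrMr// -ler_pdivrMl ?expR_gt0//.
      by rewrite -expRN -expRD (le_trans _ y1)// ler_expR; lra.
    move: (hY qY) (hX qX) => {}hY {}hX.
    rewrite [leRHS]mulrC ler_pdivlMr// mulrBl mul1r divfK ?gt_eqF//.
    by rewrite /poisson_primitive; lra.
have := ler_wpM2l ep0 nuJ1; lra.
Qed.

(** For b small, the difference of the smoothed steps at X and Y is close to 0
    outside of the enlarged interval. *)
Lemma open_interval_mass_enlarged X Y (delta : R) : - N <= X -> X <= Y -> Y <= N ->
  0 < delta ->
  F Y - F X - e * (Y - X) <=
  fine (nu `]expR (t * (X - delta)), expR (t * (Y + delta))[%classic).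
Proof.
move=> NX XY YN d0; have p0 := pi_gt0 R.
set J := `]_, _[%classic.
have mJ : measurable (J : set (measurableTypeR R)) by exact: measurable_itv.
have JD : (J : set (measurableTypeR R)) `<=` D.
  move=> y; rewrite /J/= !in_itv/= andbT => /andP[+ _].
  by apply: lt_trans; exact: expR_gt0.
have [k k0 [k1 k2]] := kdelta d0.
apply/ler_addgt0Pr => eps eps0.
have [b [bpi bb0 bP]] := small_b k0 eps0.
have := smoothed_cdf_increment bpi dF (fun X => Mf bb0) NX XY YN.
rewrite ler_norml => /andP[+ _]; rewrite smoothed_cdf_increment_integral.
rewrite [pi * _]mulrC mulfK ?gt_eqF// => h.
have ep : eps / pi <= eps.
  by rewrite ler_pdivrMr// ler_pMr// (le_trans _ (pi_ge2 _))// ler1n.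
have ep0 : 0 <= eps / pi by rewrite divr_ge0 ?ltW.
have h2 : \int[nu]_(y in D)
    (pi^-1 * (poisson_primitive t b Y y - poisson_primitive t b X y)) <=
    fine (nu J) + eps / pi.
  apply: Rintegral_le_measure => //.
  - apply: bounded_measurableZ; apply: bounded_measurableB;
      exact: bounded_measurable_poisson_primitive.
  - by move=> y /Dgt0 y0; have /andP[] := poisson_difference_bounds bpi XY y0.
  - move=> y Dy; have y0 := Dgt0 Dy; rewrite /J/= in_itv/= => yJ.
    rewrite mulrC ler_pM2r ?invr_gt0// /poisson_primitive.
    have [hX _] := bP (expR (t * X) / y).
    have [_ hY] := bP (expR (t * Y) / y).
    have /andP[h1 _] := atan_bounds ((expR (t * X) / y - cos b) / sin b).
    have /andP[_ h4] := atan_bounds ((expR (t * Y) / y - cos b) / sin b).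
    have [yX|yX] := leP y (expR (t * (X - delta))).
      have := hX _; rewrite (le_trans k1); last first.
        rewrite ler_pdivlMr// -ler_pdivlMl ?expR_gt0//.
        by rewrite -expRN -expRD (le_trans yX)// ler_expR; lra.
      by move=> /(_ isT); lra.
    have yY : expR (t * (Y + delta)) <= y.
      by rewrite leNgt; apply/negP => yY; apply: yJ; rewrite yX.
    have := hY _; rewrite (le_trans _ k2); last first.
      rewrite ler_pdivrMr// -ler_pdivrMl ?expR_gt0//.
      by rewrite -expRN -expRD (le_trans _ yY)// ler_expR; lra.
    by move=> /(_ isT); lra.
lra.
Qed.

Let F_continuous (X eps : R) : 0 < eps -> exists2 d : R, 0 < d &
  forall Y : R, `|X - Y| < d -> `|F X - F Y| < eps.
Proof.
move=> eps0; have /cvgrPdist_lt/(_ _ eps0) : {for X, continuous F}.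
  have dFX := dF X.
  by apply/differentiable_continuous/derivable1_diffP; exact: ex_derive.
by move=> /nbhs_ballP[d /= d0 dP]; exists d => // Y XY; exact: dP.
Qed.

(** Continuity of F lets the shrinking and the enlargement tend to 0. *)
Lemma interval_masses X Y : - N < X -> X <= Y -> Y < N ->
  fine (nu `[expR (t * X), expR (t * Y)]%classic) <= F Y - F X + e * (Y - X) /\
  F Y - F X - e * (Y - X) <= fine (nu `]expR (t * X), expR (t * Y)[%classic).
Proof.
move=> NX XY YN.
have small (eps : R) : 0 < eps -> exists2 d : R, 0 < d &
    [/\ d <= X + N, d <= N - Y, e * d <= eps, X < Y -> 2 * d <= Y - X &
     forall Z, `|Z| <= d -> `|F (X + Z) - F X| < eps /\ `|F (Y + Z) - F Y| < eps].
  move=> eps0; have [d1 d10 dX] := F_continuous X eps0.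
  have [d2 d20 dY] := F_continuous Y eps0.
  pose m := Num.min (Num.min d1 d2 / 2) (Num.min (eps / (e + 1))
    (Num.min (X + N) (N - Y))).
  have e1 : 0 < e + 1 by rewrite ltr_wpDl.
  have XN0 : 0 < X + N by move: NX; lra.
  have NY0 : 0 < N - Y by rewrite subr_gt0.
  have m0 : 0 < m.
    have d120 : 0 < Num.min d1 d2 / 2 by rewrite divr_gt0// lt_min d10.
    have ee0 : 0 < eps / (e + 1) by rewrite divr_gt0.
    by rewrite !lt_min d120 ee0 XN0 NY0.
  have md : m <= Num.min d1 d2 / 2 by rewrite ge_min lexx.
  have d12 : Num.min d1 d2 <= d1 by rewrite ge_min lexx.
  have d21 : Num.min d1 d2 <= d2 by rewrite ge_min lexx orbT.
  have me : m <= eps / (e + 1) by rewrite !ge_min lexx !orbT.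
  have mX : m <= X + N by rewrite !ge_min lexx !orbT.
  have mY : m <= N - Y by rewrite !ge_min lexx !orbT.
  pose d := if X < Y then Num.min m ((Y - X) / 2) else m.
  have dm : d <= m by rewrite /d; case: ifP => // _; rewrite ge_min lexx.
  have d0 : 0 < d.
    by rewrite /d; case: ifP => // XY'; rewrite lt_min m0 divr_gt0// subr_gt0.
  exists d => //; split; [lra|lra| | |].
  - rewrite (@le_trans _ _ (e * m))//; first by rewrite ler_wpM2l.
    move: me; rewrite ler_pdivlMr//; nra.
  - move=> XY'; rewrite /d XY'.
    have : Num.min m ((Y - X) / 2) <= (Y - X) / 2 by rewrite ge_min lexx orbT.
    lra.
  - move=> Z Zd; split; rewrite distrC.
      by apply: dX; rewrite opprD addNKr normrN; lra.
    by apply: dY; rewrite opprD addNKr normrN; lra.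
split; apply/ler_addgt0Pr => eps eps0.
  have [|d d0 [dX dY ed _ dF']] := small (eps / 4); first by lra.
  have := @closed_interval_mass_shrunk (X - d) (Y + d) d.
  rewrite subrK addrK => /(_ _ _ _ d0) h.
  have := dF' (- d); rewrite normrN gtr0_norm// lexx => /(_ isT)[+ _].
  have := dF' d; rewrite gtr0_norm// lexx => /(_ isT)[_].
  rewrite !ltr_norml => /andP[_ h1] /andP[h2 _].
  apply: le_trans (h _ _ _) _; lra.
have [XY'|XY'] := ltP X Y; last first.
  have -> : Y = X by apply/eqP; rewrite eq_le XY' XY.
  by rewrite !subrr mulr0 subr0 addr_ge0 ?fine_ge0// ltW.
have [|d d0 [dX dY ed /(_ XY') dXY dF']] := small (eps / 4); first by lra.
have := @open_interval_mass_enlarged (X + d) (Y - d) d.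
rewrite subrK addrK => /(_ _ _ _ d0) h.
have := dF' (- d); rewrite normrN gtr0_norm// lexx => /(_ isT)[_].
have := dF' d; rewrite gtr0_norm// lexx => /(_ isT)[+ _].
rewrite !ltr_norml => /andP[_ h1] /andP[h2 _].
have l1 : - N <= X + d by lra.
have l2 : X + d <= Y - d by lra.
have l3 : Y - d <= N by lra.
have ed0 : 0 <= e * d by rewrite mulr_ge0// ltW.
have := h l1 l2 l3; lra.
Qed.

End interval_masses.
End stieltjes_inversion.

(** * Densities from increments *)

Section density.
Context {R : realType} (m : borel_prob R) (a b C : R).
Hypothesis m_lipschitz : forall x y, a <= x -> x <= y -> y <= b ->
  fine (m `]x, y]%classic) <= C * (y - x).

Local Notation lambda := (@lebesgue_measure R).
Local Notation J := (`]a, b]%classic : set (measurableTypeR R)).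

Let mJ : measurable J. Proof. exact: measurable_itv. Qed.

Let mfin (A : set (measurableTypeR R)) : measurable A -> m A = (fine (m A))%:E.
Proof. by move=> mA; rewrite fineK// fin_num_measure. Qed.

Let C_ge0 : a < b -> 0 <= C.
Proof.
move=> ab; have := m_lipschitz (lexx a) (ltW ab) (lexx b).
have : 0 <= fine (m `]a, b]%classic) by rewrite fine_ge0.
by move=> h1 /(le_trans h1); rewrite pmulr_lge0// subr_gt0.
Qed.

Lemma restricted_mass_bound (x y : R) : x <= y -> a < b ->
  (mrestr m mJ `]x, y]%classic <= (C * (y - x))%:E)%E.
Proof.
move=> xy ab; have C0 := C_ge0 ab.
rewrite /mrestr; have mI : measurable (`]x, y]%classic `&` J : set (measurableTypeR R)).
  by apply: measurableI => //; exact: measurable_itv.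
have [mM|Mm] := leP (Num.max x a) (Num.min y b); last first.
  rewrite (_ : _ `&` _ = set0) ?measure0 ?lee_fin ?mulr_ge0 ?subr_ge0//.
  apply/seteqP; split => // z [] /=; rewrite !in_itv/= => /andP[xz zy] /andP[az zb].
  have : Num.max x a < Num.min y b.
    by apply: (@lt_le_trans _ _ z); rewrite ?gt_max ?xz ?az// le_min zy zb.
  by rewrite ltNge (ltW Mm).
have -> : `]x, y]%classic `&` J = `]Num.max x a, Num.min y b]%classic.
  apply/seteqP; split => z /=; rewrite !in_itv/= gt_max le_min.
    by move=> [/andP[-> ->] /andP[-> ->]].
  by move=> /andP[/andP[-> ->] /andP[-> ->]].
rewrite mfin ?lee_fin; last exact: measurable_itv.
rewrite (le_trans (m_lipschitz _ mM _)) ?le_max ?lexx ?orbT ?ge_min ?lexx ?orbT//.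
by rewrite ler_wpM2l// lerB// ?ge_min ?lexx// le_max lexx.
Qed.

(** A null set is covered by open intervals of arbitrarily small total length,
    and the mass of each is at most C times its length. *)
Lemma restricted_null_dominated : a < b -> mrestr m mJ `<< lambda.
Proof.
move=> ab; have C0 := C_ge0 ab.
apply/null_content_dominatesP => A mA A0.
apply/eqP; rewrite eq_le measure_ge0 andbT; apply/lee_addgt0Pr => e e0.
rewrite add0e.
have C1 : 0 < C + 1 by rewrite ltr_wpDl.
have : lambda A \is a fin_num by rewrite A0.
have lE : lambda A = ereal_inf
   [set (\sum_(0 <= k <oo) wlength idfun (F k))%E | F in open_itv_cover A].
  exact: outer_measure_open_itv_cover.
have ed : 0 < e / (C + 1) by rewrite divr_gt0.
rewrite lE => /(lb_ereal_inf_adherent ed)[_ [F [Fitv AF] <-]].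
rewrite -lE A0 add0e => Fe.
have mF k : measurable (F k : set (measurableTypeR R)).
  by have [[x y] ->] := Fitv k; exact: measurable_itv.
apply: (le_trans (measure_sigma_subadditive (mrestr m mJ) mF mA AF)).
have Fk k : (mrestr m mJ (F k) <= C%:E * wlength idfun (F k))%E.
  have [[x y] /= ->] := Fitv k; rewrite wlength_itv/= lte_fin.
  have [xy|yx] := ltP x y; last first.
    rewrite /mrestr (_ : _ `&` _ = set0) ?measure0 ?mule0//.
    apply/seteqP; split => // z [] /=; rewrite in_itv/= => /andP[xz zy] _.
    by have := lt_trans xz zy; rewrite ltNge yx.
  rewrite -EFinB -EFinM; apply: le_trans (restricted_mass_bound (ltW xy) ab).
  apply: le_measure; rewrite ?inE; try exact: measurable_itv.
  exact: subset_itv_oo_oc.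
have l0 k : (0 <= wlength idfun (F k))%E by exact: wlength_ge0.
apply: le_trans (_ : (\sum_(0 <= k <oo) C%:E * wlength idfun (F k) <= _)%E).
  by apply: lee_nneseries => // k _; exact: Fk.
rewrite nneseriesZl//.
have S0 : (0 <= \sum_(0 <= k <oo) wlength idfun (F k))%E by exact: nneseries_ge0.
move: Fe S0; case: (\sum_(0 <= k <oo) _)%E => [s| |]//.
rewrite -EFinM lte_fin !lee_fin ltr_pdivlMr// => se s0.
by rewrite (le_trans _ (ltW se))// mulrC ler_wpM2l// lerDl.
Qed.

(** The density comes from the Radon-Nikodym theorem. By Lebesgue differentiation
    it is almost everywhere the derivative of the distribution function, hence
    within e of g when the increments of the latter are within e (y - x) of
    those of G; on the exceptional null set it is replaced by g. The same f
    serves for all e. *)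
Lemma density_of_increments (g G : R -> R) : a < b ->
  measurable_fun setT (g : measurableTypeR R -> R) ->
  (forall x, a < x < b -> 0 <= g x) ->
  (forall x : R, a < x < b -> is_derive x 1 G (g x)) ->
  exists f : R -> R, [/\ measurable_fun setT (f : measurableTypeR R -> R),
    forall x, a < x < b -> 0 <= f x,
    forall B : set R, measurable (B : set (measurableTypeR R)) ->
      B `<=` `]a, b[%classic -> m B = (\int[lambda]_(x in B) (f x)%:E)%E &
    forall e, (forall x y, a < x -> x <= y -> y < b ->
        `|fine (m `]x, y]%classic) - (G y - G x)| <= e * (y - x)) ->
      forall x, a < x < b -> `|f x - g x| <= e].
Proof.
move=> ab mg g0 dG.
have [f0 [f0_ge0 f0_fin f0_int f0E]] :=
  radon_nikodym_sigma_finite (restricted_null_dominated ab).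
pose f1 x := fine (f0 x).
have f1E x : (f1 x)%:E = f0 x by rewrite fineK.
have f1_int : lambda.-integrable setT (EFin \o f1).
  by apply: eq_integrable f0_int => // x _; rewrite /= f1E.
have mf1 : measurable_fun setT (f1 : measurableTypeR R -> R).
  by apply/measurable_EFinP; exact: measurable_int f1_int.
have f1_ge0 x : 0 <= f1 x by rewrite fine_ge0.
pose F y := \int[lambda]_(s in `]-oo, y]) f1 s.
have FE y : F y = fine (mrestr m mJ `]-oo, y]%classic).
  rewrite f0E; last exact: measurable_itv.
  by congr fine; apply: eq_integral => x _; rewrite f1E.
have Fincr x y : a < x -> x <= y -> y < b ->
    F y - F x = fine (m `]x, y]%classic).
  move=> ax xy yb; rewrite !FE /mrestr.
  have -> : `]-oo, y]%classic `&` J = `]a, y]%classic.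
    apply/seteqP; split => z /=; rewrite !in_itv/=; first by move=> [-> /andP[->]].
    by move=> /andP[-> zy]; rewrite zy (le_trans zy)// ltW.
  have -> : `]-oo, x]%classic `&` J = `]a, x]%classic.
    apply/seteqP; split => z /=; rewrite !in_itv/=; first by move=> [-> /andP[->]].
    by move=> /andP[-> zy]; rewrite zy (le_trans zy)// (le_trans xy)// ltW.
  have -> : `]a, y]%classic = `]a, x]%classic `|` `]x, y]%classic.
    apply/seteqP; split => z /=; rewrite !in_itv/=.
      by move=> /andP[-> ->]; case: (leP z x) => _; [left|right].
    move=> [/andP[-> zx]|/andP[xz ->]]; first exact: le_trans xy.
    by rewrite (lt_trans ax).
  rewrite measureU; [|exact: measurable_itv|exact: measurable_itv|].
    by rewrite fineD ?fin_num_measure//; ring.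
  apply/seteqP; split => // z [] /=; rewrite !in_itv/= => /andP[_ zx] /andP[xz _].
  by move: zx; rewrite leNgt xz.
have [N [mN N0 FN]] : {ae lambda, forall x : R, derivable F x 1 /\ F^`()%classic x = f1 x}.
  apply: FTC1Ny.
    by move=> y; apply: integrableS f1_int => //; exact: measurable_itv.
  exact: (open_integrable_locally openT).
have FN' (x : R) : ~ N x -> derivable F x 1 /\ F^`()%classic x = f1 x.
  by move=> Nx; apply: contrapT => h; apply/Nx/FN.
pose f (x : R) := \1_(~` N) x * f1 x + \1_N x * g x.
have fN x : x \in N -> f x = g x.
  by rewrite /f !indicE in_setC => -> /=; rewrite mul0r mul1r add0r.
have fNN x : x \notin N -> f x = f1 x.
  by rewrite /f !indicE in_setC; case: (x \in N) => //= _; rewrite mul0r mul1r addr0.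
have mf : measurable_fun setT (f : measurableTypeR R -> R).
  apply: measurable_funD; apply: measurable_funM => //.
  by apply: measurable_indic; exact: measurableC.
exists f; split => //.
- move=> x xab; have [/fN ->|/fNN ->//] := boolP (x \in N); exact: g0.
- move=> B mB BJ.
  have -> : m B = mrestr m mJ B.
    rewrite /mrestr (setIidl _)//; apply: subset_trans BJ _.
    exact: subset_itv_oo_oc.
  rewrite f0E//; apply: ae_eq_integral => //.
  + by apply: measurable_funTS; exact: measurable_int f0_int.
  + by apply/measurable_EFinP; exact: measurable_funTS.
  + exists N; split => // x /= h; apply: contrapT => Nx; apply: h => _.
    by rewrite /= fNN ?f1E//; apply/negP => /set_mem.
- move=> e He x /andP[ax xb]; have [/fN ->|xN] := boolP (x \in N).
    rewrite subrr normr0.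
    pose y := (x + b) / 2; have xy : x < y by rewrite /y; lra.
    have yb : y < b by rewrite /y; lra.
    have := He _ _ ax (ltW xy) yb; move=> /(le_trans (normr_ge0 _)).
    by rewrite pmulr_lge0// subr_gt0.
  rewrite (fNN _ xN); have Nx : ~ N x by move=> /mem_set; apply/negP.
  have [dF F'] := FN' _ Nx.
  have dGx := dG x; rewrite ax xb in dGx; have {}dGx := dGx isT.
  have dFx : is_derive x 1 F (f1 x).
    exact: (DeriveDef dF (etrans (esym (derive1E F x)) F')).
  have dH : is_derive x 1 (F - G) (f1 x - g x) by exact: is_deriveB.
  have dHx : derivable (F - G) x 1 by exact: ex_derive.
  have HE : 'D_1 (F - G) x = f1 x - g x by exact: derive_val.
  have Hc : `|h^-1 *: ((F - G) (h *: (1 : R) + x) - (F - G) x)| @[h --> 0^'] -->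
      `|f1 x - g x|.
    by rewrite -HE; apply: cvg_norm; exact: dHx.
  apply: (cvgr_to_le Hc); near=> h.
  have h0 : h != 0 by near: h; exact: nbhs_dnbhs_neq.
  have hd : `|h| < Num.min (x - a) (b - x).
    near: h; apply: dnbhs0_lt.
    by rewrite lt_min !subr_gt0 ax.
  move: hd; rewrite lt_min ltr_norml => /andP[/andP[h1 h2]].
  rewrite ltr_norml => /andP[h3 h4].
  have incr : `|(F (h + x) - G (h + x)) - (F x - G x)| <= e * `|h|.
    have [h_gt0|h_lt0|h_eq0] := ltgtP h 0; last by rewrite h_eq0 eqxx in h0.
      rewrite (ltr0_norm h_gt0) -normrN.
      rewrite [X in `|X|](_ : _ = (F x - F (h + x)) - (G x - G (h + x))); last by ring.
      rewrite Fincr; [|lra|lra|lra].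
      have -> : - h = x - (h + x) by ring.
      by apply: He; lra.
    rewrite (gtr0_norm h_lt0).
    rewrite [X in `|X|](_ : _ = (F (h + x) - F x) - (G (h + x) - G x)); last by ring.
    rewrite Fincr; [|lra|lra|lra].
    rewrite [X in e * X](_ : _ = h + x - x); last by ring.
    by apply: He; lra.
  rewrite [_%:A]mulr1 [_ *: _]/(h^-1 * (F (h + x) - G (h + x) - (F x - G x))).
  by rewrite normrM normfV mulrC ler_pdivrMr ?normr_gt0.
Unshelve. all: by end_near. Qed.

End density.

(** * Cauchy distribution functions and laws of powers *)

Section cauchy_cdf.
Context {R : realType} (beta gamma : R).
Hypothesis gamma_gt0 : 0 < gamma.
Implicit Types x y X Y : R.

Definition cauchy_cdf X : R := 2^-1 + atan ((X - beta) / gamma) / pi.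

Definition log_cauchy_cdf x : R := cauchy_cdf (ln x).

Let cauchy_denominator_gt0 X : 0 < (X - beta) ^+ 2 + gamma ^+ 2.
Proof. by rewrite ltr_wpDl ?sqr_ge0// exprn_gt0. Qed.

Lemma is_derive_cauchy_cdf X : is_derive X 1 cauchy_cdf (cauchy_pdf beta gamma X).
Proof.
pose g X := (X - beta) / gamma.
have dg : is_derive X 1 g gamma^-1.
  by rewrite /g; apply: is_derive_eq; rewrite /GRing.scale/=; ring.
have da := is_derive1_comp (is_derive1_atan (g X)) dg.
have dc : is_derive X 1 (fun X => 2^-1 + (atan \o g) X * pi^-1)
    (0 + ((atan \o g) X *: 0 + pi^-1 *: ((1 + g X ^+ 2)^-1 * gamma^-1))).
  by apply: is_deriveD; exact: is_deriveM.
apply: (is_derive_eq dc).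
rewrite /GRing.scale/= /g /cauchy_pdf.
have := cauchy_denominator_gt0 X; move: (X - beta) => u u0.
have p0 := pi_gt0 R; move: (pi : R) p0 => p p0.
by field; rewrite (gt_eqF u0) (gt_eqF p0) (gt_eqF gamma_gt0).
Qed.

Lemma cauchy_pdf_ge0 X : 0 <= cauchy_pdf beta gamma X.
Proof. by rewrite mulr_ge0 ?divr_ge0 ?invr_ge0 ?pi_ge0// ltW. Qed.

Lemma cauchy_pdf_le X : cauchy_pdf beta gamma X <= (pi * gamma)^-1.
Proof.
rewrite /cauchy_pdf ler_pdivrMr// invfM.
rewrite [leRHS](_ : _ = gamma / pi + (X - beta) ^+ 2 / (pi * gamma)).
  by rewrite lerDl divr_ge0 ?sqr_ge0// mulr_ge0 ?pi_ge0// ltW.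
have p0 := pi_gt0 R; move: (pi : R) p0 => p p0.
by field; rewrite (gt_eqF p0) (gt_eqF gamma_gt0).
Qed.

Lemma continuous_cauchy_pdf : continuous (cauchy_pdf beta gamma).
Proof.
move=> x; rewrite /cauchy_pdf.
apply: cvgM; first exact: cvg_cst.
apply: cvgV; first by rewrite gt_eqF.
apply: cvgD; last exact: cvg_cst.
by apply: cvgM; (apply: cvgB; [exact: cvg_id|exact: cvg_cst]).
Qed.

Lemma measurable_cauchy_pdf :
  measurable_fun setT (cauchy_pdf beta gamma : measurableTypeR R -> R).
Proof. by apply: continuous_measurable_fun; exact: continuous_cauchy_pdf. Qed.

Lemma log_cauchy_pdfE x :
  log_cauchy_pdf beta gamma x = cauchy_pdf beta gamma (ln x) * x^-1.
Proof. by rewrite /log_cauchy_pdf /cauchy_pdf !invfM; ring. Qed.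

Lemma is_derive_log_cauchy_cdf x : 0 < x ->
  is_derive x 1 log_cauchy_cdf (log_cauchy_pdf beta gamma x).
Proof.
move=> x0; rewrite log_cauchy_pdfE.
exact: is_derive1_comp (is_derive_cauchy_cdf _) (is_derive1_ln x0).
Qed.

Lemma log_cauchy_pdf_ge0 x : 0 < x -> 0 <= log_cauchy_pdf beta gamma x.
Proof. by move=> x0; rewrite log_cauchy_pdfE mulr_ge0 ?cauchy_pdf_ge0 ?invr_ge0 ?ltW. Qed.

Lemma measurable_log_cauchy_pdf :
  measurable_fun setT (log_cauchy_pdf beta gamma : measurableTypeR R -> R).
Proof.
rewrite (_ : log_cauchy_pdf _ _ = (fun x => cauchy_pdf beta gamma (ln x) * x^-1)).
  apply: measurable_funM.
    exact: measurableT_comp measurable_cauchy_pdf (@measurable_ln R).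
  exact: measurable_funV.
by apply/funext => x; rewrite log_cauchy_pdfE.
Qed.

Lemma ln_lipschitz (a x y : R) : 0 < a -> a <= x -> x <= y ->
  0 <= ln y - ln x <= (y - x) / a.
Proof.
move=> a0 ax xy; have x0 : 0 < x by exact: lt_le_trans ax.
have y0 : 0 < y by exact: lt_le_trans xy.
rewrite subr_ge0 ler_ln ?posrE// xy/= -ln_div ?posrE//.
have -> : y / x = 1 + (y - x) / x by field; rewrite gt_eqF.
have d0 : 0 <= (y - x) / x by rewrite divr_ge0 ?subr_ge0// ltW.
rewrite (le_trans (le_ln1Dx _))//; first by rewrite (lt_le_trans _ d0)// ltrN10.
by rewrite ler_wpM2l ?subr_ge0// lef_pV2.
Qed.

Lemma cauchy_cdf_continuous : continuous cauchy_cdf.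
Proof.
move=> z; have dz := is_derive_cauchy_cdf z.
by apply/differentiable_continuous/derivable1_diffP; exact: ex_derive.
Qed.

Lemma cauchy_cdf_lipschitz X Y : X <= Y ->
  cauchy_cdf Y - cauchy_cdf X <= (pi * gamma)^-1 * (Y - X).
Proof.
move=> XY.
have [||z _ ->] := @MVT_segment R cauchy_cdf (cauchy_pdf beta gamma) X Y XY.
- by move=> z _; exact: is_derive_cauchy_cdf.
- by apply: continuous_subspaceT; exact: cauchy_cdf_continuous.
by rewrite ler_wpM2r ?subr_ge0// cauchy_pdf_le.
Qed.

Lemma cauchy_integral X Y : X <= Y ->
  (\int[lebesgue_measure]_(x in `]X, Y]) (cauchy_pdf beta gamma x)%:E =
   (cauchy_cdf Y - cauchy_cdf X)%:E)%E.
Proof.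
rewrite le_eqVlt => /orP[/eqP ->|XY].
  by rewrite set_itvoc0// integral_set0 subrr.
rewrite integral_itv_obnd_cbnd; last first.
  by apply/measurable_EFinP; apply: measurable_funTS; exact: measurable_cauchy_pdf.
rewrite (@continuous_FTC2 _ _ cauchy_cdf)//.
- by apply: continuous_subspaceT; exact: continuous_cauchy_pdf.
- split.
  + by move=> z _; have dz := is_derive_cauchy_cdf z; exact: ex_derive.
  + by apply: cvg_at_right_filter; exact: cauchy_cdf_continuous.
  + by apply: cvg_at_left_filter; exact: cauchy_cdf_continuous.
- move=> z _; have dz := is_derive_cauchy_cdf z.
  by rewrite derive1E; exact: derive_val.
Qed.

End cauchy_cdf.

Section power_law.
Context {R : realType} (nu : borel_prob R) (t : R).
Hypothesis nu_pos : nu `]0, +oo[%classic = 1%E.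
Hypothesis t0 : 0 < t.
Implicit Types (X Y : R).

Lemma power_law_interval X Y :
  fine (nu `]expR (t * X), expR (t * Y)[%classic) <=
    fine (power_law nu t^-1 `]expR X, expR Y]%classic) /\
  fine (power_law nu t^-1 `]expR X, expR Y]%classic) <=
    fine (nu `[expR (t * X), expR (t * Y)]%classic).
Proof.
have pE y : 0 < y -> power_fun t^-1 y = expR (t^-1 * ln y).
  by move=> y0; rewrite /power_fun/= /powR gt_eqF.
have mI (i : interval R) : measurable ([set` i] : set (measurableTypeR R)).
  exact: measurable_itv.
have mP : measurable (power_fun t^-1 @^-1` `]expR X, expR Y]%classic :
    set (measurableTypeR R)).
  by rewrite -[X in measurable X]setTI; exact: measurable_funPT.
have lnP (y : R) : 0 < y -> expR (ln y) = y by move=> y0; rewrite lnK.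
have tX y Z : (Z < t^-1 * y) = (t * Z < y).
  by rewrite -ltr_pdivlMl ?invr_gt0// invrK.
have Xt y Z : (t^-1 * y <= Z) = (y <= t * Z).
  by rewrite ler_pdivrMl.
have mD : measurable (`]0, +oo[%classic : set (measurableTypeR R)) by exact: mI.
have Dc : nu (~` `]0, +oo[%classic) = 0%E by rewrite probability_setC// nu_pos subee.
split; apply: fine_le; rewrite ?fin_num_measure//.
  apply: le_measure; rewrite ?inE//.
  move=> y /=; rewrite !in_itv/= => /andP[h1 h2].
  have y0 : 0 < y by rewrite (lt_trans _ h1) ?expR_gt0.
  rewrite pE// ltr_expR ler_expR tX Xt.
  by rewrite -ltr_expR -ler_expR (lnP y)// h1 ltW.
rewrite -[leLHS]/(nu (power_fun t^-1 @^-1` `]expR X, expR Y])).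
rewrite -[leRHS]adde0 -Dc.
apply: le_trans (measureU2 _ _ _); [|exact: mI|exact: measurableC].
apply: le_measure; rewrite ?inE//.
  by apply: measurableU; [exact: mI|exact: measurableC].
move=> y /= ypre; have [y0|y0] := ltP 0 y; [left|right]; last first.
  by rewrite in_itv/= andbT ltNge y0.
move: ypre; rewrite !in_itv/= pE// ltr_expR ler_expR tX Xt => /andP[h1 h2].
by rewrite -(lnP y)// !ler_expR ltW.
Qed.

End power_law.

Section increments.
Context {R : realType} (mu : borel_prob R) (v : Cplx R -> Cplx R)
  (v_mu : is_v_function mu v) (mupow : R -> borel_prob R)
  (mupowP : forall t : R, 0 <= t -> is_free_mult_power mu t (mupow t))
  (I : set R) (I_open : open I) (I1 : I 1)
  (ve : Cplx R -> Cplx R) (beta gamma : R)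
  (ve_ext : forall z, Omega z -> ve z = v z)
  (ve_cont : {within @Omega R `|` [set x%:C | x in I], continuous ve})
  (ve1 : ve 1 = (- beta) +i* gamma)
  (gamma_gt0 : 0 < gamma).

Local Notation law t := (power_law (mupow t) t^-1).
Local Notation cdf := (log_cauchy_cdf beta gamma).
Local Notation pdf := (log_cauchy_pdf beta gamma).

(** The error bound e a (ln y - ln x) obtained in logarithmic coordinates is at
    most e (y - x), since ln has slope at most 1 / a beyond a. *)
Lemma power_law_increments (a b e : R) : 0 < a -> a < b -> 0 < e ->
  \forall t \near 0^'+, forall x y, a < x -> x <= y -> y < b ->
    `|fine (law t `]x, y]%classic) - (cdf y - cdf x)| <= e * (y - x).
Proof.
move=> a0 ab e0.
pose N := 1 + Num.max `|ln a| `|ln b|.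
have N0 : 0 < N by rewrite ltr_pwDl// le_max normr_ge0.
have ea0 : 0 < e * a by rewrite mulr_gt0.
have [t0 t00 est] := small_time_estimate v_mu ve_ext I_open I1 ve_cont ve1 gamma_gt0 N0 ea0.
near=> t => x y ax xy yb.
have t_gt0 : 0 < t by near: t; exact: nbhs_right_gt.
have tt0 : t < t0 by near: t; exact: nbhs_right_lt.
have [nu_pos _] := mupowP (ltW t_gt0).
have tI : 0 < t < t0 by rewrite t_gt0.
have [b0 b00 Mf] := est _ _ tI (mupowP (ltW t_gt0)).
have x0 : 0 < x by exact: lt_trans ax.
have y0 : 0 < y by exact: lt_le_trans xy.
have b_gt0 : 0 < b by exact: lt_trans ab.
have lxy : ln x <= ln y by rewrite ler_ln.
have Nx : - N < ln x.
  have : ln a < ln x by rewrite ltr_ln.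
  have : `|ln a| <= N - 1 by rewrite /N addrAC subrr add0r le_max lexx.
  by rewrite ler_norml => /andP[]; lra.
have yN : ln y < N.
  have : ln y < ln b by rewrite ltr_ln.
  have : `|ln b| <= N - 1 by rewrite /N addrAC subrr add0r le_max lexx orbT.
  by rewrite ler_norml => /andP[]; lra.
have [h1 h2] := interval_masses t_gt0 (is_derive_cauchy_cdf beta gamma_gt0)
  (ltW ea0) b00 Mf Nx lxy yN.
have [h3 h4] := power_law_interval nu_pos t_gt0 (ln x) (ln y).
rewrite !lnK ?posrE// in h3 h4.
have /andP[_ h5] := ln_lipschitz a0 (ltW ax) xy.
have {}h5 : e * a * (ln y - ln x) <= e * (y - x).
  by rewrite -mulrA ler_pM2l// mulrC -ler_pdivlMr.
by rewrite ler_norml /log_cauchy_cdf; lra.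
Unshelve. all: by end_near. Qed.

Lemma log_cauchy_cdf_lipschitz (a x y : R) : 0 < a -> a <= x -> x <= y ->
  cdf y - cdf x <= (pi * gamma)^-1 / a * (y - x).
Proof.
move=> a0 ax xy; have /andP[l1 l2] := ln_lipschitz a0 ax xy.
rewrite subr_ge0 in l1.
apply: le_trans (cauchy_cdf_lipschitz beta gamma_gt0 l1) _.
rewrite mulrAC -mulrA ler_wpM2l// invr_ge0 mulr_ge0 ?pi_ge0// ltW//.
Qed.

End increments.

(** * Densities for small times and for the limit law *)

Lemma compact_in_open_interval (R : realType) (K : set R) : compact K ->
  K `<=` `]0, +oo[%classic ->
  exists a b : R, [/\ 0 < a, a < b & forall x, K x -> a < x < b].
Proof.
move=> cK Kpos; have [->|K0] := eqVneq K set0.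
  by exists 1, 2; split => //; rewrite ltr1n.
have {}K0 : K !=set0 by exact/set0P.
have cid : {within K, continuous (id : R -> R)}.
  by apply: continuous_subspaceT => x; exact: cvg_id.
have [p /set_mem Kp pmin] := compact_EVT_min K0 cK cid.
have [q /set_mem Kq qmax] := compact_EVT_max K0 cK cid.
have p0 : 0 < p by have := Kpos _ Kp; rewrite /= in_itv/= andbT.
have pq : p <= q by apply: (qmax p); exact: mem_set.
exists (p / 2), (q + 1); split; [by rewrite divr_gt0|by lra|].
move=> x Kx; have := pmin x (mem_set Kx); have := qmax x (mem_set Kx) => /=; lra.
Qed.

Section small_time_density.
Context {R : realType} (mu : borel_prob R) (v : Cplx R -> Cplx R)
  (v_mu : is_v_function mu v) (mupow : R -> borel_prob R)
  (mupowP : forall t : R, 0 <= t -> is_free_mult_power mu t (mupow t))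
  (I : set R) (I_open : open I) (I1 : I 1)
  (ve : Cplx R -> Cplx R) (beta gamma : R)
  (ve_ext : forall z, Omega z -> ve z = v z)
  (ve_cont : {within @Omega R `|` [set x%:C | x in I], continuous ve})
  (ve1 : ve 1 = (- beta) +i* gamma)
  (gamma_gt0 : 0 < gamma).

Local Notation law t := (power_law (mupow t) t^-1).
Local Notation cdf := (log_cauchy_cdf beta gamma).
Local Notation pdf := (log_cauchy_pdf beta gamma).

(** The law has a density as soon as its increments are Lipschitz, which holds for
    t small because those of the Cauchy law are. *)
Lemma small_time_density (a b : R) : 0 < a -> a < b ->
  exists f : R -> R -> R,
    (\forall t \near 0^'+,
      [/\ measurable_fun setT (f t : measurableTypeR R -> R),
          forall x, a < x < b -> 0 <= f t x &
          forall B : set R, measurable (B : set (measurableTypeR R)) ->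
            B `<=` `]a, b[%classic ->
            law t B = (\int[lebesgue_measure]_(x in B) (f t x)%:E)%E]) /\
    forall e, 0 < e -> \forall t \near 0^'+,
      forall x, a < x < b -> `|f t x - pdf x| <= e.
Proof.
move=> a0 ab.
have a20 : 0 < a / 2 by rewrite divr_gt0.
have a2b : a / 2 < b + 1 by lra.
pose C := (pi * gamma)^-1 / a + 1.
pose lip t := forall x y, a <= x -> x <= y -> y <= b ->
  fine (law t `]x, y]%classic) <= C * (y - x).
have near_lip : \forall t \near 0^'+, lip t.
  have := power_law_increments v_mu mupowP I_open I1 ve_ext ve_cont ve1 gamma_gt0
    a20 a2b ltr01.
  apply: filterS => t ht x y ax xy yb.
  have xa : a / 2 < x by lra.
  have by1 : y < b + 1 by lra.
  have := ht x y xa xy by1; rewrite ler_norml => /andP[_].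
  have := log_cauchy_cdf_lipschitz beta gamma_gt0 a0 ax xy.
  by rewrite /C; lra.
have /choice[f fP] : forall t, exists f : R -> R, lip t ->
    [/\ measurable_fun setT (f : measurableTypeR R -> R),
    forall x, a < x < b -> 0 <= f x,
    forall B : set R, measurable (B : set (measurableTypeR R)) ->
      B `<=` `]a, b[%classic ->
      law t B = (\int[lebesgue_measure]_(x in B) (f x)%:E)%E &
    forall e, (forall x y, a < x -> x <= y -> y < b ->
        `|fine (law t `]x, y]%classic) - (cdf y - cdf x)| <= e * (y - x)) ->
      forall x, a < x < b -> `|f x - pdf x| <= e].
  move=> t; have [lt|nlt] := pselect (lip t); last by exists (cst 0).
  have [f fP] := @density_of_increments _ _ _ _ _ lt pdf cdf ab
    (measurable_log_cauchy_pdf beta gamma_gt0)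
    (fun x xab => log_cauchy_pdf_ge0 beta gamma_gt0 (lt_trans a0 (andP xab).1))
    (fun x xab => is_derive_log_cauchy_cdf beta gamma_gt0 (lt_trans a0 (andP xab).1)).
  by exists f.
exists f; split.
  by apply: filterS near_lip => t /fP[].
move=> e e0.
have := power_law_increments v_mu mupowP I_open I1 ve_ext ve_cont ve1 gamma_gt0
    a0 ab e0.
by move=> h; near=> t; have [//|_ _ _ ft] := fP t _; [near: t|apply: ft; near: t].
Unshelve. all: by end_near. Qed.

End small_time_density.

Section exp_cauchy.
Context {R : realType} d {T : measurableType d} (P : probability T R)
  (X : {RV P >-> measurableTypeR R}) (beta gamma : R).
Hypothesis gamma_gt0 : 0 < gamma.
Hypothesis X_cauchy : has_cauchy_law X beta gamma.

Local Notation L := (distribution P (exp_fun \o X)).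
Local Notation pdf := (log_cauchy_pdf beta gamma).

Lemma exp_cauchy_pos : L `]0, +oo[%classic = 1%E.
Proof.
rewrite -(@probability_setT _ _ _ P); congr (P _).
by apply/seteqP; split => // y _ /=; rewrite in_itv/= andbT expR_gt0.
Qed.

Lemma exp_cauchy_increment (x y : R) : 0 < x -> x <= y ->
  fine (L `]x, y]%classic) = log_cauchy_cdf beta gamma y - log_cauchy_cdf beta gamma x.
Proof.
move=> x0 xy; have y0 : 0 < y by exact: lt_le_trans xy.
have -> : L `]x, y]%classic = distribution P X `]ln x, ln y]%classic.
  have hx (z : R) : (ln x < z) = (x < expR z) by rewrite -ltr_expR lnK.
  have hy (z : R) : (z <= ln y) = (expR z <= y) by rewrite -ler_expR lnK.
  by congr (P _); apply/seteqP; split => z /=; rewrite !in_itv/= hx hy.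
rewrite X_cauchy; last exact: measurable_itv.
by rewrite (cauchy_integral beta gamma_gt0)//= ler_ln.
Qed.

(** The increments of the law are exactly those of log_cauchy_cdf, so any density
    given by density_of_increments agrees with log_cauchy_pdf. *)
Lemma exp_cauchy_density (a b : R) (B : set R) : 0 < a -> a < b ->
  measurable (B : set (measurableTypeR R)) -> B `<=` `]a, b[%classic ->
  L B = (\int[lebesgue_measure]_(x in B) (pdf x)%:E)%E.
Proof.
move=> a0 ab mB BJ.
have lip x y : a <= x -> x <= y -> y <= b ->
    fine (L `]x, y]%classic) <= (pi * gamma)^-1 / a * (y - x).
  move=> ax xy _; rewrite exp_cauchy_increment//; last exact: lt_le_trans ax.
  exact: log_cauchy_cdf_lipschitz.
have [f [_ _ fE fpdf]] := density_of_increments lip ab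
  (measurable_log_cauchy_pdf beta gamma_gt0)
  (fun x xab => log_cauchy_pdf_ge0 beta gamma_gt0 (lt_trans a0 (andP xab).1))
  (fun x xab => is_derive_log_cauchy_cdf beta gamma_gt0 (lt_trans a0 (andP xab).1)).
rewrite fE//; apply: eq_integral => x /set_mem/BJ; rewrite /= in_itv/= => xab.
have : `|f x - pdf x| <= 0.
  apply: fpdf => // {xab}x y ax xy yb.
  by rewrite exp_cauchy_increment ?subrr ?normr0 ?mul0r//; exact: lt_trans ax.
by rewrite normr_le0 subr_eq0 => /eqP ->.
Qed.

End exp_cauchy.

(** * Weak convergence from domination on compact intervals *)

Section near_domination.
Context {R : realType} d {T : measurableType d}.
Implicit Types (l m : probability T R) (h : T -> R) (c : R).

(** The integral is monotone in the measure, so that replacing m by l + k costs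
    at most the mass of k times the bound on h. *)
Lemma Rintegral_dominated l m (k : {measure set T -> \bar R}) h c (delta : R) :
  (forall B, measurable B -> (m B <= l B + k B)%E) -> (k setT <= delta%:E)%E ->
  measurable_fun setT h -> 0 <= c -> (forall x, 0 <= h x <= c) ->
  \int[m]_x h x <= \int[l]_x h x + c * delta.
Proof.
move=> mlk kd mh c0 hc.
have mE : measurable_fun setT (fun x => (h x)%:E) by exact/measurable_EFinP.
have h0 x : (0 <= (h x)%:E)%E by rewrite lee_fin; have /andP[] := hc x.
have bh : bounded_measurable setT h.
  by split => //; exists c => x _; have /andP[x0 xc] := hc x; rewrite ger0_norm.
have hfin (p : probability T R) : (\int[p]_x (h x)%:E)%E = (\int[p]_x h x)%:E.
  rewrite /Rintegral fineK//; apply: integrable_fin_num => //.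
  exact: bounded_measurable_integrable.
rewrite -lee_fin EFinD -!hfin.
have mlk' B : measurable B -> (m B <= measure_add l k B)%E.
  by move=> mB; rewrite measure_addE mlk.
apply: (le_trans (ge0_le_measure_integral mlk' measurableT h0 mE)).
rewrite ge0_integral_measure_add//; apply: leeD => //.
apply: (@le_trans _ _ (\int[k]_x (cst c%:E) x)%E).
  by apply: ge0_le_integral => // x _; rewrite lee_fin//; have /andP[] := hc x.
by rewrite integral_cst// EFinM lee_pmul.
Qed.

Lemma Rintegral_affine m h (c s : R) : bounded_measurable setT h ->
  \int[m]_x (c + s * h x) = c + s * \int[m]_x h x.
Proof.
move=> bh; have bsh := bounded_measurableZ s bh.
have bc := @bounded_measurable_cst R _ T setT c.
rewrite RintegralD//; do ?exact: bounded_measurable_integrable.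
rewrite RintegralZl//; last exact: bounded_measurable_integrable.
by rewrite Rintegral_cst// [X in fine X]probability_setT mulr1.
Qed.

End near_domination.

Section convergence_of_densities.
Context {R : realType}.
Implicit Types (l m : borel_prob R) (h : R -> R).
Local Notation lambda := (@lebesgue_measure R).

Lemma Rintegral_near_density l m h (a b c e delta : R) : a < b ->
  0 <= e -> 0 <= c ->
  (forall B : set R, measurable (B : set (measurableTypeR R)) ->
     B `<=` `]a, b[%classic -> (m B <= l B + e%:E * lambda B)%E) ->
  (m (~` `]a, b[%classic) <= delta%:E)%E ->
  measurable_fun setT (h : measurableTypeR R -> R) -> (forall x, 0 <= h x <= c) ->
  \int[m]_x h x <= \int[l]_x h x + c * (e * (b - a) + delta).
Proof.
move=> ab e0 c0 ml md mh hc.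
have mJ : measurable (`]a, b[%classic : set (measurableTypeR R)).
  exact: measurable_itv.
have mJc := measurableC mJ.
(* Inside the interval the excess of m over l is at most e times the Lebesgue
   measure; outside, all of m is counted as excess. *)
pose k : {measure set (measurableTypeR R) -> \bar R} :=
  measure_add (mscale (NngNum e0) (mrestr lambda mJ)) (mrestr m mJc).
have kE B : k B = (e%:E * lambda (B `&` `]a, b[%classic) + m (B `&` ~` `]a, b[%classic))%E.
  exact: (measure_addE _ _ B).
clearbody k.
apply: (@Rintegral_dominated _ _ _ l m k) => //.
- move=> B mB; rewrite kE -{1}(setIT B) -(setUv `]a, b[%classic) setIUr.
  have mBJ := measurableI _ _ mB mJ; have mBJc := measurableI _ _ mB mJc.
  rewrite measureU//; last by rewrite setIACA setICr setI0.
  rewrite addeA leeD2r// (le_trans (ml _ _ _))//.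
  by rewrite leeD2r// le_measure ?inE.
- rewrite kE !setTI EFinD leeD//.
  by rewrite lebesgue_measure_itv/= lte_fin ab.
Qed.

Lemma probability_exhausted_by_intervals l (delta : R) :
  l `]0, +oo[%classic = 1%E -> 0 < delta ->
  exists a b : R, [/\ 0 < a, a < b & ((1 - delta)%:E < l `]a, b[%classic)%E].
Proof.
move=> l1 d0.
pose F (n : nat) : set (measurableTypeR R) := `]n.+2%:R^-1, n.+2%:R[%classic.
have mF n : measurable (F n) by exact: measurable_itv.
have FU : \bigcup_n F n = `]0, +oo[%classic.
  apply/seteqP; split => [x [n _]|x]; rewrite /F/= !in_itv/= andbT.
    by move=> /andP[+ _]; apply: lt_trans; rewrite invr_gt0.
  move=> x0; pose n := Num.truncn (x + x^-1).
  have xn : x + x^-1 < n.+2%:R.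
    apply: (@lt_le_trans _ _ n.+1%:R); last by rewrite ler_nat.
    exact: Num.Theory.truncnS_gt.
  exists n => //=; rewrite in_itv/=.
  rewrite invf_plt ?posrE// (le_lt_trans _ xn)/= ?lerDr ?ltW//.
  by rewrite (le_lt_trans _ xn)// lerDl invr_ge0 ltW.
have Fmono : {homo F : n p / (n <= p)%N >-> (n <= p)%O}.
  move=> n p np; apply/subsetPset => x; rewrite /F/= !in_itv/= => /andP[h1 h2].
  have np2 : n.+2%:R <= p.+2%:R :> R by rewrite ler_nat.
  rewrite (lt_le_trans h2)// andbT (le_lt_trans _ h1)//.
  by rewrite lef_pV2 ?posrE.
have : (l (F n) @[n --> \oo] --> l (\bigcup_n F n))%E.
  by apply: nondecreasing_cvg_mu => //; rewrite FU; exact: measurable_itv.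
rewrite FU l1 => /fine_cvgP[_ /cvgrPdist_lt/(_ _ d0)[n _ /(_ n (leqnn n))]] /=.
rewrite ltr_norml => /andP[_ hn].
exists n.+2%:R^-1, n.+2%:R; split => //.
  by rewrite (@lt_trans _ _ 1)// ?invf_lt1// ltr1n.
have -> : l `]n.+2%:R^-1, n.+2%:R[%classic = (fine (l (F n)))%:E.
  by rewrite fineK// fin_num_measure.
rewrite lte_fin; move: hn => /=; lra.
Qed.

(** No mass escapes: an interval that carries nearly all of l carries nearly all
    of m t for t small. Domination only bounds integrals of nonnegative functions
    from above, so it is applied to both c + g and c - g. *)
Lemma weak_cvg_of_local_domination (m : R -> borel_prob R) l :
  l `]0, +oo[%classic = 1%E ->
  (forall a b e : R, 0 < a -> a < b -> 0 < e -> \forall t \near 0^'+,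
     forall B : set R, measurable (B : set (measurableTypeR R)) ->
       B `<=` `]a, b[%classic ->
       (m t B <= l B + e%:E * lambda B)%E /\
       (l B <= m t B + e%:E * lambda B)%E) ->
  weak_cvg 0^'+ m l.
Proof.
move=> l1 ml g cg [c0 gc0].
pose c := 1 + c0.
have gc x : `|g x| < c by rewrite (le_lt_trans (gc0 x))// /c ltrDr.
have c_gt0 : 0 < c by exact: le_lt_trans (gc 0).
apply/cvgrPdist_le => eta eta0.
pose delta := eta / (8 * c).
have delta0 : 0 < delta by rewrite divr_gt0// mulr_gt0.
have [a [b [a0 ab lab]]] := probability_exhausted_by_intervals l1 delta0.
pose e := delta / (b - a).
have e0 : 0 < e by rewrite divr_gt0 ?subr_gt0.
have eab : e * (b - a) = delta by rewrite /e divfK// subr_eq0 gt_eqF.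
have mg : measurable_fun setT (g : measurableTypeR R -> R).
  exact: continuous_measurable_fun.
have mJ : measurable (`]a, b[%classic : set (measurableTypeR R)).
  exact: measurable_itv.
have {}lab : 1 - delta < fine (l `]a, b[%classic).
  by rewrite -lte_fin fineK// fin_num_measure.
near=> t.
have mlt : forall B : set R, measurable (B : set (measurableTypeR R)) ->
    B `<=` `]a, b[%classic -> (m t B <= l B + e%:E * lambda B)%E /\
       (l B <= m t B + e%:E * lambda B)%E.
  by near: t; exact: ml.
have lJc : (l (~` `]a, b[%classic) <= (2 * delta)%:E)%E.
  rewrite probability_setC// -(fineK (fin_num_measure l _ mJ)) -EFinB lee_fin.
  lra.
have mJc : (m t (~` `]a, b[%classic) <= (2 * delta)%:E)%E.
  have [_] := mlt _ mJ (@subset_refl _ _).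
  rewrite lebesgue_measure_itv/= lte_fin ab -EFinB -EFinM eab.
  rewrite probability_setC// -(fineK (fin_num_measure l _ mJ)).
  rewrite -(fineK (fin_num_measure (m t) _ mJ)) -EFinD -EFinB !lee_fin.
  lra.
have bg : bounded_measurable setT (g : measurableTypeR R -> R).
  by split => //; exists c0 => x _.
have bound (s : R) : `|s| = 1 ->
    \int[m t]_x (c + s * g x) <= \int[l]_x (c + s * g x) + 2 * c * (e * (b - a) + 2 * delta).
  move=> s1; apply: Rintegral_near_density => //.
  - exact: ltW.
  - by rewrite mulr_ge0// ltW.
  - by move=> B mB BJ; have [] := mlt B mB BJ.
  - by apply: measurable_funD => //; exact: measurable_funM.
  - move=> x; have : `|s * g x| <= c by rewrite normrM s1 mul1r ltW.
    by rewrite ler_norml; lra.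
have := bound 1 (normr1 _); have := bound (-1) (normrN1 _).
rewrite !(Rintegral_affine _ _ _ bg) eab ler_norml.
have -> : 2 * c * (delta + 2 * delta) = 3 / 4 * eta.
  by rewrite /delta; field; rewrite gt_eqF.
lra.
Unshelve. all: by end_near. Qed.

End convergence_of_densities.

(** * The convergence theorem *)

Lemma density_domination (R : realType) (p q : borel_prob R) (f g : R -> R)
    (a b e : R) (B : set R) : 0 <= e ->
  measurable (B : set (measurableTypeR R)) -> B `<=` `]a, b[%classic ->
  measurable_fun setT (f : measurableTypeR R -> R) ->
  measurable_fun setT (g : measurableTypeR R -> R) ->
  (forall x, a < x < b -> 0 <= f x) -> (forall x, a < x < b -> 0 <= g x) ->
  (forall x, a < x < b -> f x <= g x + e) ->
  p B = (\int[lebesgue_measure]_(x in B) (f x)%:E)%E ->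
  q B = (\int[lebesgue_measure]_(x in B) (g x)%:E)%E ->
  (p B <= q B + e%:E * lebesgue_measure B)%E.
Proof.
move=> e0 mB BJ mf mg f0 g0 fg -> ->.
have Bab x : B x -> a < x < b by move=> /BJ; rewrite /= in_itv.
have mfE : measurable_fun B (fun x => (f x)%:E).
  by apply/measurable_EFinP; exact: measurable_funTS.
have mgE : measurable_fun B (fun x => (g x)%:E).
  by apply/measurable_EFinP; exact: measurable_funTS.
rewrite -integral_cst// -ge0_integralD//; last first.
  by move=> x /Bab/g0; rewrite lee_fin.
apply: ge0_le_integral => //.
- by move=> x /Bab/f0; rewrite lee_fin.
- exact: emeasurable_funD.
- by move=> x /Bab/fg; rewrite -EFinD lee_fin.
Qed.

Theorem theorem4p1 (R : realType) (mu : borel_prob R)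
  (mu_pos : mu `]0, +oo[%classic = 1%E)
  (mu_id : free_mult_inf_divisible mu)
  (v : Cplx R -> Cplx R) (v_mu : is_v_function mu v)
  (mupow : R -> borel_prob R)
  (mupowP : forall t : R, 0 <= t -> is_free_mult_power mu t (mupow t))
  (I : set R) (I_open : open I) (I_itv : is_interval I) (I1 : I 1)
  (ve : Cplx R -> Cplx R) (beta gamma : R)
  (ve_ext : forall z, Omega z -> ve z = v z)
  (ve_cont : {within @Omega R `|` [set x%:C | x in I], continuous ve})
  (ve1 : ve 1 = (- beta) +i* gamma)
  (gamma_gt0 : 0 < gamma) :
  (forall K : set R, compact K -> K `<=` `]0, +oo[%classic ->
     exists f : R -> R -> R,
       (\forall t \near 0^'+,
          abs_continuous_on K (power_law (mupow t) t^-1) /\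
          is_density_on K (power_law (mupow t) t^-1) (f t)) /\
       (forall e : R, 0 < e -> \forall t \near 0^'+,
          forall x, K x -> `|f t x - log_cauchy_pdf beta gamma x| < e)) /\
  (forall (d : measure_display) (T : measurableType d) (P : probability T R)
     (X : {RV P >-> measurableTypeR R}), has_cauchy_law X beta gamma ->
     weak_cvg 0^'+ (fun t => power_law (mupow t) t^-1)
       (distribution P (exp_fun \o X))).
Proof.
have dens := small_time_density v_mu mupowP I_open I1 ve_ext ve_cont ve1 gamma_gt0.
split=> [K cK Kpos|d T P X X_cauchy].
  have [a [b [a0 ab Kab]]] := compact_in_open_interval cK Kpos.
  have [f [f_density f_close]] := dens a b a0 ab.
  exists f; split.
    apply: filterS f_density => t [mf f0 fE].
    have BJ B : B `<=` K -> B `<=` `]a, b[%classic.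
      by move=> BK x /BK/Kab; rewrite /= in_itv.
    split=> [B mB BK B0|].
      rewrite fE//; last exact: BJ.
      apply: null_set_integral => //.
      by apply/measurable_EFinP; exact: measurable_funTS.
    split; first exact: measurable_funTS.
      by move=> x /Kab/f0.
    by move=> B mB BK; rewrite fE//; exact: BJ.
  move=> e e0; have e20 : 0 < e / 2 by rewrite divr_gt0.
  apply: filterS (f_close _ e20) => t ft x /Kab/ft h.
  by rewrite (le_lt_trans h)// ltr_pdivrMr// ltr_pMr// ltr1n.
apply: weak_cvg_of_local_domination; first exact: exp_cauchy_pos.
move=> a b e a0 ab e0; have [f [f_density f_close]] := dens a b a0 ab.
near=> t => B mB BJ.
have [mf f0 fE] : [/\ measurable_fun setT (f t : measurableTypeR R -> R),
    forall x, a < x < b -> 0 <= f t x &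
    forall B : set R, measurable (B : set (measurableTypeR R)) ->
      B `<=` `]a, b[%classic -> power_law (mupow t) t^-1 B =
        (\int[lebesgue_measure]_(x in B) (f t x)%:E)%E].
  by near: t.
have close : forall x, a < x < b -> `|f t x - log_cauchy_pdf beta gamma x| <= e.
  by near: t; exact: f_close.
have LE := exp_cauchy_density gamma_gt0 X_cauchy a0 ab mB BJ.
have g0 x : a < x < b -> 0 <= log_cauchy_pdf beta gamma x.
  by move=> /andP[ax _]; apply: log_cauchy_pdf_ge0 => //; exact: lt_trans ax.
have mg := measurable_log_cauchy_pdf beta gamma_gt0.
split; [apply: (density_domination (ltW e0) mB BJ mf mg) => //
       |apply: (density_domination (ltW e0) mB BJ mg mf) => //]; rewrite ?fE//.
  by move=> x /close; rewrite ler_norml; lra.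
by move=> x /close; rewrite ler_norml; lra.
Unshelve. all: by end_near. Qed.
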